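(* For every integer $k\ge 0$, the function $$\xi_k(s)=\pi^{-\frac{s}{2}}\,s(s-1)\,\frac{Z_k(s)}{\Gamma\left(\frac{s}{2}\right)^{k-1}\Gamma\left(\frac{1-s}{2}\right)^k}$$ is entire (that is, all singularities of this meromorphic function on $\mathbb{C}$ are removable).
   Context: Let $\zeta$ be the Riemann zeta function, $\chi(s)=2^s\pi^{s-1}\sin(\pi s/2)\Gamma(1-s)$ (so $\zeta(s)=\chi(s)\zeta(1-s)$), and $$\omega(s)=\frac{\chi'}{\chi}(s)=\log 2\pi-\frac{\Gamma'}{\Gamma}(s)+\frac{\pi}{2}\tan\frac{\pi s}{2}.$$ The meromorphic functions $Z_k$ are defined recursively by $Z_0(s)=\zeta(s)$ and $Z_{k+1}(s)=Z_k'(s)-\frac12\omega(s)Z_k(s)$ for $k\ge 0$. *)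

(* Defs.v *)
From Stdlib Require Import Reals ZArith ClassicalEpsilon.
From Coquelicot Require Import Coquelicot.

Open Scope R_scope.
Open Scope C_scope.

Definition Cexp (z : C) : C :=
  (exp (Re z) * cos (Im z), exp (Re z) * sin (Im z))%R.

Definition Csin (z : C) : C := (Cexp (Ci * z) - Cexp (- (Ci * z))) / (2 * Ci).

(** [a ^ s] for a real base; meaningful for [0 < a] only. *)
Definition Rcpow (a : R) (s : C) : C := Cexp (s * RtoC (ln a)).

Definition CpowZ (z : C) (n : Z) : C :=
  match n with
  | Z0 => 1
  | Zpos p => z ^ Pos.to_nat p
  | Zneg p => / z ^ Pos.to_nat p
  end.

Definition holomorphic_at (f : C -> C) (z : C) : Prop :=
  locally z (fun w => ex_derive (K := C_AbsRing) (V := C_NormedModule) f w).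

Definition entire (f : C -> C) : Prop := forall z, holomorphic_at f z.

(** Componentwise; this is the limit of [u] whenever [u] converges in [C]. *)
Definition CLim_seq (u : nat -> C) : C :=
  (real (Lim_seq (fun n => Re (u n))), real (Lim_seq (fun n => Im (u n)))).

(** [s (s + 1) ... (s + n - 1)] *)
Fixpoint rising (s : C) (n : nat) : C :=
  match n with
  | O => 1
  | S m => rising s m * (s + RtoC (INR m))
  end.

(** Gauss's form of the Gamma function,
    [Gamma s = lim n! n^s / (s (s + 1) ... (s + n))].
    Values at the poles [0, -1, -2, ...] are junk. *)
Definition Gamma (s : C) : C :=
  CLim_seq (fun n => RtoC (INR (fact n)) * Rcpow (INR n) s / rising s (S n)).

(** [F] continues the Dirichlet series [sum_(n >= 1) n^(-s)] analytically to
    the complement of [1]; this determines [F] except at [1]. *)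
Definition zeta_continuation (F : C -> C) : Prop :=
  (forall s : C, (1 < Re s)%R ->
     is_series (K := C_AbsRing) (V := C_NormedModule)
       (fun n : nat => Rcpow (INR (S n)) (- s)) (F s)) /\
  (forall s : C, s <> 1 -> holomorphic_at F s).

(** Chosen by [epsilon]; its value at the pole [1] is junk. *)
Definition zeta : C -> C :=
  epsilon (inhabits (fun _ : C => RtoC 0)) zeta_continuation.

Definition chi (s : C) : C :=
  Rcpow 2 s * Rcpow PI (s - 1) * Csin (RtoC PI * s / 2) * Gamma (1 - s).

Definition omega (s : C) : C := C_derive chi s / chi s.

(** All functions are total; those below have their poles at integers, where
    their values are junk.  Off the integers, derivatives do not depend on
    that junk since the integers are closed in [C]. *)
Fixpoint Zfun (k : nat) (s : C) : C :=
  match k with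
  | O => zeta s
  | S j => C_derive (Zfun j) s - / 2 * omega s * Zfun j s
  end.

Definition xi (k : nat) (s : C) : C :=
  Rcpow PI (- s / 2) * s * (s - 1) *
  (Zfun k s /
   (CpowZ (Gamma (s / 2)) (Z.of_nat k - 1) *
    CpowZ (Gamma ((1 - s) / 2)) (Z.of_nat k))).

Definition is_integer (s : C) : Prop := exists n : Z, s = RtoC (IZR n).

(** A meromorphic function whose singularities all lie in the closed discrete
    set of integers has only removable ones iff it coincides off the integers
    with an entire function. *)
Definition removably_entire (f : C -> C) : Prop :=
  exists g : C -> C, entire g /\ forall s : C, ~ is_integer s -> f s = g s.

(* Main.v *)
(** Write [A s = 1 / Gamma (s / 2)], [B s = 1 / Gamma ((1 - s) / 2)], both entire, and [X = A B].
    Legendre's duplication formula and the coincidence of the zeros of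
    [sin (pi z)] and [1 / (Gamma z Gamma (1 - z))] give [chi = Y A / B] with [Y] entire and
    nowhere zero, so [X omega] is entire.  Hence [V_k = (s - 1) X^k Z_k] obeys the recursion
    [V_(k+1) = X V_k' - V_k (X / (s - 1) + k X' + X omega / 2)] with entire coefficients, starting
    from [V_0 = (s - 1) zeta].  All [V_k] vanish at [-2, -4, ...], because [V_0] and [X] do, and
    [xi_k = pi^(- s / 2) s V_k / A], where the zeros of [A / s] are simple and are these points.

    The function [(s - 1) zeta] is continued by Taylor expansion of
    [(n + 1/2)^(1-s) - (n - 1/2)^(1-s)], which telescopes and expresses it through its values
    at [s + 2, s + 4, ...]; the same relation yields the trivial zeros.  The complex analysis
    rests on Goursat's theorem and Cauchy's formula for rectangles. *)

From Stdlib Require Import Reals ZArith Lra Lia Classical ClassicalEpsilon.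
From Coquelicot Require Import Coquelicot.
Require Import Defs.
Open Scope R_scope.
Open Scope C_scope.

(** * Complex derivatives *)

(** It suffices to know each classical factor of [chi] up to an entire function without zeros: such
    a factor adds an entire term to the logarithmic derivative [omega], and [X] times that term is
    still entire. This is why the reflection and duplication formulas appear with an unspecified
    cofactor. The recursion for [V_k] differentiates, so the coefficients must stay holomorphic
    under derivation; this, together with uniform limits (for [1 / Gamma] and for the remainder
    series of zeta), is what calls for Cauchy's formula. In the recursion [V_k'] may fail to vanish
    at the trivial zeros, but it is multiplied by [X], which does vanish there. Since the zeros of
    [A / s] are simple, vanishing to first order is all that has to be propagated through the [k]
    steps. [zeta] is known only through the property by which it is chosen, so an identity theorem
    has to tie it to the constructed continuation. Values at integers are junk; identities for
    [chi], [omega] and [Zfun] are therefore proved off the integers, and they can be differentiated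
    because this set is open. *)

Lemma Cmod_ge_minus (a b : C) : (Cmod a - Cmod b <= Cmod (a - b))%R.
Proof.
  generalize (Cmod_triangle (a - b) b).
  replace (a - b + b) with a by ring. lra.
Qed.

Lemma Cmod_sub_sym (a b : C) : Cmod (a - b) = Cmod (b - a).
Proof. rewrite <- Cmod_opp. f_equal. ring. Qed.

Lemma Cmod_le_Re_Im (z : C) : (Cmod z <= Rabs (Re z) + Rabs (Im z))%R.
Proof.
  destruct z as [x y].
  assert (E : (x, y) = RtoC x + Ci * RtoC y).
  { unfold Cplus, Cmult, RtoC, Ci. simpl. f_equal; ring. }
  rewrite E at 1. eapply Rle_trans; [apply Cmod_triangle|].
  rewrite Cmod_mult, Cmod_Ci, !Cmod_R, Rmult_1_l. apply Rle_refl.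
Qed.

Lemma im_le_Cmod (z : C) : Rabs (Im z) <= Cmod z.
Proof. eapply Rle_trans; [apply Rmax_r|apply (Rmax_Cmod z)]. Qed.

Lemma Re_minus (a b : C) : Re (a - b) = (Re a - Re b)%R.
Proof. reflexivity. Qed.

Lemma Im_minus (a b : C) : Im (a - b) = (Im a - Im b)%R.
Proof. reflexivity. Qed.

Definition ccont (f : C -> C) (z : C) : Prop :=
  forall e, 0 < e -> exists d, 0 < d /\
    forall w, Cmod (w - z) < d -> Cmod (f w - f z) < e.

Lemma ccont_const (k z : C) : ccont (fun _ => k) z.
Proof.
  intros e He. exists 1%R. split; [lra|]. intros w _.
  replace (k - k) with (RtoC 0) by ring. rewrite Cmod_0. lra.
Qed.

Lemma ccont_id (z : C) : ccont (fun w => w) z.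
Proof. intros e He. exists e. auto. Qed.

Lemma ccont_comp (f g : C -> C) (z : C) :
  ccont g z -> ccont f (g z) -> ccont (fun w => f (g w)) z.
Proof.
  intros Hg Hf e He. destruct (Hf e He) as [d [Hd H]].
  destruct (Hg d Hd) as [d' [Hd' H']]. exists d'. auto.
Qed.

Lemma ccont_plus (f g : C -> C) (z : C) :
  ccont f z -> ccont g z -> ccont (fun w => f w + g w) z.
Proof.
  intros Hf Hg e He.
  destruct (Hf (e/2)%R) as [d1 [Hd1 H1]]; [lra|].
  destruct (Hg (e/2)%R) as [d2 [Hd2 H2]]; [lra|].
  exists (Rmin d1 d2). split; [apply Rmin_glb_lt; auto|]. intros w Hw.
  assert (Cmod (w - z) < d1) by (eapply Rlt_le_trans; [apply Hw|apply Rmin_l]).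
  assert (Cmod (w - z) < d2) by (eapply Rlt_le_trans; [apply Hw|apply Rmin_r]).
  replace (f w + g w - (f z + g z)) with ((f w - f z) + (g w - g z)) by ring.
  eapply Rle_lt_trans; [apply Cmod_triangle|].
  specialize (H1 w H). specialize (H2 w H0). lra.
Qed.

Lemma ccont_locally_bounded (f : C -> C) (z : C) :
  ccont f z -> exists d, 0 < d /\
    forall w, Cmod (w - z) < d -> Cmod (f w) < Cmod (f z) + 1.
Proof.
  intros H. destruct (H 1%R) as [d [Hd H1]]; [lra|]. exists d. split; auto.
  intros w Hw. specialize (H1 w Hw). generalize (Cmod_ge_minus (f w) (f z)). lra.
Qed.

Lemma ccont_mult (f g : C -> C) (z : C) :
  ccont f z -> ccont g z -> ccont (fun w => f w * g w) z.
Proof.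
  intros Hf Hg e He.
  destruct (ccont_locally_bounded f z Hf) as [d0 [Hd0 H0]].
  generalize (Cmod_ge_0 (f z)) (Cmod_ge_0 (g z)). intros Pf Pg.
  assert (HA : 0 < e / (2 * (Cmod (g z) + 1))) by (apply Rdiv_lt_0_compat; lra).
  assert (HB : 0 < e / (2 * (Cmod (f z) + 1))) by (apply Rdiv_lt_0_compat; lra).
  destruct (Hf _ HA) as [d1 [Hd1 H1]].
  destruct (Hg _ HB) as [d2 [Hd2 H2]].
  exists (Rmin d0 (Rmin d1 d2)).
  split; [repeat apply Rmin_glb_lt; auto|]. intros w Hw.
  assert (W0 : Cmod (w - z) < d0) by (eapply Rlt_le_trans; [apply Hw|apply Rmin_l]).
  assert (W1 : Cmod (w - z) < d1).
  { eapply Rlt_le_trans; [apply Hw|]. eapply Rle_trans; [apply Rmin_r|apply Rmin_l]. }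
  assert (W2 : Cmod (w - z) < d2).
  { eapply Rlt_le_trans; [apply Hw|]. eapply Rle_trans; [apply Rmin_r|apply Rmin_r]. }
  replace (f w * g w - f z * g z) with (f w * (g w - g z) + (f w - f z) * g z) by ring.
  eapply Rle_lt_trans; [apply Cmod_triangle|]. rewrite !Cmod_mult.
  specialize (H0 w W0). specialize (H1 w W1). specialize (H2 w W2).
  assert (Cmod (f w) * Cmod (g w - g z) <=
          (Cmod (f z) + 1) * (e / (2 * (Cmod (f z) + 1))))%R.
  { apply Rmult_le_compat; try apply Cmod_ge_0; lra. }
  assert ((Cmod (f z) + 1) * (e / (2 * (Cmod (f z) + 1))) = e / 2)%R by (field; lra).
  assert (Cmod (f w - f z) * Cmod (g z) <=
          (e / (2 * (Cmod (g z) + 1))) * Cmod (g z))%R.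
  { apply Rmult_le_compat_r; [apply Cmod_ge_0|lra]. }
  assert ((e / (2 * (Cmod (g z) + 1))) * Cmod (g z) <
          (e / (2 * (Cmod (g z) + 1))) * (Cmod (g z) + 1))%R.
  { apply Rmult_lt_compat_l; lra. }
  assert ((e / (2 * (Cmod (g z) + 1))) * (Cmod (g z) + 1) = e / 2)%R by (field; lra).
  lra.
Qed.

Lemma ccont_inv_id (z : C) : z <> 0 -> ccont (fun w => / w) z.
Proof.
  intros Hz e He. assert (P : 0 < Cmod z) by (apply Cmod_gt_0; auto).
  set (m := Cmod z) in *.
  exists (Rmin (m / 2) (e * m * m / 2)). split.
  { apply Rmin_glb_lt; [lra|].
    assert (0 < e * m * m)%R by (repeat apply Rmult_lt_0_compat; auto). lra. }
  intros w Hw.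
  assert (W1 : Cmod (w - z) < m / 2) by (eapply Rlt_le_trans; [apply Hw|apply Rmin_l]).
  assert (W2 : Cmod (w - z) < e * m * m / 2) by (eapply Rlt_le_trans; [apply Hw|apply Rmin_r]).
  assert (Pw : m / 2 < Cmod w).
  { generalize (Cmod_ge_minus z w). rewrite Cmod_sub_sym. fold m. lra. }
  assert (w <> 0) by (apply Cmod_gt_0; lra).
  replace (/ w - / z) with ((z - w) / (w * z)) by (field; auto).
  rewrite Cmod_div by (apply Cmult_neq_0; auto). rewrite Cmod_mult. fold m.
  rewrite Cmod_sub_sym.
  apply Rmult_lt_reg_r with (Cmod w * m)%R; [apply Rmult_lt_0_compat; lra|].
  unfold Rdiv. rewrite Rmult_assoc, Rinv_l, Rmult_1_r
    by (apply Rgt_not_eq, Rmult_lt_0_compat; lra).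
  eapply Rlt_le_trans; [apply W2|].
  replace (e * m * m / 2)%R with (e * (m/2 * m))%R by field.
  apply Rmult_le_compat_l; [lra|]. apply Rmult_le_compat_r; lra.
Qed.

Lemma ccont_inv (f : C -> C) (z : C) :
  f z <> 0 -> ccont f z -> ccont (fun w => / f w) z.
Proof. intros H Hf. apply (ccont_comp (fun w => / w)); auto. apply ccont_inv_id; auto. Qed.

Lemma ccont_opp (f : C -> C) (z : C) : ccont f z -> ccont (fun w => - f w) z.
Proof.
  intros H e He. destruct (H e He) as [d [Hd H']]. exists d. split; auto.
  intros w Hw. replace (- f w - - f z) with (- (f w - f z)) by ring.
  rewrite Cmod_opp. auto.
Qed.

Lemma ccont_ext_loc (f g : C -> C) (z : C) (r : R) :
  0 < r -> (forall w, Cmod (w - z) < r -> f w = g w) -> ccont f z -> ccont g z.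
Proof.
  intros Hr E H e He. destruct (H e He) as [d [Hd H']].
  exists (Rmin d r). split; [apply Rmin_glb_lt; auto|]. intros w Hw.
  rewrite <- !E.
  - apply H'. eapply Rlt_le_trans; [apply Hw|apply Rmin_l].
  - replace (z - z) with (RtoC 0) by ring. rewrite Cmod_0. auto.
  - eapply Rlt_le_trans; [apply Hw|apply Rmin_r].
Qed.

Lemma ccont_nonzero (f : C -> C) (z : C) :
  ccont f z -> f z <> 0 -> exists r, 0 < r /\ forall w, Cmod (w - z) < r -> f w <> 0.
Proof.
  intros H Hz. destruct (H (Cmod (f z))) as [d [Hd H']].
  { apply Cmod_gt_0; auto. }
  exists d. split; auto. intros w Hw E. specialize (H' w Hw).
  rewrite E in H'. replace (0 - f z) with (- f z) in H' by ring.
  rewrite Cmod_opp in H'. lra.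
Qed.

(** Carathéodory's form of the complex derivative: products, compositions and
    inverses reduce to the corresponding facts about continuity. *)
Definition cder (f : C -> C) (z l : C) : Prop :=
  exists phi, ccont phi z /\ phi z = l /\ forall w, f w = f z + phi w * (w - z).

Lemma cder_eps (f : C -> C) (z l : C) :
  cder f z l <->
  forall e, 0 < e -> exists d, 0 < d /\ forall w, Cmod (w - z) < d ->
    Cmod (f w - f z - l * (w - z)) <= e * Cmod (w - z).
Proof.
  split.
  - intros [phi [Hc [Hl H]]] e He. destruct (Hc e He) as [d [Hd Hd']].
    exists d. split; auto. intros w Hw. rewrite (H w).
    replace (f z + phi w * (w - z) - f z - l * (w - z))
      with ((phi w - l) * (w - z)) by ring.
    rewrite Cmod_mult. apply Rmult_le_compat_r; [apply Cmod_ge_0|].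
    rewrite <- Hl. left; auto.
  - intros H.
    exists (fun w => if excluded_middle_informative (w = z) then l
                     else (f w - f z) / (w - z)).
    split; [|split].
    + intros e He. destruct (H (e/2)%R) as [d [Hd Hd']]; [lra|].
      exists d. split; auto. intros w Hw.
      destruct (excluded_middle_informative (z = z)) as [_|n]; [|elim n; auto].
      destruct (excluded_middle_informative (w = z)) as [_|n].
      * replace (l - l) with (RtoC 0) by ring. rewrite Cmod_0; auto.
      * assert (N : w - z <> 0).
        { intros E. apply n. replace w with (w - z + z) by ring. rewrite E. ring. }
        replace ((f w - f z) / (w - z) - l)
          with ((f w - f z - l * (w - z)) / (w - z)) by (field; auto).
        rewrite Cmod_div; auto. assert (P := proj1 (Cmod_gt_0 _) N).
        apply Rle_lt_trans with (e / 2)%R; [|lra].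
        apply Rmult_le_reg_r with (Cmod (w - z)); auto.
        unfold Rdiv at 1. rewrite Rmult_assoc, Rinv_l, Rmult_1_r by lra. auto.
    + destruct (excluded_middle_informative (z = z)) as [_|n]; [auto|elim n; auto].
    + intros w. destruct (excluded_middle_informative (w = z)) as [E|n].
      * rewrite E; ring.
      * field. intros E. apply n. replace w with (w - z + z) by ring. rewrite E. ring.
Qed.

Lemma locally_C_eps (z : C) (P : C -> Prop) :
  locally (T := C_UniformSpace) z P <->
  exists d, 0 < d /\ forall w, Cmod (w - z) < d -> P w.
Proof.
  split.
  - intros [d Hd]. exists d. split; [apply cond_pos|]. intros w Hw. apply Hd.
    apply C_NormedModule_mixin_compat1. exact Hw.
  - intros [d [Hd H]].
    (* Balls of the uniform structure on [C] are squares; a square of half-side [d / sqrt 2] fits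
       into the disc of radius [d]. *)
    assert (P2 : 0 < d / sqrt 2) by (apply Rdiv_lt_0_compat; auto; apply sqrt_lt_R0; lra).
    exists (mkposreal _ P2). intros w Hw. apply H.
    assert (Q := C_NormedModule_mixin_compat2 z w (mkposreal _ P2) Hw). simpl in Q.
    replace (sqrt 2 * (d / sqrt 2))%R with d in Q. { exact Q. }
    field. apply Rgt_not_eq, sqrt_lt_R0; lra.
Qed.

Lemma cder_is_derive (f : C -> C) (z l : C) :
  cder f z l <-> is_derive (K := C_AbsRing) (V := C_NormedModule) f z l.
Proof.
  rewrite cder_eps. split.
  - intros H. split.
    + apply is_linear_scal_l.
    + intros x Hx. apply (is_filter_lim_locally_unique (V := AbsRing_NormedModule C_AbsRing)) in Hx. subst x.
      intros eps. destruct (H eps (cond_pos eps)) as [d [Hd Hd']].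
      apply locally_C, locally_C_eps. exists d. split; auto. intros w Hw.
      change (Cmod (f w - f z - (w - z) * l) <= eps * Cmod (w - z)).
      replace ((w - z) * l) with (l * (w - z)) by ring. auto.
  - intros [_ H] e He. specialize (H z (fun P HP => HP) (mkposreal e He)).
    simpl in H. apply locally_C, locally_C_eps in H. destruct H as [d [Hd H]].
    exists d. split; auto. intros w Hw. specialize (H w Hw).
    replace (l * (w - z)) with ((w - z) * l) by ring. exact H.
Qed.

Lemma cder_ccont (f : C -> C) (z l : C) : cder f z l -> ccont f z.
Proof.
  intros [phi [Hc [Hl H]]].
  apply ccont_ext_loc with (f := fun w => f z + phi w * (w - z)) (r := 1%R); [lra|auto|].
  apply ccont_plus; [apply ccont_const|]. apply ccont_mult; auto.
  apply ccont_plus; [apply ccont_id|apply ccont_const].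
Qed.

Lemma cder_C_derive (f : C -> C) (z l : C) : cder f z l -> C_derive f z = l.
Proof. intros H. apply is_C_derive_unique, cder_is_derive. auto. Qed.

Lemma cder_ext_loc (f g : C -> C) (z l : C) (r : R) :
  0 < r -> (forall w, Cmod (w - z) < r -> f w = g w) -> cder f z l -> cder g z l.
Proof.
  rewrite !cder_eps. intros Hr E H e He. destruct (H e He) as [d [Hd H']].
  exists (Rmin d r). split; [apply Rmin_glb_lt; auto|]. intros w Hw.
  rewrite <- !E.
  - apply H'. eapply Rlt_le_trans; [apply Hw|apply Rmin_l].
  - replace (z - z) with (RtoC 0) by ring. rewrite Cmod_0. auto.
  - eapply Rlt_le_trans; [apply Hw|apply Rmin_r].
Qed.

Lemma cder_ext (f g : C -> C) (z l : C) :
  (forall w, f w = g w) -> cder f z l -> cder g z l.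
Proof. intros E. apply cder_ext_loc with 1%R; [lra|auto]. Qed.

Lemma cder_eq (f : C -> C) (z l l' : C) : cder f z l -> l = l' -> cder f z l'.
Proof. intros H E. rewrite <- E. exact H. Qed.

Lemma cder_const (k z : C) : cder (fun _ => k) z 0.
Proof.
  exists (fun _ => 0). split; [apply ccont_const|]. split; auto. intros; ring.
Qed.

Lemma cder_id (z : C) : cder (fun w => w) z 1.
Proof.
  exists (fun _ => 1). split; [apply ccont_const|]. split; auto. intros; ring.
Qed.

Lemma cder_plus (f g : C -> C) (z a b : C) :
  cder f z a -> cder g z b -> cder (fun w => f w + g w) z (a + b).
Proof.
  intros [p [Hp [Ep Fp]]] [q [Hq [Eq Fq]]]. exists (fun w => p w + q w).
  split; [apply ccont_plus; auto|]. split; [congruence|].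
  intros w. rewrite (Fp w), (Fq w). ring.
Qed.

Lemma cder_mult (f g : C -> C) (z a b : C) :
  cder f z a -> cder g z b -> cder (fun w => f w * g w) z (a * g z + f z * b).
Proof.
  intros Hf Hg. assert (Cf := cder_ccont _ _ _ Hf).
  destruct Hf as [p [Hp [Ep Fp]]]. destruct Hg as [q [Hq [Eq Fq]]].
  exists (fun w => p w * g z + f w * q w).
  split; [|split; [congruence|]].
  - apply ccont_plus; apply ccont_mult; auto. apply ccont_const.
  - intros w. rewrite (Fq w), (Fp w). ring.
Qed.

Lemma cder_scal (k : C) (f : C -> C) (z a : C) :
  cder f z a -> cder (fun w => k * f w) z (k * a).
Proof.
  intros H. eapply cder_eq. { apply cder_mult; [apply cder_const|apply H]. } cbv beta; ring.
Qed.

Lemma cder_opp (f : C -> C) (z a : C) : cder f z a -> cder (fun w => - f w) z (- a).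
Proof.
  intros H. apply cder_ext with (fun w => (- (1)) * f w). { intros; ring. }
  eapply cder_eq. { apply cder_scal, H. } cbv beta; ring.
Qed.

Lemma cder_minus (f g : C -> C) (z a b : C) :
  cder f z a -> cder g z b -> cder (fun w => f w - g w) z (a - b).
Proof. intros. apply cder_plus; auto. apply cder_opp; auto. Qed.

Lemma cder_comp (f g : C -> C) (z a b : C) :
  cder f (g z) a -> cder g z b -> cder (fun w => f (g w)) z (a * b).
Proof.
  intros [p [Hp [Ep Fp]]] Hg. assert (Cg := cder_ccont _ _ _ Hg).
  destruct Hg as [q [Hq [Eq Fq]]].
  exists (fun w => p (g w) * q w). split; [|split; [congruence|]].
  - apply ccont_mult; auto. apply (ccont_comp p g); auto.
  - intros w. rewrite (Fp (g w)). rewrite (Fq w) at 2. ring.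
Qed.

Lemma cder_inv (f : C -> C) (z a : C) :
  f z <> 0 -> cder f z a -> cder (fun w => / f w) z (- a / (f z * f z)).
Proof.
  intros Hz Hf. assert (Cf := cder_ccont _ _ _ Hf).
  destruct (ccont_nonzero f z Cf Hz) as [r [Hr N]].
  destruct Hf as [p [Hp [Ep Fp]]].
  (* Carathéodory's identity is required at every [w], but it breaks where [f w = 0], since [/ 0] is
     a default value. The function is therefore redefined at those points, all away from [z], so
     that the identity holds there by fiat. *)
  apply cder_ext_loc with
    (f := fun w => if excluded_middle_informative (f w = 0) then
             / f z + (- p w * (/ f w * / f z)) * (w - z) else / f w) (r := r); auto.
  { intros w Hw. destruct (excluded_middle_informative (f w = 0)); auto.
    elim (N w Hw); auto. }
  exists (fun w => - p w * (/ f w * / f z)). split; [|split].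
  - apply ccont_mult; [apply ccont_opp; auto|]. apply ccont_mult; [|apply ccont_const].
    apply ccont_inv; auto.
  - rewrite Ep. field. auto.
  - intros w. destruct (excluded_middle_informative (f z = 0)); [tauto|].
    destruct (excluded_middle_informative (f w = 0)); auto.
    replace (/ f w) with (f z / (f w * f z)) at 1 by (field; auto).
    replace (f z) with (f w - p w * (w - z)) at 1 by (rewrite (Fp w); ring).
    field. auto.
Qed.

Lemma cder_div (f g : C -> C) (z a b : C) :
  g z <> 0 -> cder f z a -> cder g z b ->
  cder (fun w => f w / g w) z ((a * g z - f z * b) / (g z * g z)).
Proof.
  intros Hz Hf Hg. unfold Cdiv at 1. eapply cder_eq.
  - apply cder_mult; [apply Hf|apply cder_inv; eauto].
  - cbv beta; field. auto.
Qed.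

Definition cdiff (f : C -> C) (z : C) : Prop := exists l, cder f z l.

Lemma cdiff_ex_derive (f : C -> C) (z : C) :
  cdiff f z <-> ex_derive (K := C_AbsRing) (V := C_NormedModule) f z.
Proof. split; intros [l H]; exists l; apply cder_is_derive; auto. Qed.

Lemma cdiff_ccont (f : C -> C) (z : C) : cdiff f z -> ccont f z.
Proof. intros [l H]. eapply cder_ccont; eauto. Qed.

Lemma cdiff_derive (f : C -> C) (z : C) : cdiff f z -> cder f z (C_derive f z).
Proof. intros [l H]. rewrite (cder_C_derive _ _ _ H). auto. Qed.

Lemma cdiff_const (k z : C) : cdiff (fun _ => k) z.
Proof. eexists; apply cder_const. Qed.

Lemma cdiff_id (z : C) : cdiff (fun w => w) z.
Proof. eexists; apply cder_id. Qed.

Lemma cdiff_plus (f g : C -> C) (z : C) :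
  cdiff f z -> cdiff g z -> cdiff (fun w => f w + g w) z.
Proof. intros [a Ha] [b Hb]. eexists; apply cder_plus; eauto. Qed.

Lemma cdiff_minus (f g : C -> C) (z : C) :
  cdiff f z -> cdiff g z -> cdiff (fun w => f w - g w) z.
Proof. intros [a Ha] [b Hb]. eexists; apply cder_minus; eauto. Qed.

Lemma cdiff_opp (f : C -> C) (z : C) : cdiff f z -> cdiff (fun w => - f w) z.
Proof. intros [a Ha]. eexists; apply cder_opp; eauto. Qed.

Lemma cdiff_mult (f g : C -> C) (z : C) :
  cdiff f z -> cdiff g z -> cdiff (fun w => f w * g w) z.
Proof. intros [a Ha] [b Hb]. eexists; apply cder_mult; eauto. Qed.

Lemma cdiff_inv (f : C -> C) (z : C) : f z <> 0 -> cdiff f z -> cdiff (fun w => / f w) z.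
Proof. intros Hz [a Ha]. eexists; apply cder_inv; eauto. Qed.

Lemma cdiff_div (f g : C -> C) (z : C) :
  g z <> 0 -> cdiff f z -> cdiff g z -> cdiff (fun w => f w / g w) z.
Proof. intros Hz [a Ha] [b Hb]. eexists; apply cder_div; eauto. Qed.

Lemma cdiff_comp (f g : C -> C) (z : C) :
  cdiff f (g z) -> cdiff g z -> cdiff (fun w => f (g w)) z.
Proof. intros [a Ha] [b Hb]. eexists; apply cder_comp; eauto. Qed.

Lemma cdiff_ext_loc (f g : C -> C) (z : C) (r : R) :
  0 < r -> (forall w, Cmod (w - z) < r -> f w = g w) -> cdiff f z -> cdiff g z.
Proof. intros Hr E [l H]. exists l. eapply cder_ext_loc; eauto. Qed.

Lemma cdiff_ext (f g : C -> C) (z : C) :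
  (forall w, f w = g w) -> cdiff f z -> cdiff g z.
Proof. intros E. apply cdiff_ext_loc with 1%R; [lra|auto]. Qed.

Lemma cdiff_pow (f : C -> C) (n : nat) (z : C) :
  cdiff f z -> cdiff (fun w => f w ^ n) z.
Proof.
  intros H. induction n as [|n IH]; simpl; [apply cdiff_const|].
  apply cdiff_mult; auto.
Qed.

Create HintDb cd.
#[export] Hint Resolve cdiff_const cdiff_id cdiff_plus cdiff_minus cdiff_opp
  cdiff_mult cdiff_inv cdiff_div cdiff_pow : cd.

(** * Goursat's theorem for rectangles *)

Notation is_CRInt := (is_RInt (V := C_R_NormedModule)).
Notation CRInt := (RInt (V := C_R_CompleteNormedModule)).
Notation ex_CRInt := (ex_RInt (V := C_R_NormedModule)).

(** Integration in the real normed module [C] is linear over the reals only. Multiplication by [k]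
    is a real combination of the identity and of multiplication by [Ci], and the latter merely
    exchanges the two components up to a sign. *)
Lemma is_CRInt_cmult (k : C) (g : R -> C) (a b : R) (l : C) :
  is_CRInt g a b l -> is_CRInt (fun t => k * g t) a b (k * l).
Proof.
  intros H.
  assert (HI : is_CRInt (fun t => Ci * g t) a b (Ci * l)).
  { destruct l as [l1 l2].
    replace (Ci * (l1, l2)) with ((- l2)%R, l1)
      by (unfold Cmult, Ci; simpl; f_equal; ring).
    apply (is_RInt_fct_extend_pair (U := R_NormedModule) (V := R_NormedModule)).
    - apply is_RInt_ext with (fun t => opp (snd (g t))).
      { intros x _. unfold opp, Cmult, Ci; simpl. ring. }
      apply (is_RInt_opp (V := R_NormedModule)).
      apply (is_RInt_fct_extend_snd _ _ _ _ H).
    - apply is_RInt_ext with (fun t => fst (g t)).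
      { intros x _. unfold Cmult, Ci; simpl. ring. }
      apply (is_RInt_fct_extend_fst _ _ _ _ H). }
  assert (Dec : forall z : C, k * z =
    plus (scal (Re k) z : C_R_NormedModule) (scal (Im k) (Ci * z) : C_R_NormedModule)).
  { intros z. rewrite !scal_R_Cmult.
    change (k * z = RtoC (Re k) * z + RtoC (Im k) * (Ci * z)).
    destruct k as [k1 k2], z as [z1 z2].
    unfold Cplus, Cmult, Ci, RtoC; simpl; f_equal; ring. }
  rewrite Dec. apply is_RInt_ext with
      (fun t => plus (scal (Re k) (g t)) (scal (Im k) (Ci * g t)) : C_R_NormedModule).
  - intros x _. symmetry. apply Dec.
  - apply (is_RInt_plus (V := C_R_NormedModule));
      apply (is_RInt_scal (V := C_R_NormedModule)); auto.
Qed.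

Lemma is_CRInt_unique (g : R -> C) (a b : R) (l : C) : is_CRInt g a b l -> CRInt g a b = l.
Proof. intros H. apply (is_RInt_unique (V := C_R_CompleteNormedModule)). exact H. Qed.

Lemma CRInt_correct (g : R -> C) (a b : R) : ex_CRInt g a b -> is_CRInt g a b (CRInt g a b).
Proof. intros H. apply (RInt_correct (V := C_R_CompleteNormedModule)). exact H. Qed.

Lemma CRInt_bound (g : R -> C) (a b M : R) : a <= b -> ex_CRInt g a b ->
  (forall x, a <= x <= b -> Cmod (g x) <= M) -> Cmod (CRInt g a b) <= M * (b - a).
Proof.
  intros Hab Hex HM.
  replace (M * (b - a))%R with (scal (b - a)%R M) by (unfold scal; simpl; unfold mult; simpl; ring).
  rewrite Cmod_norm.
  apply (norm_RInt_le (V := C_R_NormedModule) g (fun _ => M) a b); auto.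
  - intros x Hx. change (norm (g x)) with (norm (V := C_R_NormedModule) (g x)).
    rewrite <- Cmod_norm. auto.
  - apply CRInt_correct; auto.
  - apply (is_RInt_const (V := R_NormedModule)).
Qed.

Lemma ex_CRInt_cont (g : R -> C) (a b : R) : a <= b ->
  (forall x, a <= x <= b -> continuous (U := C_R_NormedModule) g x) -> ex_CRInt g a b.
Proof.
  intros Hab H. apply (ex_RInt_continuous (V := C_R_CompleteNormedModule)).
  intros z. rewrite Rmin_left, Rmax_right by auto. apply H.
Qed.

Lemma continuous_hor (f : C -> C) (x y : R) : ccont f (x, y) ->
  continuous (T := R_UniformSpace) (U := C_R_NormedModule) (fun t => f (t, y)) x.
Proof.
  intros H P HP.
  assert (HP' : locally (T := C_UniformSpace) (f (x, y)) P) by exact HP.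
  apply locally_C_eps in HP'. destruct HP' as [e [He He']].
  destruct (H e He) as [d [Hd Hd']]. exists (mkposreal d Hd). intros t Ht.
  apply He', Hd'. replace ((t, y) - (x, y)) with (RtoC (t - x)).
  - rewrite Cmod_R. exact Ht.
  - unfold Cminus, Cplus, Copp, RtoC; simpl; f_equal; ring.
Qed.

Lemma continuous_ver (f : C -> C) (x y : R) : ccont f (x, y) ->
  continuous (T := R_UniformSpace) (U := C_R_NormedModule) (fun t => f (x, t)) y.
Proof.
  intros H P HP.
  assert (HP' : locally (T := C_UniformSpace) (f (x, y)) P) by exact HP.
  apply locally_C_eps in HP'. destruct HP' as [e [He He']].
  destruct (H e He) as [d [Hd Hd']]. exists (mkposreal d Hd). intros t Ht.
  apply He', Hd'. replace ((x, t) - (x, y)) with (Ci * RtoC (t - y)).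
  - rewrite Cmod_mult, Cmod_Ci, Rmult_1_l, Cmod_R. exact Ht.
  - unfold Cminus, Cplus, Copp, Cmult, Ci, RtoC; simpl; f_equal; ring.
Qed.

Definition hint (f : C -> C) (a b y : R) : C := CRInt (fun x => f (x, y)) a b.
Definition vint (f : C -> C) (c d x : R) : C := CRInt (fun y => f (x, y)) c d.

(** Contour integral over the boundary of a rectangle, counterclockwise. *)
Definition loop (f : C -> C) (a b c d : R) : C :=
  hint f a b c - hint f a b d + Ci * (vint f c d b - vint f c d a).

Definition rect (a b c d : R) (w : C) : Prop :=
  (a <= Re w <= b /\ c <= Im w <= d)%R.

Definition bdry (a b c d : R) (w : C) : Prop :=
  rect a b c d w /\ (Re w = a \/ Re w = b \/ Im w = c \/ Im w = d).

Lemma ex_hint (f : C -> C) (a b y : R) : a <= b ->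
  (forall x, a <= x <= b -> ccont f (x, y)) -> ex_CRInt (fun x => f (x, y)) a b.
Proof.
  intros Hab H. apply ex_CRInt_cont; auto.
  intros x Hx. apply continuous_hor; auto.
Qed.

Lemma ex_vint (f : C -> C) (c d x : R) : c <= d ->
  (forall y, c <= y <= d -> ccont f (x, y)) -> ex_CRInt (fun y => f (x, y)) c d.
Proof.
  intros Hab H. apply ex_CRInt_cont; auto.
  intros y Hy. apply continuous_ver; auto.
Qed.

Lemma bdry_sides (a b c d : R) (P : C -> Prop) : a <= b -> c <= d ->
  (forall w, bdry a b c d w -> P w) ->
  (forall x, a <= x <= b -> P (x, c)) /\ (forall x, a <= x <= b -> P (x, d)) /\
  (forall y, c <= y <= d -> P (a, y)) /\ (forall y, c <= y <= d -> P (b, y)).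
Proof.
  intros Hab Hcd H.
  repeat split; intros t Ht; apply H; split; unfold rect; simpl; auto; lra.
Qed.

Lemma loop_linear (f g : C -> C) (k : C) (a b c d : R) : a <= b -> c <= d ->
  (forall w, bdry a b c d w -> ccont f w) ->
  (forall w, bdry a b c d w -> ccont g w) ->
  loop (fun w => f w + k * g w) a b c d = loop f a b c d + k * loop g a b c d.
Proof.
  intros Hab Hcd Hf Hg.
  destruct (bdry_sides _ _ _ _ _ Hab Hcd Hf) as [F1 [F2 [F3 F4]]].
  destruct (bdry_sides _ _ _ _ _ Hab Hcd Hg) as [G1 [G2 [G3 G4]]].
  assert (L : forall (u v : R -> C) p q, ex_CRInt u p q -> ex_CRInt v p q ->
     CRInt (fun t => u t + k * v t) p q = CRInt u p q + k * CRInt v p q).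
  { intros u v p q Hu Hv. apply is_CRInt_unique.
    apply (is_RInt_plus (V := C_R_NormedModule)).
    - apply CRInt_correct; auto.
    - apply is_CRInt_cmult, CRInt_correct; auto. }
  unfold loop, hint, vint.
  rewrite (L (fun x => f (x, c)) (fun x => g (x, c))) by (apply ex_hint; auto).
  rewrite (L (fun x => f (x, d)) (fun x => g (x, d))) by (apply ex_hint; auto).
  rewrite (L (fun y => f (a, y)) (fun y => g (a, y))) by (apply ex_vint; auto).
  rewrite (L (fun y => f (b, y)) (fun y => g (b, y))) by (apply ex_vint; auto).
  ring.
Qed.

Lemma loop_ext (f g : C -> C) (a b c d : R) : a <= b -> c <= d ->
  (forall w, bdry a b c d w -> f w = g w) -> loop f a b c d = loop g a b c d.
Proof.
  intros Hab Hcd H. destruct (bdry_sides _ _ _ _ _ Hab Hcd H) as [F1 [F2 [F3 F4]]].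
  assert (E : forall (u v : R -> C) p q, p <= q -> (forall t, p <= t <= q -> u t = v t) ->
    CRInt u p q = CRInt v p q).
  { intros u v p q Hpq Huv. apply (RInt_ext (V := C_R_CompleteNormedModule)).
    intros t. rewrite Rmin_left, Rmax_right by auto. intros Ht. apply Huv. lra. }
  unfold loop, hint, vint.
  rewrite (E _ _ a b Hab F1), (E _ _ a b Hab F2), (E _ _ c d Hcd F3), (E _ _ c d Hcd F4).
  reflexivity.
Qed.

Lemma loop_bound (f : C -> C) (M a b c d : R) : a <= b -> c <= d ->
  (forall w, bdry a b c d w -> ccont f w) ->
  (forall w, bdry a b c d w -> Cmod (f w) <= M) ->
  Cmod (loop f a b c d) <= M * (2 * (b - a) + 2 * (d - c)).
Proof.
  intros Hab Hcd H HM. destruct (bdry_sides _ _ _ _ _ Hab Hcd H) as [F1 [F2 [F3 F4]]].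
  destruct (bdry_sides _ _ _ _ _ Hab Hcd HM) as [G1 [G2 [G3 G4]]].
  assert (B1 : Cmod (hint f a b c) <= M * (b - a)) by (apply CRInt_bound; auto; apply ex_hint; auto).
  assert (B2 : Cmod (hint f a b d) <= M * (b - a)) by (apply CRInt_bound; auto; apply ex_hint; auto).
  assert (B3 : Cmod (vint f c d a) <= M * (d - c)) by (apply CRInt_bound; auto; apply ex_vint; auto).
  assert (B4 : Cmod (vint f c d b) <= M * (d - c)) by (apply CRInt_bound; auto; apply ex_vint; auto).
  unfold loop. eapply Rle_trans; [apply Cmod_triangle|].
  rewrite Cmod_mult, Cmod_Ci, Rmult_1_l. unfold Cminus.
  generalize (Cmod_triangle (hint f a b c) (- hint f a b d)).
  generalize (Cmod_triangle (vint f c d b) (- vint f c d a)).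
  rewrite !Cmod_opp. lra.
Qed.

Lemma hint_split (f : C -> C) (a m b y : R) : a <= m -> m <= b ->
  (forall x, a <= x <= b -> ccont f (x, y)) -> hint f a b y = hint f a m y + hint f m b y.
Proof.
  intros H1 H2 H. symmetry. apply (RInt_Chasles (V := C_R_CompleteNormedModule));
  apply ex_hint; auto; intros x Hx; apply H; lra.
Qed.

Lemma vint_split (f : C -> C) (c m d x : R) : c <= m -> m <= d ->
  (forall y, c <= y <= d -> ccont f (x, y)) -> vint f c d x = vint f c m x + vint f m d x.
Proof.
  intros H1 H2 H. symmetry. apply (RInt_Chasles (V := C_R_CompleteNormedModule));
  apply ex_vint; auto; intros y Hx; apply H; lra.
Qed.

Lemma loop_split_x (f : C -> C) (a m b c d : R) : a <= m -> m <= b -> c <= d ->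
  (forall w, bdry a b c d w -> ccont f w) ->
  loop f a b c d = loop f a m c d + loop f m b c d.
Proof.
  intros H1 H2 H3 H. destruct (bdry_sides a b c d _ ltac:(lra) H3 H) as [F1 [F2 [F3 F4]]].
  unfold loop. rewrite (hint_split f a m b c), (hint_split f a m b d) by auto. ring.
Qed.

Lemma loop_split_y (f : C -> C) (a b c m d : R) : c <= m -> m <= d -> a <= b ->
  (forall w, bdry a b c d w -> ccont f w) ->
  loop f a b c d = loop f a b c m + loop f a b m d.
Proof.
  intros H1 H2 H3 H. destruct (bdry_sides a b c d _ H3 ltac:(lra) H) as [F1 [F2 [F3 F4]]].
  unfold loop. rewrite (vint_split f c m d a), (vint_split f c m d b) by auto. ring.
Qed.

Lemma is_RInt_id_quad (a b : R) : is_RInt (fun x : R => x) a b ((b * b - a * a) / 2)%R.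
Proof.
  replace ((b * b - a * a) / 2)%R with (minus (b * b / 2)%R (a * a / 2)%R)
    by (unfold minus, plus, opp; simpl; field).
  apply (is_RInt_derive (V := R_CompleteNormedModule) (fun x => x * x / 2)%R (fun x => x)).
  - intros x _. auto_derive; auto. field.
  - intros x _. apply continuous_id.
Qed.

Lemma is_RInt_const_R (k a b : R) : is_RInt (fun _ => k) a b ((b - a) * k)%R.
Proof. apply (is_RInt_const (V := R_NormedModule)). Qed.

(** With [loop_const] this makes loop integrals blind to affine functions, the only explicit
    integrals that Goursat's argument uses. *)
Lemma loop_id (a b c d : R) : loop (fun w => w) a b c d = 0.
Proof.
  assert (Hh : forall y, hint (fun w => w) a b y = ((b * b - a * a) / 2, (b - a) * y)%R).
  { intros y. apply is_CRInt_unique.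
    apply (is_RInt_fct_extend_pair (U := R_NormedModule) (V := R_NormedModule)).
    - apply is_RInt_id_quad. - apply is_RInt_const_R. }
  assert (Hv : forall x, vint (fun w => w) c d x = ((d - c) * x, (d * d - c * c) / 2)%R).
  { intros y. apply is_CRInt_unique.
    apply (is_RInt_fct_extend_pair (U := R_NormedModule) (V := R_NormedModule)).
    - apply is_RInt_const_R. - apply is_RInt_id_quad. }
  unfold loop. rewrite !Hh, !Hv.
  unfold Cminus, Cplus, Copp, Cmult, Ci, RtoC; simpl; f_equal; field.
Qed.

Lemma loop_const (k : C) (a b c d : R) : loop (fun _ => k) a b c d = 0.
Proof.
  unfold loop. replace (hint (fun _ => k) a b c) with (hint (fun _ => k) a b d) by reflexivity.
  replace (vint (fun _ => k) c d b) with (vint (fun _ => k) c d a) by reflexivity. ring.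
Qed.

Lemma nested_intervals (u v : nat -> R) :
  (forall n, u n <= u (S n)) -> (forall n, v (S n) <= v n) -> (forall n, u n <= v n) ->
  exists X, forall n, u n <= X <= v n.
Proof.
  intros Hu Hv Huv.
  assert (Mu : forall n m, (n <= m)%nat -> u n <= u m).
  { intros n m H. induction H; [lra|]. specialize (Hu m). lra. }
  assert (Mv : forall n m, (n <= m)%nat -> v m <= v n).
  { intros n m H. induction H; [lra|]. specialize (Hv m). lra. }
  assert (B : forall n m, u n <= v m).
  { intros n m. destruct (Nat.le_ge_cases n m) as [H|H].
    - specialize (Mu n m H). specialize (Huv m). lra.
    - specialize (Mv m n H). specialize (Huv n). lra. }
  destruct (completeness (fun r => exists n, r = u n)) as [X [HX1 HX2]].
  - exists (v 0%nat). intros r [n ->]. auto.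
  - exists (u 0%nat), 0%nat. auto.
  - exists X. intros n. split.
    + apply HX1. exists n; auto.
    + apply HX2. intros r [m ->]. auto.
Qed.

Lemma rect_mono (a b c d a' b' c' d' : R) (w : C) :
  a <= a' -> b' <= b -> c <= c' -> d' <= d -> rect a' b' c' d' w -> rect a b c d w.
Proof. unfold rect. intros. lra. Qed.

Lemma bdry_rect (a b c d : R) (w : C) : bdry a b c d w -> rect a b c d w.
Proof. intros [H _]; auto. Qed.

Lemma loop_quarters (f : C -> C) (x y H K : R) : 0 <= H -> 0 <= K ->
  (forall w, rect x (x + H) y (y + K) w -> ccont f w) ->
  loop f x (x + H) y (y + K) =
    loop f x (x + H/2) y (y + K/2) + loop f x (x + H/2) (y + K/2) (y + K/2 + K/2)
  + (loop f (x + H/2) (x + H/2 + H/2) y (y + K/2)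
     + loop f (x + H/2) (x + H/2 + H/2) (y + K/2) (y + K/2 + K/2)).
Proof.
  intros HH HK Hf.
  replace (x + H/2 + H/2)%R with (x + H)%R by field.
  replace (y + K/2 + K/2)%R with (y + K)%R by field.
  rewrite (loop_split_x f x (x + H/2) (x + H)) by
    (first [lra | intros w Hw; apply Hf; exact (bdry_rect _ _ _ _ _ Hw)]).
  rewrite (loop_split_y f x (x + H/2) y (y + K/2) (y + K)) by
    (first [lra | intros w [Hw _]; apply Hf; revert Hw; apply rect_mono; lra]).
  rewrite (loop_split_y f (x + H/2) (x + H) y (y + K/2) (y + K)) by
    (first [lra | intros w [Hw _]; apply Hf; revert Hw; apply rect_mono; lra]).
  ring.
Qed.

(** Goursat: a rectangle with a too large integral has a quarter with the same
    defect; at the limit point this contradicts differentiability. *)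
Lemma goursat (f : C -> C) (a b c d : R) : a <= b -> c <= d ->
  (forall w, rect a b c d w -> cdiff f w) -> loop f a b c d = 0.
Proof.
  intros Hab Hcd Hf.
  set (h := (b - a)%R). set (k := (d - c)%R).
  assert (Hh : 0 <= h) by (unfold h; lra). assert (Hk : 0 <= k) by (unfold k; lra).
  assert (Hp : forall n, 0 < / 2 ^ n) by (intros; apply Rinv_0_lt_compat, pow_lt; lra).
  assert (Hs : forall n, (/ 2 ^ S n = / 2 ^ n / 2)%R).
  { intros n. simpl. rewrite Rinv_mult. lra. }
  enough (Heps : forall e, 0 < e -> Cmod (loop f a b c d) <= e * (h + k) ^ 2).
  { apply Cmod_eq_0. apply Rle_antisym; [|apply Cmod_ge_0].
    apply Rnot_lt_le. intros Hpos.
    assert (P : 0 < (h + k) ^ 2 + 1) by (generalize (pow2_ge_0 (h + k)); lra).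
    specialize (Heps (Cmod (loop f a b c d) / ((h + k) ^ 2 + 1) / 2)%R).
    assert (Q : 0 < Cmod (loop f a b c d) / ((h + k) ^ 2 + 1)) by (apply Rdiv_lt_0_compat; auto).
    specialize (Heps ltac:(lra)).
    set (L := Cmod (loop f a b c d)) in *. set (T := ((h + k) ^ 2)%R) in *.
    assert (L / (T + 1) / 2 * T <= L / (T+1) / 2 * (T + 1))%R.
    { apply Rmult_le_compat_l; lra. }
    replace (L / (T + 1) / 2 * (T + 1))%R with (L / 2)%R in H by (field; lra). lra. }
  intros e He. apply Rnot_lt_le. intros Hbad.
  (* The defect is measured against [(H + K) ^ 2], the square of the half-perimeter: quartering
     divides this by exactly 4, so if all four quarters satisfied the bound, so would the whole
     rectangle. *)
  set (bad := fun n (p : R * R) =>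
    let H := (h * / 2 ^ n)%R in let K := (k * / 2 ^ n)%R in
    (a <= fst p /\ fst p + H <= b /\ c <= snd p /\ snd p + K <= d /\
     e * (H + K) ^ 2 < Cmod (loop f (fst p) (fst p + H) (snd p) (snd p + K)))%R).
  set (sub := fun n (p q : R * R) =>
    (fst p <= fst q /\ fst q + h * / 2 ^ S n <= fst p + h * / 2 ^ n /\
     snd p <= snd q /\ snd q + k * / 2 ^ S n <= snd p + k * / 2 ^ n)%R).
  assert (step : forall n p, bad n p -> exists q, bad (S n) q /\ sub n p q).
  { intros n [x y]. unfold bad, sub. cbn -[pow]. rewrite Hs.
    set (t := (/ 2 ^ n)%R). specialize (Hp n). fold t in Hp.
    replace (h * (t / 2))%R with (h * t / 2)%R by lra.
    replace (k * (t / 2))%R with (k * t / 2)%R by lra.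
    assert (HH : 0 <= h * t) by (apply Rmult_le_pos; lra).
    assert (HK : 0 <= k * t) by (apply Rmult_le_pos; lra).
    set (H := (h * t)%R) in *. set (K := (k * t)%R) in *.
    intros [B1 [B2 [B3 [B4 B5]]]].
    rewrite loop_quarters in B5; auto.
    2:{ intros w Hw. apply cdiff_ccont, Hf. revert Hw. apply rect_mono; lra. }
    apply NNPP. intros Hno.
    assert (Q : forall q, (fst q = x \/ fst q = x + H/2)%R -> (snd q = y \/ snd q = y + K/2)%R ->
      Cmod (loop f (fst q) (fst q + H/2) (snd q) (snd q + K/2)) <= e * (H/2 + K/2) ^ 2).
    { intros q Q1 Q2. apply Rnot_lt_le. intros Hq. apply Hno. exists q.
      destruct Q1 as [Q1|Q1], Q2 as [Q2|Q2]; rewrite Q1, Q2 in Hq |- *;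
      repeat split; try lra; exact Hq. }
    generalize (Q (x, y) ltac:(simpl; lra) ltac:(simpl; lra))
               (Q (x, y + K/2)%R ltac:(simpl; lra) ltac:(simpl; lra))
               (Q (x + H/2, y)%R ltac:(simpl; lra) ltac:(simpl; lra))
               (Q (x + H/2, y + K/2)%R ltac:(simpl; lra) ltac:(simpl; lra)).
    cbn -[pow]. intros Q1 Q2 Q3 Q4.
    set (l1 := loop f x (x + H/2) y (y + K/2)) in *.
    set (l2 := loop f x (x + H/2) (y + K/2) (y + K/2 + K/2)) in *.
    set (l3 := loop f (x + H/2) (x + H/2 + H/2) y (y + K/2)) in *.
    set (l4 := loop f (x + H/2) (x + H/2 + H/2) (y + K/2) (y + K/2 + K/2)) in *.
    generalize (Cmod_triangle (l1 + l2) (l3 + l4)) (Cmod_triangle l1 l2) (Cmod_triangle l3 l4).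
    replace (e * (H / 2 + K / 2) ^ 2)%R with (e * (H + K) ^ 2 / 4)%R in * by field. lra. }
  set (nx := fun n p => epsilon (inhabits p) (fun q => bad (S n) q /\ sub n p q)).
  set (s := fix s n := match n with O => (a, c) | S m => nx m (s m) end).
  assert (Hs0 : forall n, bad n (s n)).
  { induction n as [|n IH].
    - unfold bad. simpl. rewrite Rinv_1, !Rmult_1_r. unfold h, k in *. repeat split; try lra.
      replace (a + (b - a))%R with b by ring. replace (c + (d - c))%R with d by ring.
      simpl in Hbad. rewrite Rmult_1_r in Hbad. exact Hbad.
    - simpl. apply (epsilon_spec (inhabits (s n)) _ (step n (s n) IH)). }
  assert (Hs1 : forall n, sub n (s n) (s (S n))).
  { intros n. apply (epsilon_spec (inhabits (s n)) _ (step n (s n) (Hs0 n))). }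
  destruct (nested_intervals (fun n => fst (s n)) (fun n => fst (s n) + h * / 2 ^ n)%R) as [X HX].
  { intros n. apply (Hs1 n). } { intros n. apply (Hs1 n). }
  { intros n. assert (0 <= h * / 2 ^ n); [|lra]. apply Rmult_le_pos; auto. left; auto. }
  destruct (nested_intervals (fun n => snd (s n)) (fun n => snd (s n) + k * / 2 ^ n)%R) as [Y HY].
  { intros n. apply (Hs1 n). } { intros n. apply (Hs1 n). }
  { intros n. assert (0 <= k * / 2 ^ n); [|lra]. apply Rmult_le_pos; auto. left; auto. }
  destruct (Hf (X, Y)) as [l Hl].
  { specialize (HX 0%nat). specialize (HY 0%nat). simpl in HX, HY.
    rewrite Rinv_1, Rmult_1_r in HX, HY. unfold h, k in *. unfold rect; simpl. lra. }
  rewrite cder_eps in Hl. destruct (Hl (e / 2)%R) as [dl [Hdl Hd]]; [lra|].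
  assert (Hn : exists n, (h + k) * / 2 ^ n < dl).
  { destruct (pow_lt_1_zero (/2) ltac:(rewrite Rabs_right; lra) (dl / (h + k + 1))%R) as [n Hn].
    { apply Rdiv_lt_0_compat; lra. }
    exists n. specialize (Hn n (Nat.le_refl n)). rewrite pow_inv in Hn.
    rewrite Rabs_right in Hn by (left; apply Hp).
    apply Rmult_lt_compat_l with (r := (h + k + 1)%R) in Hn; [|lra].
    replace ((h + k + 1) * (dl / (h + k + 1)))%R with dl in Hn by (field; lra).
    specialize (Hp n). lra. }
  destruct Hn as [n Hn]. specialize (Hs0 n). specialize (HX n). specialize (HY n).
  unfold bad in Hs0. destruct (s n) as [x y]. cbn -[pow] in Hs0, HX, HY.
  set (H := (h * / 2 ^ n)%R) in *. set (K := (k * / 2 ^ n)%R) in *.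
  assert (HHK : H + K < dl) by (unfold H, K; lra).
  assert (HH : 0 <= H) by lra. assert (HK : 0 <= K) by lra.
  destruct Hs0 as [B1 [B2 [B3 [B4 B5]]]].
  assert (Cf : forall w, bdry x (x + H) y (y + K) w -> ccont f w).
  { intros w [Hw _]. apply cdiff_ccont, Hf. revert Hw. apply rect_mono; lra. }
  set (p := (X, Y) : C) in *.
  (* Subtracting the tangent affine function at the limit point [p] leaves the integral unchanged
     and the integrand of size at most [e / 2 * Cmod (w - p)]. *)
  assert (E1 : loop (fun w => (f p - l * p) + l * w) x (x + H) y (y + K) = 0).
  { rewrite (loop_linear (fun _ => f p - l * p) (fun w => w)) by
     (first [lra | intros; apply ccont_const | intros; apply ccont_id]).
    rewrite loop_const, loop_id. ring. }
  assert (E2 : loop (fun w => f w + (- (1)) * ((f p - l * p) + l * w)) x (x + H) y (y + K)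
     = loop f x (x + H) y (y + K)).
  { rewrite loop_linear by (first [lra | solve [auto] | intros w _; apply cdiff_ccont; auto 20 with cd]).
    rewrite E1. ring. }
  rewrite <- E2 in B5. clear E1 E2.
  (* The perimeter is [2 * (H + K)] and [Cmod (w - p) <= H + K], so the [e / 2] chosen above
     reproduces exactly the bound [e * (H + K) ^ 2] that [bad] exceeds. *)
  assert (B6 : Cmod (loop (fun w => f w + (- (1)) * ((f p - l * p) + l * w)) x (x + H) y (y + K))
    <= (e / 2 * (H + K)) * (2 * (x + H - x) + 2 * (y + K - y))).
  { apply loop_bound; try lra.
    - intros w Hw. apply ccont_plus; auto. apply cdiff_ccont; auto 20 with cd.
    - intros w [Hw _].
      replace (f w + (- (1)) * ((f p - l * p) + l * w)) with (f w - f p - l * (w - p)) by ring.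
      assert (Hwp : Cmod (w - p) <= H + K).
      { eapply Rle_trans; [apply Cmod_le_Re_Im|]. rewrite Re_minus, Im_minus.
        unfold rect in Hw. unfold p; simpl.
        apply Rplus_le_compat; apply Rabs_le; lra. }
      eapply Rle_trans; [apply Hd; lra|]. apply Rmult_le_compat_l; lra. }
  replace (e / 2 * (H + K) * (2 * (x + H - x) + 2 * (y + K - y)))%R
    with (e * (H + K) ^ 2)%R in B6 by field. lra.
Qed.

(** * Cauchy's formula and its consequences *)

Definition rect_int (a b c d : R) (w : C) : Prop :=
  (a < Re w < b /\ c < Im w < d)%R.

Lemma Csub_neq_0 (w z : C) : w <> z -> w - z <> 0.
Proof. intros n E. apply n. replace w with (w - z + z) by ring. rewrite E. ring. Qed.

Lemma bdry_dist (a b c d : R) (z : C) : rect_int a b c d z ->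
  exists e, 0 < e /\ forall w, bdry a b c d w -> e <= Cmod (w - z).
Proof.
  intros [[H1 H2] [H3 H4]].
  exists (Rmin (Rmin (Re z - a) (b - Re z)) (Rmin (Im z - c) (d - Im z))).
  split; [repeat apply Rmin_glb_lt; lra|].
  intros w [_ Hw].
  generalize (re_le_Cmod (w - z)) (im_le_Cmod (w - z)). rewrite Re_minus, Im_minus.
  set (x := Rmin (Re z - a) (b - Re z)). set (y := Rmin (Im z - c) (d - Im z)).
  assert (x <= Re z - a)%R by apply Rmin_l. assert (x <= b - Re z)%R by apply Rmin_r.
  assert (y <= Im z - c)%R by apply Rmin_l. assert (y <= d - Im z)%R by apply Rmin_r.
  generalize (Rmin_l x y) (Rmin_r x y) (Rle_abs (Re w - Re z)) (Rle_abs (- (Re w - Re z)))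
    (Rle_abs (Im w - Im z)) (Rle_abs (- (Im w - Im z))). rewrite !Rabs_Ropp.
  destruct Hw as [Hw|[Hw|[Hw|Hw]]]; rewrite Hw; lra.
Qed.

Lemma bdry_neq (a b c d : R) (z w : C) : rect_int a b c d z -> bdry a b c d w -> w - z <> 0.
Proof.
  intros Hz Hw. destruct (bdry_dist _ _ _ _ _ Hz) as [e [He H]]. specialize (H w Hw).
  apply Cmod_gt_0. lra.
Qed.

Lemma rect_int_nbhd (a b c d : R) (z : C) : rect_int a b c d z ->
  exists e, 0 < e /\ forall w, Cmod (w - z) < e -> rect_int a b c d w.
Proof.
  intros [[H1 H2] [H3 H4]].
  exists (Rmin (Rmin (Re z - a) (b - Re z)) (Rmin (Im z - c) (d - Im z))).
  split; [repeat apply Rmin_glb_lt; lra|].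
  intros w.
  generalize (re_le_Cmod (w - z)) (im_le_Cmod (w - z)). rewrite Re_minus, Im_minus.
  set (x := Rmin (Re z - a) (b - Re z)). set (y := Rmin (Im z - c) (d - Im z)).
  assert (x <= Re z - a)%R by apply Rmin_l. assert (x <= b - Re z)%R by apply Rmin_r.
  assert (y <= Im z - c)%R by apply Rmin_l. assert (y <= d - Im z)%R by apply Rmin_r.
  generalize (Rmin_l x y) (Rmin_r x y) (Rle_abs (Re w - Re z)) (Rle_abs (- (Re w - Re z)))
    (Rle_abs (Im w - Im z)) (Rle_abs (- (Im w - Im z))). rewrite !Rabs_Ropp.
  unfold rect_int. lra.
Qed.

Lemma ccont_cauchy_kernel (z w : C) : w - z <> 0 -> ccont (fun w => / (w - z)) w.
Proof.
  intros H. apply cdiff_ccont. apply cdiff_inv; auto with cd.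
Qed.

Lemma Re_is_CRInt (g : R -> C) (a b : R) : ex_CRInt g a b ->
  is_RInt (fun t => Re (g t)) a b (Re (CRInt g a b)).
Proof.
  intros H. apply (is_RInt_fct_extend_fst (U := R_NormedModule) (V := R_NormedModule)).
  apply CRInt_correct; auto.
Qed.

Lemma Im_is_CRInt (g : R -> C) (a b : R) : ex_CRInt g a b ->
  is_RInt (fun t => Im (g t)) a b (Im (CRInt g a b)).
Proof.
  intros H. apply (is_RInt_fct_extend_snd (U := R_NormedModule) (V := R_NormedModule)).
  apply CRInt_correct; auto.
Qed.

Lemma is_RInt_pos (g : R -> R) (a b l m : R) : a < b -> 0 < m ->
  (forall t, a <= t <= b -> m <= g t) -> is_RInt g a b l -> 0 < l.
Proof.
  intros Hab Hm Hg H.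
  assert (K := is_RInt_le (fun _ => m) g a b _ _ (Rlt_le _ _ Hab) (is_RInt_const_R m a b) H).
  assert (0 < (b - a) * m) by (apply Rmult_lt_0_compat; lra).
  eapply Rlt_le_trans; [apply H0|]. apply K. intros x Hx. apply Hg; lra.
Qed.

Definition windJ (a b c d : R) (z : C) : C := loop (fun w => / (w - z)) a b c d.

(** Each side contributes a positive amount to the imaginary part; the exact
    value [2 i pi] is never needed. *)
Lemma windJ_neq_0 (a b c d : R) (z : C) : rect_int a b c d z -> windJ a b c d z <> 0.
Proof.
  intros Hz. assert (Hz' := Hz). destruct Hz' as [[H1 H2] [H3 H4]].
  destruct (bdry_dist _ _ _ _ _ Hz) as [e [He Hd]].
  assert (Hab : a <= b) by lra. assert (Hcd : c <= d) by lra.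
  assert (Hc : forall w, bdry a b c d w -> ccont (fun w => / (w - z)) w).
  { intros w Hw. apply ccont_cauchy_kernel. eapply bdry_neq; eauto. }
  destruct (bdry_sides _ _ _ _ _ Hab Hcd Hc) as [F1 [F2 [F3 F4]]].
  set (D := (Rabs (b - a) + Rabs (d - c))%R).
  assert (HD : forall w, bdry a b c d w -> (0 < (Re w - Re z)^2 + (Im w - Im z)^2 <= D^2)%R).
  { intros w Hw. rewrite <- Re_minus, <- Im_minus, <- Cmod2_alt. split.
    - apply pow_lt. specialize (Hd w Hw). lra.
    - apply pow_incr. split; [apply Cmod_ge_0|].
      eapply Rle_trans; [apply Cmod_le_Re_Im|]. rewrite Re_minus, Im_minus. unfold D.
      rewrite (Rabs_right (b - a)), (Rabs_right (d - c)) by lra.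
      destruct Hw as [[Hw1 Hw2] _]. apply Rplus_le_compat; apply Rabs_le; lra. }
  assert (HDp : 0 < D) by (unfold D; rewrite !Rabs_right by lra; lra).
  assert (Hm : 0 < Rmin (Rmin (Re z - a) (b - Re z)) (Rmin (Im z - c) (d - Im z)) / D ^ 2).
  { apply Rdiv_lt_0_compat; [repeat apply Rmin_glb_lt; lra|apply pow_lt; auto]. }
  set (m := Rmin (Rmin (Re z - a) (b - Re z)) (Rmin (Im z - c) (d - Im z))) in *.
  assert (m <= Re z - a)%R by (eapply Rle_trans; [apply Rmin_l|apply Rmin_l]).
  assert (m <= b - Re z)%R by (eapply Rle_trans; [apply Rmin_l|apply Rmin_r]).
  assert (m <= Im z - c)%R by (eapply Rle_trans; [apply Rmin_r|apply Rmin_l]).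
  assert (m <= d - Im z)%R by (eapply Rle_trans; [apply Rmin_r|apply Rmin_r]).
  (* On each side the relevant component of [/ (w - z)] is, up to sign, the distance from [z] to
     that side divided by [Cmod (w - z) ^ 2]; the first is at least [m], and the half-perimeter [D]
     bounds the modulus. *)
  assert (LB' : forall n q, m <= n -> 0 < q <= D^2 -> m / D^2 <= n / q).
  { intros n q Hn [Hq1 Hq2].
    assert (0 < m).
    { apply Rnot_le_lt. intros Hn0. apply (Rlt_irrefl 0). eapply Rlt_le_trans; [apply Hm|].
      unfold Rdiv. rewrite <- (Rmult_0_l (/ D ^ 2)). apply Rmult_le_compat_r; auto.
      left. apply Rinv_0_lt_compat, pow_lt; auto. }
    unfold Rdiv. apply Rmult_le_compat; try lra.
    - left. apply Rinv_0_lt_compat, pow_lt; auto.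
    - apply Rinv_le_contravar; auto. }
  assert (I1 : 0 < Im (hint (fun w => / (w - z)) a b c)).
  { apply (is_RInt_pos (fun x => Im (/ ((x, c) - z))) a b _ (m / D^2)); [lra|auto| |].
    - intros t Ht. replace (Im (/ ((t, c) - z))) with ((Im z - c) / ((t - Re z)^2 + (c - Im z)^2))%R.
      + apply LB'; auto. apply (HD (t, c)). split; unfold rect; simpl; auto; lra.
      + unfold Cinv; simpl. destruct z; simpl. unfold Rdiv. f_equal. ring.
    - apply Im_is_CRInt, (ex_hint (fun w => / (w - z))); auto. }
  assert (I2 : 0 < - Im (hint (fun w => / (w - z)) a b d)).
  { apply (is_RInt_pos (fun x => - Im (/ ((x, d) - z)))%R a b _ (m / D^2)); [lra|auto| |].
    - intros t Ht. replace (- Im (/ ((t, d) - z)))%R with ((d - Im z) / ((t - Re z)^2 + (d - Im z)^2))%R.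
      + apply LB'; auto. apply (HD (t, d)). split; unfold rect; simpl; auto; lra.
      + unfold Cinv; simpl. destruct z; simpl. unfold Rdiv. ring_simplify. f_equal.
    - apply (is_RInt_opp (V := R_NormedModule)).
      apply Im_is_CRInt, (ex_hint (fun w => / (w - z))); auto. }
  assert (I3 : 0 < - Re (vint (fun w => / (w - z)) c d a)).
  { apply (is_RInt_pos (fun y => - Re (/ ((a, y) - z)))%R c d _ (m / D^2)); [lra|auto| |].
    - intros t Ht. replace (- Re (/ ((a, t) - z)))%R with ((Re z - a) / ((a - Re z)^2 + (t - Im z)^2))%R.
      + apply LB'; auto. apply (HD (a, t)). split; unfold rect; simpl; auto; lra.
      + unfold Cinv; simpl. destruct z; simpl. unfold Rdiv. rewrite <- Ropp_mult_distr_l_reverse.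
        f_equal. ring.
    - apply (is_RInt_opp (V := R_NormedModule)).
      apply Re_is_CRInt, (ex_vint (fun w => / (w - z))); auto. }
  assert (I4 : 0 < Re (vint (fun w => / (w - z)) c d b)).
  { apply (is_RInt_pos (fun y => Re (/ ((b, y) - z)))%R c d _ (m / D^2)); [lra|auto| |].
    - intros t Ht. replace (Re (/ ((b, t) - z)))%R with ((b - Re z) / ((b - Re z)^2 + (t - Im z)^2))%R.
      + apply LB'; auto. apply (HD (b, t)). split; unfold rect; simpl; auto; lra.
      + unfold Cinv; simpl. destruct z; simpl. unfold Rdiv. f_equal.
    - apply Re_is_CRInt, (ex_vint (fun w => / (w - z))); auto. }
  intros E. apply (f_equal Im) in E. unfold windJ, loop in E.
  destruct (hint (fun w => / (w - z)) a b c) as [u1 v1].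
  destruct (hint (fun w => / (w - z)) a b d) as [u2 v2].
  destruct (vint (fun w => / (w - z)) c d a) as [u3 v3].
  destruct (vint (fun w => / (w - z)) c d b) as [u4 v4].
  simpl in E, I1, I2, I3, I4. lra.
Qed.

(** The difference quotient [q] is holomorphic off [z] and bounded near [z] by differentiability.
    Goursat's theorem lets the rectangle shrink to a small square around [z], over whose boundary
    the integral of [q] tends to 0. What remains is [f z] times the integral of the kernel. *)
Lemma cauchy_formula (f : C -> C) (a b c d : R) (z : C) : rect_int a b c d z ->
  (forall w, rect a b c d w -> cdiff f w) ->
  loop (fun w => f w * / (w - z)) a b c d = f z * windJ a b c d z.
Proof.
  intros Hz Hf. assert (Hz' := Hz). destruct Hz' as [[H1 H2] [H3 H4]].
  set (q := fun w => (f w - f z) * / (w - z)).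
  assert (Hq : forall w, rect a b c d w -> w <> z -> cdiff q w).
  { intros w Hw n. unfold q. apply Csub_neq_0 in n. auto 20 with cd. }
  assert (Hq0 : loop q a b c d = 0).
  { destruct (Hf z) as [l Hl]. { unfold rect; lra. }
    rewrite cder_eps in Hl. destruct (Hl 1%R Rlt_0_1) as [dl [Hdl Hd]].
    set (M := (Cmod l + 1)%R).
    (* Points on the boundary of the square of half-side [e] satisfy [Cmod (w - z) <= 2 * e], hence
       [dl / 2]; the other terms keep the square inside the rectangle. *)
    set (e0 := Rmin (dl / 2) (Rmin (Rmin (Re z - a) (b - Re z)) (Rmin (Im z - c) (d - Im z)))).
    assert (He0 : 0 < e0) by (unfold e0; repeat apply Rmin_glb_lt; lra).
    assert (D0 : e0 <= dl / 2) by (apply Rmin_l).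
    assert (D1 : (e0 <= Re z - a)%R) by (unfold e0; eapply Rle_trans; [apply Rmin_r|]; eapply Rle_trans; [apply Rmin_l|apply Rmin_l]).
    assert (D2 : (e0 <= b - Re z)%R) by (unfold e0; eapply Rle_trans; [apply Rmin_r|]; eapply Rle_trans; [apply Rmin_l|apply Rmin_r]).
    assert (D3 : (e0 <= Im z - c)%R) by (unfold e0; eapply Rle_trans; [apply Rmin_r|]; eapply Rle_trans; [apply Rmin_r|apply Rmin_l]).
    assert (D4 : (e0 <= d - Im z)%R) by (unfold e0; eapply Rle_trans; [apply Rmin_r|]; eapply Rle_trans; [apply Rmin_r|apply Rmin_r]).
    clearbody e0.
    assert (HM : 0 < M) by (unfold M; generalize (Cmod_ge_0 l); lra).
    assert (B : forall e, 0 < e < e0 -> Cmod (loop q a b c d) <= M * 8 * e).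
    { intros e He.
      set (x := Re z) in *. set (y := Im z) in *.
      assert (G : forall a' b' c' d', a <= a' -> a' <= b' -> b' <= b -> c <= c' -> c' <= d' -> d' <= d ->
        (b' < x \/ x < a' \/ d' < y \/ y < c')%R -> loop q a' b' c' d' = 0).
      { intros a' b' c' d' A1 A2 A3 A4 A5 A6 A7. apply goursat; auto. intros w Hw. apply Hq.
        - revert Hw. apply rect_mono; auto.
        - intros E. subst w. unfold rect in Hw. fold x y in Hw. lra. }
      assert (Cq : forall a' b' c' d' w, a <= a' -> b' <= b -> c <= c' -> d' <= d ->
          (a' < x < b' /\ c' < y < d' \/ b' < x \/ x < a' \/ d' < y \/ y < c')%R ->
          bdry a' b' c' d' w -> ccont q w).
      { intros a' b' c' d' w A1 A2 A3 A4 A5 [Hw Hw']. apply cdiff_ccont, Hq.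
        - revert Hw. apply rect_mono; auto.
        - intros E. subst w. fold x y in Hw'. unfold rect in Hw. fold x y in Hw. lra. }
      rewrite (loop_split_x q a (x - e) b c d); try lra.
      2:{ intros w. apply Cq; lra. }
      rewrite (G a (x - e) c d)%R; try lra.
      rewrite (loop_split_x q (x - e) (x + e) b c d); try lra.
      2:{ intros w. apply Cq; lra. }
      rewrite (G (x + e) b c d)%R; try lra.
      rewrite (loop_split_y q (x - e) (x + e) c (y - e) d); try lra.
      2:{ intros w. apply Cq; lra. }
      rewrite (G (x - e) (x + e) c (y - e))%R; try lra.
      rewrite (loop_split_y q (x - e) (x + e) (y - e) (y + e) d); try lra.
      2:{ intros w. apply Cq; lra. }
      rewrite (G (x - e) (x + e) (y + e) d)%R; try lra.
      rewrite !Cplus_0_l, !Cplus_0_r.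
      replace (M * 8 * e)%R with (M * (2 * (x + e - (x - e)) + 2 * (y + e - (y - e))))%R by ring.
      apply loop_bound; try lra.
      { intros w. apply Cq; lra. }
      intros w [Hw Hw'].
      assert (n : w <> z). { intros E. subst w. fold x y in Hw'. lra. }
      apply Csub_neq_0 in n. unfold q. rewrite Cmod_mult, Cmod_inv by auto.
      apply Cmod_gt_0 in n.
      assert (Hwz : Cmod (w - z) < dl).
      { eapply Rle_lt_trans; [apply Cmod_le_Re_Im|]. rewrite Re_minus, Im_minus. fold x y.
        unfold rect in Hw.
        assert (Rabs (Re w - x) <= e) by (apply Rabs_le; lra).
        assert (Rabs (Im w - y) <= e) by (apply Rabs_le; lra). lra. }
      specialize (Hd w Hwz).
      apply Rmult_le_reg_r with (Cmod (w - z)); auto.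
      rewrite Rmult_assoc, Rinv_l, Rmult_1_r by lra.
      replace (f w - f z) with ((f w - f z - l * (w - z)) + l * (w - z)) by ring.
      eapply Rle_trans; [apply Cmod_triangle|]. rewrite Cmod_mult. unfold M. lra. }
    apply Cmod_eq_0. apply Rle_antisym; [|apply Cmod_ge_0]. apply Rnot_lt_le. intros Hpos.
    set (L := Cmod (loop q a b c d)) in *.
    assert (P : 0 < Rmin (e0 / 2) (L / (M * 8) / 2)).
    { apply Rmin_glb_lt; [lra|]. assert (0 < L / (M * 8)) by (apply Rdiv_lt_0_compat; lra). lra. }
    assert (P' : Rmin (e0 / 2) (L / (M * 8) / 2) < e0)
      by (eapply Rle_lt_trans; [apply Rmin_l|lra]).
    specialize (B _ (conj P P')).
    assert (B' : M * 8 * Rmin (e0 / 2) (L / (M * 8) / 2) <= M * 8 * (L / (M * 8) / 2)).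
    { apply Rmult_le_compat_l; [lra|apply Rmin_r]. }
    replace (M * 8 * (L / (M * 8) / 2))%R with (L / 2)%R in B' by (field; lra). lra. }
  rewrite loop_ext with (g := fun w => q w + f z * / (w - z)); try lra.
  2:{ intros w Hw. unfold q. ring. }
  rewrite loop_linear; try lra.
  - rewrite Hq0. unfold windJ. ring.
  - intros w Hw. apply cdiff_ccont, Hq. { apply bdry_rect; auto. }
    intros E. apply (bdry_neq _ _ _ _ _ _ Hz Hw). rewrite E. ring.
  - intros w Hw. apply ccont_cauchy_kernel. eapply bdry_neq; eauto.
Qed.

Lemma bdry_bounded (f : C -> C) (a b c d : R) : a <= b -> c <= d ->
  (forall w, bdry a b c d w -> ccont f w) ->
  exists M, 0 < M /\ forall w, bdry a b c d w -> Cmod (f w) <= M.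
Proof.
  intros Hab Hcd H. destruct (bdry_sides _ _ _ _ _ Hab Hcd H) as [F1 [F2 [F3 F4]]].
  assert (S : forall (g : R -> C) p q, p <= q ->
     (forall t, p <= t <= q -> continuous (T := R_UniformSpace) (U := C_R_NormedModule) g t) ->
     exists M, forall t, p <= t <= q -> Cmod (g t) <= M).
  { intros g p q Hpq Hg.
    destruct (continuity_ab_maj (fun t => Cmod (g t)) p q Hpq) as [t0 [Ht0 _]].
    - intros t Ht. apply continuity_pt_filterlim.
      apply (filterlim_ext (fun t => norm (V := C_R_NormedModule) (g t))).
      { intros u. symmetry. apply Cmod_norm. }
      replace (Cmod (g t)) with (norm (V := C_R_NormedModule) (g t)) by (symmetry; apply Cmod_norm).
      eapply filterlim_comp; [apply (Hg t Ht)|]. apply (filterlim_norm (V := C_R_NormedModule)).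
    - exists (Cmod (g t0)). auto. }
  destruct (S (fun x => f (x, c)) a b Hab) as [M1 HM1]. { intros; apply continuous_hor; auto. }
  destruct (S (fun x => f (x, d)) a b Hab) as [M2 HM2]. { intros; apply continuous_hor; auto. }
  destruct (S (fun y => f (a, y)) c d Hcd) as [M3 HM3]. { intros; apply continuous_ver; auto. }
  destruct (S (fun y => f (b, y)) c d Hcd) as [M4 HM4]. { intros; apply continuous_ver; auto. }
  exists (Rabs M1 + Rabs M2 + Rabs M3 + Rabs M4 + 1)%R.
  generalize (Rabs_pos M1) (Rabs_pos M2) (Rabs_pos M3) (Rabs_pos M4)
   (Rle_abs M1) (Rle_abs M2) (Rle_abs M3) (Rle_abs M4). intros. split; [lra|].
  intros [x y] [[Hx Hy] Hw]. simpl in *.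
  destruct Hw as [E|[E|[E|E]]]; rewrite E.
  - specialize (HM3 y Hy). lra.
  - specialize (HM4 y Hy). lra.
  - specialize (HM1 x Hx). lra.
  - specialize (HM2 x Hx). lra.
Qed.

(** Differentiation under the integral sign: a first-order Taylor remainder of the kernel that is
    quadratic uniformly on the contour integrates to a quadratic remainder for the loop. In the
    proof the [+ 1] in [P] keeps it positive for degenerate rectangles. *)
Lemma cder_loop_param (k : C -> C -> C) (k1 : C -> C) (z0 : C) (B r a b c d : R) :
  a <= b -> c <= d -> 0 < r -> 0 < B ->
  (forall z w, Cmod (z - z0) < r -> bdry a b c d w -> ccont (k z) w) ->
  (forall w, bdry a b c d w -> ccont k1 w) ->
  (forall z w, Cmod (z - z0) < r -> bdry a b c d w ->
     Cmod (k z w - k z0 w - (z - z0) * k1 w) <= B * Cmod (z - z0) ^ 2) ->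
  cder (fun z => loop (k z) a b c d) z0 (loop k1 a b c d).
Proof.
  intros Hab Hcd Hr HB Hk Hk1 HE. apply cder_eps. intros e He.
  set (P := (2 * (b - a) + 2 * (d - c) + 1)%R).
  assert (HP : 0 < P) by (unfold P; lra).
  assert (HBP : 0 < B * P) by (apply Rmult_lt_0_compat; auto).
  exists (Rmin r (e / (B * P))). split.
  { apply Rmin_glb_lt; auto. apply Rdiv_lt_0_compat; auto. }
  intros z Hz.
  assert (Z1 : Cmod (z - z0) < r) by (eapply Rlt_le_trans; [apply Hz|apply Rmin_l]).
  assert (Z2 : Cmod (z - z0) < e / (B * P)) by (eapply Rlt_le_trans; [apply Hz|apply Rmin_r]).
  assert (Z0 : Cmod (z0 - z0) < r).
  { replace (z0 - z0) with (RtoC 0) by ring. rewrite Cmod_0; auto. }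
  replace (loop (k z) a b c d - loop (k z0) a b c d - loop k1 a b c d * (z - z0)) with
    (loop (fun w => k z w + (- (1)) * (k z0 w + (z - z0) * k1 w)) a b c d).
  - eapply Rle_trans; [apply (loop_bound _ (B * Cmod (z - z0) ^ 2)); auto|].
    + intros w Hw. apply ccont_plus; [apply Hk; auto|]. apply ccont_mult; [apply ccont_const|].
      apply ccont_plus; [apply Hk; auto|]. apply ccont_mult; [apply ccont_const|auto].
    + intros w Hw.
      replace (k z w + (- (1)) * (k z0 w + (z - z0) * k1 w))
        with (k z w - k z0 w - (z - z0) * k1 w) by ring. auto.
    + replace (2 * (b - a) + 2 * (d - c))%R with (P - 1)%R by (unfold P; ring).
      generalize (Cmod_ge_0 (z - z0)). intros Q.
      set (t := Cmod (z - z0)) in *.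
      apply Rle_trans with (B * P * t * t)%R.
      * assert (0 <= B * (t * t)) by (apply Rmult_le_pos; [lra|apply Rmult_le_pos; lra]).
        replace (B * t ^ 2 * (P - 1))%R with (B * P * t * t - B * (t * t))%R by ring. lra.
      * apply Rmult_le_compat_r; auto.
        apply Rle_trans with (B * P * (e / (B * P)))%R.
        { apply Rmult_le_compat_l; lra. }
        right. field. split; lra.
  - rewrite loop_linear; auto.
    + rewrite loop_linear; auto. ring.
    + intros w Hw. apply ccont_plus; [apply Hk; auto|]. apply ccont_mult; [apply ccont_const|auto].
Qed.

Lemma kernel_bound (phi : C -> C) (a b c d : R) (z0 : C) : rect_int a b c d z0 ->
  (forall w, bdry a b c d w -> ccont phi w) ->
  exists M e, 0 < M /\ 0 < e /\ forall z w, Cmod (z - z0) < e -> bdry a b c d w ->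
    Cmod (phi w) <= M /\ e <= Cmod (w - z0) /\ e <= Cmod (w - z).
Proof.
  intros Hz Hphi. assert (Hz' := Hz). destruct Hz' as [[H1 H2] [H3 H4]].
  destruct (bdry_dist _ _ _ _ _ Hz) as [e [He Hd]].
  destruct (bdry_bounded phi a b c d ltac:(lra) ltac:(lra) Hphi) as [M [HM HM']].
  exists M, (e / 2)%R. repeat split; auto; try lra.
  - specialize (Hd w H0). lra.
  - specialize (Hd w H0). generalize (Cmod_ge_minus (w - z0) (z - z0)).
    replace (w - z0 - (z - z0)) with (w - z) by ring. lra.
Qed.

Lemma cder_cauchy1 (phi : C -> C) (a b c d : R) (z0 : C) : rect_int a b c d z0 ->
  (forall w, bdry a b c d w -> ccont phi w) ->
  cder (fun z => loop (fun w => phi w * / (w - z)) a b c d) z0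
       (loop (fun w => phi w * (/ (w - z0) * / (w - z0))) a b c d).
Proof.
  intros Hz Hphi. assert (Hz' := Hz). destruct Hz' as [[H1 H2] [H3 H4]].
  destruct (kernel_bound phi a b c d z0 Hz Hphi) as [M [e [HM [He HK]]]].
  destruct (rect_int_nbhd _ _ _ _ _ Hz) as [r [Hr Hri]].
  apply (cder_loop_param (fun z w => phi w * / (w - z)) _ z0 (M * (/ e * / e * / e))
    (Rmin r e)); try lra.
  - apply Rmin_glb_lt; auto.
  - repeat apply Rmult_lt_0_compat; auto; apply Rinv_0_lt_compat; auto.
  - intros z w Hzr Hw. apply ccont_mult; auto. apply ccont_cauchy_kernel.
    eapply bdry_neq; eauto. apply Hri. eapply Rlt_le_trans; [apply Hzr|apply Rmin_l].
  - intros w Hw. apply ccont_mult; auto.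
    apply ccont_mult; apply ccont_cauchy_kernel; eapply bdry_neq; eauto.
  - intros z w Hzr Hw.
    destruct (HK z w) as [K1 [K2 K3]]; auto. { eapply Rlt_le_trans; [apply Hzr|apply Rmin_r]. }
    assert (N0 : w - z0 <> 0) by (apply Cmod_gt_0; lra).
    assert (N1 : w - z <> 0) by (apply Cmod_gt_0; lra).
    replace (phi w * / (w - z) - phi w * / (w - z0) - (z - z0) * (phi w * (/ (w - z0) * / (w - z0))))
      with (phi w * ((z - z0) * (z - z0) * (/ (w - z0) * / (w - z0) * / (w - z)))) by (field; auto).
    rewrite !Cmod_mult, !Cmod_inv by auto.
    assert (I0 : (0 < / Cmod (w - z0) <= / e)%R).
    { split; [apply Rinv_0_lt_compat; lra|apply Rinv_le_contravar; lra]. }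
    assert (I1 : (0 < / Cmod (w - z) <= / e)%R).
    { split; [apply Rinv_0_lt_compat; lra|apply Rinv_le_contravar; lra]. }
    assert (Q : (0 <= / Cmod (w - z0) * / Cmod (w - z0) * / Cmod (w - z) <= / e * / e * / e)%R).
    { split. { repeat apply Rmult_le_pos; lra. }
      apply Rmult_le_compat; try lra. { apply Rmult_le_pos; lra. }
      apply Rmult_le_compat; lra. }
    set (t := Cmod (z - z0)). assert (0 <= t * t) by (apply Rle_0_sqr).
    replace (M * (/ e * / e * / e) * t ^ 2)%R with (M * (t * t * (/ e * / e * / e)))%R by ring.
    apply Rmult_le_compat; auto. { apply Cmod_ge_0. } { apply Rmult_le_pos; lra. }
    apply Rmult_le_compat_l; lra.
Qed.

(** [cder_cauchy1] represents the derivative of a Cauchy integral as an integral; this second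
    derivative shows that the representation is itself holomorphic. Higher derivatives are reached
    by iterating [cdiff_C_derive]. *)
Lemma cder_cauchy2 (phi : C -> C) (a b c d : R) (z0 : C) : rect_int a b c d z0 ->
  (forall w, bdry a b c d w -> ccont phi w) ->
  cder (fun z => loop (fun w => phi w * (/ (w - z) * / (w - z))) a b c d) z0
       (loop (fun w => phi w * (2 * (/ (w - z0) * / (w - z0) * / (w - z0)))) a b c d).
Proof.
  intros Hz Hphi. assert (Hz' := Hz). destruct Hz' as [[H1 H2] [H3 H4]].
  destruct (kernel_bound phi a b c d z0 Hz Hphi) as [M [e [HM [He HK]]]].
  destruct (rect_int_nbhd _ _ _ _ _ Hz) as [r [Hr Hri]].
  apply (cder_loop_param (fun z w => phi w * (/ (w - z) * / (w - z))) _ z0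
     (M * (3 * (/ e * / e * / e * / e))) (Rmin r e)); try lra.
  - apply Rmin_glb_lt; auto.
  - repeat apply Rmult_lt_0_compat; auto; try apply Rinv_0_lt_compat; lra.
  - intros z w Hzr Hw. apply ccont_mult; auto.
    assert (w - z <> 0).
    { eapply bdry_neq; eauto. apply Hri. eapply Rlt_le_trans; [apply Hzr|apply Rmin_l]. }
    apply ccont_mult; apply ccont_cauchy_kernel; auto.
  - intros w Hw. apply ccont_mult; auto. apply ccont_mult; [apply ccont_const|].
    repeat apply ccont_mult; apply ccont_cauchy_kernel; eapply bdry_neq; eauto.
  - intros z w Hzr Hw.
    destruct (HK z w) as [K1 [K2 K3]]; auto. { eapply Rlt_le_trans; [apply Hzr|apply Rmin_r]. }
    assert (N0 : w - z0 <> 0) by (apply Cmod_gt_0; lra).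
    assert (N1 : w - z <> 0) by (apply Cmod_gt_0; lra).
    set (i0 := / (w - z0)). set (i1 := / (w - z)).
    replace (phi w * (i1 * i1) - phi w * (i0 * i0) - (z - z0) * (phi w * (2 * (i0 * i0 * i0))))
      with (phi w * ((z - z0) * (z - z0) * (i0 * i0 * i1 * i1 + 2 * (i0 * i0 * i0 * i1))))
      by (unfold i0, i1; field; auto).
    assert (I0 : (0 <= Cmod i0 <= / e)%R).
    { split; [apply Cmod_ge_0|]. unfold i0. rewrite Cmod_inv; auto. apply Rinv_le_contravar; lra. }
    assert (I1 : (0 <= Cmod i1 <= / e)%R).
    { split; [apply Cmod_ge_0|]. unfold i1. rewrite Cmod_inv; auto. apply Rinv_le_contravar; lra. }
    assert (Q : forall x y z t : R, (0 <= x <= / e -> 0 <= y <= / e -> 0 <= z <= / e -> 0 <= t <= / e ->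
       x * y * z * t <= / e * / e * / e * / e)%R).
    { intros. repeat (apply Rmult_le_compat; repeat apply Rmult_le_pos; try lra). }
    rewrite !Cmod_mult. set (t := Cmod (z - z0)). assert (0 <= t * t) by (apply Rle_0_sqr).
    replace (M * (3 * (/ e * / e * / e * / e)) * t ^ 2)%R
      with (M * (t * t * (3 * (/ e * / e * / e * / e))))%R by ring.
    apply Rmult_le_compat; auto. { apply Cmod_ge_0. } { apply Rmult_le_pos; auto; apply Cmod_ge_0. }
    apply Rmult_le_compat_l; auto.
    eapply Rle_trans; [apply Cmod_triangle|]. rewrite !Cmod_mult, Cmod_R, Rabs_right by lra.
    generalize (Q _ _ _ _ I0 I0 I1 I1) (Q _ _ _ _ I0 I0 I0 I1). lra.
Qed.

(* Cauchy integrals over squares: derivatives, uniform limits, division by zeros, identity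
   theorems *)
Opaque loop.

(** Squares play the part of discs. The square of half-side [r] contains the disc of radius [r] and
    lies in the closed disc of radius [2 * r], which explains the choice [R / 3] in the proofs
    below. *)
Definition square (c : C) (r : R) : C -> Prop := rect (Re c - r) (Re c + r) (Im c - r) (Im c + r).
Definition square_int (c : C) (r : R) : C -> Prop :=
  rect_int (Re c - r) (Re c + r) (Im c - r) (Im c + r).
Definition sloop (f : C -> C) (c : C) (r : R) : C :=
  loop f (Re c - r) (Re c + r) (Im c - r) (Im c + r).
Definition sbdry (c : C) (r : R) : C -> Prop := bdry (Re c - r) (Re c + r) (Im c - r) (Im c + r).

Lemma square_Cmod (c w : C) (r : R) : square c r w -> Cmod (w - c) <= 2 * r.
Proof.
  intros [H1 H2]. eapply Rle_trans; [apply Cmod_le_Re_Im|]. rewrite Re_minus, Im_minus.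
  assert (Rabs (Re w - Re c) <= r) by (apply Rabs_le; lra).
  assert (Rabs (Im w - Im c) <= r) by (apply Rabs_le; lra). lra.
Qed.

Lemma Cmod_square_int (c w : C) (r : R) : Cmod (w - c) < r -> square_int c r w.
Proof.
  intros H. generalize (re_le_Cmod (w - c)) (im_le_Cmod (w - c)).
  rewrite Re_minus, Im_minus.
  generalize (Rle_abs (Re w - Re c)) (Rle_abs (- (Re w - Re c)))
    (Rle_abs (Im w - Im c)) (Rle_abs (- (Im w - Im c))). rewrite !Rabs_Ropp.
  unfold square_int, rect_int. lra.
Qed.

Lemma square_int_center (c : C) (r : R) : 0 < r -> square_int c r c.
Proof. intros H. unfold square_int, rect_int. lra. Qed.

Lemma sbdry_Cmod (c w : C) (r : R) : 0 < r -> sbdry c r w -> r <= Cmod (w - c).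
Proof.
  intros Hr [_ H]. generalize (re_le_Cmod (w - c)) (im_le_Cmod (w - c)).
  rewrite Re_minus, Im_minus.
  generalize (Rle_abs (Re w - Re c)) (Rle_abs (- (Re w - Re c)))
    (Rle_abs (Im w - Im c)) (Rle_abs (- (Im w - Im c))). rewrite !Rabs_Ropp.
  destruct H as [H|[H|[H|H]]]; lra.
Qed.

Definition cauchyI (f : C -> C) (c : C) (r : R) (z : C) : C :=
  sloop (fun w => f w * / (w - z)) c r.

(** Stands in for [2 i pi]. It is treated as a function of [z], holomorphic as the Cauchy integral
    of 1 and without zeros inside the square, so that holomorphic functions are quotients
    [cauchyI f c r z / swind c r z]. *)
Definition swind (c : C) (r : R) (z : C) : C :=
  windJ (Re c - r) (Re c + r) (Im c - r) (Im c + r) z.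

Lemma swind_neq_0 (c : C) (r : R) (z : C) : square_int c r z -> swind c r z <> 0.
Proof. apply windJ_neq_0. Qed.

Lemma swind_cauchyI (c : C) (r : R) (z : C) : 0 < r -> swind c r z = cauchyI (fun _ => 1) c r z.
Proof.
  intros Hr. unfold swind, windJ, cauchyI, sloop. apply loop_ext; try lra.
  intros w _. ring.
Qed.

Lemma cauchyI_formula (f : C -> C) (c : C) (r : R) (z : C) : square_int c r z ->
  (forall w, square c r w -> cdiff f w) -> f z = cauchyI f c r z / swind c r z.
Proof.
  intros Hz Hf. assert (N := swind_neq_0 _ _ _ Hz).
  assert (E := cauchy_formula f _ _ _ _ z Hz Hf).
  unfold cauchyI, sloop. rewrite E. fold (swind c r z). field. auto.
Qed.

Lemma cdiff_cauchyI (f : C -> C) (c : C) (r : R) (z : C) : square_int c r z ->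
  (forall w, sbdry c r w -> ccont f w) -> cdiff (cauchyI f c r) z.
Proof. intros Hz Hf. eexists. exact (cder_cauchy1 f _ _ _ _ z Hz Hf). Qed.

Lemma cdiff_swind (c : C) (r : R) (z : C) : square_int c r z -> cdiff (swind c r) z.
Proof.
  intros Hz. assert (Hr : 0 < r) by (destruct Hz; lra).
  apply cdiff_ext with (cauchyI (fun _ => 1) c r).
  { intros w. symmetry. apply swind_cauchyI; auto. }
  apply cdiff_cauchyI; auto. intros; apply ccont_const.
Qed.

Lemma cdiff_cauchy_quot (f : C -> C) (c : C) (r : R) (z : C) : square_int c r z ->
  (forall w, sbdry c r w -> ccont f w) -> cdiff (fun w => cauchyI f c r w / swind c r w) z.
Proof.
  intros Hz Hf. apply cdiff_div; [apply swind_neq_0|apply cdiff_cauchyI|apply cdiff_swind]; auto.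
Qed.

Lemma square_int_nbhd (c z : C) (r : R) : square_int c r z ->
  exists e, 0 < e /\ forall w, Cmod (w - z) < e -> square_int c r w.
Proof. apply rect_int_nbhd. Qed.

(** Near [c] the function is the quotient of the two Cauchy integrals [If] and [I1]. The quotient
    rule writes its derivative as [G], built from these and their first derivatives, all of which
    are differentiable once more; and [G] agrees with [C_derive f] on a whole disc, not only at
    [c]. *)
Lemma cdiff_C_derive (f : C -> C) (c : C) (R : R) : 0 < R ->
  (forall w, Cmod (w - c) < R -> cdiff f w) -> cdiff (C_derive f) c.
Proof.
  intros HR Hf. set (r := (R / 3)%R). assert (Hr : 0 < r) by (unfold r; lra).
  assert (Hf' : forall w, square c r w -> cdiff f w).
  { intros w Hw. apply Hf. apply square_Cmod in Hw. unfold r in *. lra. }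
  assert (Hfc : forall w, sbdry c r w -> ccont f w).
  { intros w [Hw _]. apply cdiff_ccont, Hf'. auto. }
  set (D := fun g z => sloop (fun w => g w * (/ (w - z) * / (w - z))) c r).
  assert (HD : forall g, (forall w, sbdry c r w -> ccont g w) ->
    forall z, square_int c r z -> cder (cauchyI g c r) z (D g z)).
  { intros g Hg z Hz. exact (cder_cauchy1 g _ _ _ _ z Hz Hg). }
  assert (HDD : forall g, (forall w, sbdry c r w -> ccont g w) ->
    forall z, square_int c r z -> cdiff (D g) z).
  { intros g Hg z Hz. eexists. exact (cder_cauchy2 g _ _ _ _ z Hz Hg). }
  assert (C1 : forall w, sbdry c r w -> ccont (fun _ => 1) w) by (intros; apply ccont_const).
  set (I1 := cauchyI (fun _ => 1) c r). set (If := cauchyI f c r).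
  set (G := fun z => (D f z * I1 z - If z * D (fun _ => 1) z) / (I1 z * I1 z)).
  assert (NI : forall z, square_int c r z -> I1 z <> 0).
  { intros z Hz. unfold I1. rewrite <- swind_cauchyI by auto. apply swind_neq_0; auto. }
  assert (E : forall z, square_int c r z -> C_derive f z = G z).
  { intros z Hz. apply cder_C_derive.
    destruct (square_int_nbhd _ _ _ Hz) as [e [He Hn]].
    apply cder_ext_loc with (f := fun z => If z / I1 z) (r := e); auto.
    - intros w Hw. symmetry. unfold I1. rewrite <- swind_cauchyI by auto.
      apply cauchyI_formula; auto.
    - apply cder_div; [apply NI; auto| |]; apply HD; auto. }
  apply cdiff_ext_loc with (f := G) (r := r); auto.
  - intros w Hw. symmetry. apply E, Cmod_square_int. auto.
  - assert (Hc := square_int_center c r Hr).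
    assert (cdiff If c) by (eexists; apply HD; auto).
    assert (cdiff I1 c) by (eexists; apply HD; auto).
    assert (H1 := HDD f Hfc c Hc). assert (H2 := HDD _ C1 c Hc). assert (N := NI c Hc).
    apply (cdiff_div (fun z => D f z * I1 z - If z * D (fun _ => 1) z) (fun z => I1 z * I1 z)).
    + apply Cmult_neq_0; exact N.
    + exact (cdiff_minus _ _ _ (cdiff_mult _ _ _ H1 H0) (cdiff_mult _ _ _ H H2)).
    + exact (cdiff_mult _ _ _ H0 H0).
Qed.

Lemma cauchyI_bound (c : C) (r : R) (z : C) : square_int c r z ->
  exists K, 0 < K /\ forall f e, 0 <= e -> (forall w, sbdry c r w -> ccont f w) ->
    (forall w, sbdry c r w -> Cmod (f w) <= e) -> Cmod (cauchyI f c r z) <= K * e.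
Proof.
  intros Hz. assert (Hr : 0 < r) by (destruct Hz; lra).
  destruct (bdry_dist _ _ _ _ _ Hz) as [d [Hd Hd']].
  exists (/ d * (8 * r))%R. split.
  { apply Rmult_lt_0_compat; [apply Rinv_0_lt_compat; auto|lra]. }
  intros f e He Hf Hfe.
  replace (/ d * (8 * r) * e)%R with (e * / d * (2 * (Re c + r - (Re c - r)) + 2 * (Im c + r - (Im c - r))))%R by ring.
  apply loop_bound; try lra.
  - intros w Hw. apply ccont_mult; auto. apply ccont_cauchy_kernel.
    eapply bdry_neq; eauto.
  - intros w Hw. assert (N := bdry_neq _ _ _ _ _ _ Hz Hw).
    rewrite Cmod_mult, Cmod_inv by auto. specialize (Hd' w Hw).
    apply Rmult_le_compat; auto. { apply Cmod_ge_0. }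
    { left. apply Rinv_0_lt_compat; lra. } { apply Rinv_le_contravar; lra. }
Qed.

Lemma cauchyI_minus (f g : C -> C) (c : C) (r : R) (z : C) : square_int c r z ->
  (forall w, sbdry c r w -> ccont f w) -> (forall w, sbdry c r w -> ccont g w) ->
  cauchyI (fun w => f w - g w) c r z = cauchyI f c r z - cauchyI g c r z.
Proof.
  intros Hz Hf Hg. assert (Hr : 0 < r) by (destruct Hz; lra).
  assert (Ck : forall w, sbdry c r w -> ccont (fun w => / (w - z)) w).
  { intros w Hw. apply ccont_cauchy_kernel. eapply bdry_neq; eauto. }
  unfold cauchyI, sloop.
  rewrite loop_ext with (g := fun w => f w * / (w - z) + (- (1)) * (g w * / (w - z))); try lra.
  - rewrite loop_linear; try lra.
    + ring.
    + intros w Hw. apply ccont_mult; [apply Hf|apply Ck]; auto.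
    + intros w Hw. apply ccont_mult; [apply Hg|apply Ck]; auto.
  - intros; ring.
Qed.

Lemma Cmod_le_all_eps (z : C) (K : R) :
  (forall e, 0 < e -> Cmod z <= K * e) -> z = 0.
Proof.
  intros H. apply Cmod_eq_0. apply Rle_antisym; [|apply Cmod_ge_0].
  apply Rnot_lt_le. intros Hp.
  assert (HK : 0 < K).
  { specialize (H 1%R Rlt_0_1). lra. }
  specialize (H (Cmod z / K / 2)%R).
  assert (0 < Cmod z / K) by (apply Rdiv_lt_0_compat; auto).
  specialize (H ltac:(lra)).
  replace (K * (Cmod z / K / 2))%R with (Cmod z / 2)%R in H by (field; lra). lra.
Qed.

(** The limit is continuous, so its Cauchy integral exists and is holomorphic. Cauchy's formula for
    the approximants passes to the limit, because [cauchyI_bound] controls the integral by the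
    supremum on the contour, and [f] is thus its own Cauchy quotient. *)
Lemma weierstrass (f : C -> C) (c : C) (R : R) : 0 < R ->
  (forall e, 0 < e -> exists g, forall w, Cmod (w - c) < R -> cdiff g w /\ Cmod (g w - f w) <= e) ->
  cdiff f c.
Proof.
  intros HR H. set (r := (R / 3)%R). assert (Hr : 0 < r) by (unfold r; lra).
  assert (Hsq : forall w, square c r w -> Cmod (w - c) < R).
  { intros w Hw. apply square_Cmod in Hw. unfold r in *. lra. }
  assert (Hfc : forall w, Cmod (w - c) < R -> ccont f w).
  { intros w Hw e He. destruct (H (e / 4)%R) as [g Hg]; [lra|].
    destruct (cdiff_ccont _ _ (proj1 (Hg w Hw)) (e / 4)%R) as [d [Hd Hd']]; [lra|].
    exists (Rmin d (R - Cmod (w - c))). split; [apply Rmin_glb_lt; lra|].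
    intros v Hv.
    assert (V1 : Cmod (v - w) < d) by (eapply Rlt_le_trans; [apply Hv|apply Rmin_l]).
    assert (V2 : Cmod (v - w) < R - Cmod (w - c)) by (eapply Rlt_le_trans; [apply Hv|apply Rmin_r]).
    assert (V3 : Cmod (v - c) < R).
    { replace (v - c) with ((v - w) + (w - c)) by ring.
      eapply Rle_lt_trans; [apply Cmod_triangle|]. lra. }
    specialize (Hd' v V1). destruct (Hg v V3) as [_ G1]. destruct (Hg w Hw) as [_ G2].
    replace (f v - f w) with ((f v - g v) + ((g v - g w) + (g w - f w))) by ring.
    rewrite Cmod_sub_sym in G1.
    eapply Rle_lt_trans; [apply Cmod_triangle|].
    generalize (Cmod_triangle (g v - g w) (g w - f w)). lra. }
  assert (Hfb : forall w, sbdry c r w -> ccont f w).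
  { intros w [Hw _]. apply Hfc, Hsq. auto. }
  apply cdiff_ext_loc with (f := fun z => cauchyI f c r z / swind c r z) (r := r); auto.
  2:{ apply cdiff_cauchy_quot; auto. apply square_int_center; auto. }
  intros z Hz. apply Cmod_square_int in Hz. assert (N := swind_neq_0 _ _ _ Hz).
  destruct (cauchyI_bound c r z Hz) as [K [HK HKb]].
  assert (E : cauchyI f c r z - f z * swind c r z = 0).
  { apply Cmod_le_all_eps with (K + Cmod (swind c r z))%R. intros e He.
    destruct (H e He) as [g Hg].
    assert (Hgd : forall w, square c r w -> cdiff g w) by (intros w Hw; apply Hg; auto).
    assert (Hgb : forall w, sbdry c r w -> ccont g w).
    { intros w [Hw _]. apply cdiff_ccont; auto. }
    assert (Eg := cauchyI_formula g c r z Hz Hgd).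
    replace (cauchyI f c r z - f z * swind c r z) with
      ((cauchyI f c r z - cauchyI g c r z) + (g z - f z) * swind c r z)
      by (rewrite Eg; field; auto).
    eapply Rle_trans; [apply Cmod_triangle|]. rewrite Rmult_plus_distr_r.
    apply Rplus_le_compat.
    - rewrite <- cauchyI_minus; auto. apply HKb; try lra.
      + intros w Hw. apply ccont_plus; auto. apply ccont_opp; auto.
      + intros w [Hw _]. rewrite Cmod_sub_sym. apply Hg; auto.
    - rewrite Cmod_mult, Rmult_comm. apply Rmult_le_compat_l; [apply Cmod_ge_0|].
      apply Hg, Hsq. destruct Hz as [Hz1 Hz2]. split; lra. }
  replace (f z) with ((f z * swind c r z) / swind c r z) by (field; auto).
  f_equal. replace (cauchyI f c r z) with ((cauchyI f c r z - f z * swind c r z) + f z * swind c r z) by ring.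
  rewrite E. ring.
Qed.

(** The removable singularity of the slope [(f w - f a) / (w - a)]: the holomorphic extension [G] is
    the Cauchy quotient of the slope taken on the boundary, where [w <> a]. *)
Lemma difference_quotient (f : C -> C) (a : C) (R : R) : 0 < R ->
  (forall w, Cmod (w - a) < R -> cdiff f w) ->
  exists G, cdiff G a /\ G a = C_derive f a /\
    exists r, 0 < r /\ forall w, Cmod (w - a) < r -> f w = f a + G w * (w - a).
Proof.
  intros HR Hf. set (r := (R / 3)%R). assert (Hr : 0 < r) by (unfold r; lra).
  assert (Hsq : forall w, square a r w -> cdiff f w).
  { intros w Hw. apply Hf. apply square_Cmod in Hw. unfold r in *. lra. }
  set (phi := fun w => (f w - f a) * / (w - a)).
  assert (Ha := square_int_center a r Hr).
  assert (Hna : forall w, sbdry a r w -> w - a <> 0).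
  { intros w Hw. exact (bdry_neq _ _ _ _ _ _ Ha Hw). }
  assert (Hphi : forall w, sbdry a r w -> ccont phi w).
  { intros w Hw. specialize (Hna w Hw). destruct Hw as [Hw _]. specialize (Hsq w Hw).
    apply cdiff_ccont. unfold phi. auto 20 with cd. }
  set (G := fun z => cauchyI phi a r z / swind a r z).
  assert (HGd : cdiff G a) by exact (cdiff_cauchy_quot phi a r a Ha Hphi).
  assert (HG : forall w, Cmod (w - a) < r -> f w = f a + G w * (w - a)).
  { intros z Hz. apply Cmod_square_int in Hz.
    set (u := fun w => f w - f a).
    assert (Hu : forall w, square a r w -> cdiff u w) by (intros; unfold u; auto with cd).
    assert (Hub : forall w, sbdry a r w -> ccont u w).
    { intros w [Hw _]. apply cdiff_ccont; auto. }
    assert (E1 := cauchyI_formula u a r z Hz Hu).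
    assert (E2 := cauchyI_formula u a r a Ha Hu).
    assert (N := swind_neq_0 _ _ _ Hz). assert (Na := swind_neq_0 _ _ _ Ha).
    assert (E3 : cauchyI u a r a = 0).
    { replace (cauchyI u a r a) with (u a * swind a r a) by (rewrite E2; field; auto).
      unfold u. ring. }
    (* The partial fraction [/ (w - z) = / (w - a) + (z - a) / ((w - a) * (w - z))], multiplied by
       [u] and integrated. *)
    assert (E4 : cauchyI u a r z = cauchyI u a r a + (z - a) * cauchyI phi a r z).
    { unfold cauchyI, sloop.
      rewrite <- loop_linear; try lra.
      - apply loop_ext; try lra. intros w Hw. unfold phi, u.
        assert (w - z <> 0) by (eapply bdry_neq; eauto).
        specialize (Hna w Hw). field; auto.
      - intros w Hw. apply ccont_mult; [apply Hub; auto|]. apply ccont_cauchy_kernel, Hna, Hw.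
      - intros w Hw. apply ccont_mult; [apply Hphi; auto|]. apply ccont_cauchy_kernel.
        eapply bdry_neq; eauto. }
    replace (f z) with (f a + u z) by (unfold u; ring). rewrite E1, E4, E3. unfold G.
    field. auto. }
  exists G. split; [auto|split].
  - symmetry. apply cder_C_derive.
    apply cder_ext_loc with (f := fun w => f a + G w * (w - a)) (r := r); auto.
    { intros w Hw. symmetry. auto. }
    exists G. split; [apply cdiff_ccont; auto|]. split; auto. intros w. ring.
  - exists r. auto.
Qed.

Lemma simple_zero_quotient (f h : C -> C) (a : C) (R : R) : 0 < R ->
  (forall w, Cmod (w - a) < R -> cdiff f w) ->
  (forall w, Cmod (w - a) < R -> cdiff h w) ->
  f a = 0 -> h a = 0 -> C_derive h a <> 0 ->
  exists q r, cdiff q a /\ q a = C_derive f a / C_derive h a /\ 0 < r /\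
    forall w, Cmod (w - a) < r -> w <> a -> h w <> 0 /\ f w / h w = q w.
Proof.
  intros HR Hf Hh Ef Eh Nh.
  destruct (difference_quotient f a R HR Hf) as [F [HF [HFa [r1 [Hr1 E1]]]]].
  destruct (difference_quotient h a R HR Hh) as [H [HH [HHa [r2 [Hr2 E2]]]]].
  destruct (ccont_nonzero H a (cdiff_ccont _ _ HH)) as [r3 [Hr3 N3]]; [rewrite HHa; auto|].
  exists (fun w => F w / H w), (Rmin r1 (Rmin r2 r3)).
  split; [apply cdiff_div; auto; rewrite HHa; auto|].
  split; [rewrite HFa, HHa; auto|]. split; [repeat apply Rmin_glb_lt; auto|].
  intros w Hw n.
  assert (W1 : Cmod (w - a) < r1) by (eapply Rlt_le_trans; [apply Hw|apply Rmin_l]).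
  assert (W2 : Cmod (w - a) < r2).
  { eapply Rlt_le_trans; [apply Hw|]. eapply Rle_trans; [apply Rmin_r|apply Rmin_l]. }
  assert (W3 : Cmod (w - a) < r3).
  { eapply Rlt_le_trans; [apply Hw|]. eapply Rle_trans; [apply Rmin_r|apply Rmin_r]. }
  rewrite (E1 w W1), (E2 w W2), Ef, Eh. specialize (N3 w W3). apply Csub_neq_0 in n.
  split.
  - rewrite Cplus_0_l. apply Cmult_neq_0; auto.
  - field. auto.
Qed.

(** On zeros of [h] the quotient takes the value dictated by l'Hôpital. *)
Lemma entire_quotient (f h : C -> C) :
  (forall z, cdiff f z) -> (forall z, cdiff h z) ->
  (forall a, h a = 0 -> f a = 0 /\ C_derive h a <> 0) ->
  exists q, (forall z, cdiff q z) /\ forall z, f z = q z * h z.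
Proof.
  intros Hf Hh H0.
  exists (fun z => if excluded_middle_informative (h z = 0) then C_derive f z / C_derive h z
                   else f z / h z).
  split.
  - intros a. destruct (classic (h a = 0)) as [E|N].
    + destruct (H0 a E) as [Ef Nd].
      destruct (simple_zero_quotient f h a 1 Rlt_0_1) as [q [r [Hq [Hqa [Hr Hqr]]]]]; auto.
      apply cdiff_ext_loc with (f := q) (r := r); auto.
      intros w Hw. destruct (excluded_middle_informative (h w = 0)) as [E'|N'].
      * destruct (classic (w = a)) as [->|n]; auto.
        destruct (Hqr w Hw n). tauto.
      * symmetry. apply Hqr; auto. intros ->. auto.
    + destruct (ccont_nonzero h a (cdiff_ccont _ _ (Hh a)) N) as [r [Hr Hr']].
      apply cdiff_ext_loc with (f := fun z => f z / h z) (r := r); auto.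
      * intros w Hw. destruct (excluded_middle_informative (h w = 0)); auto.
        elim (Hr' w Hw); auto.
      * apply cdiff_div; auto.
  - intros z. destruct (excluded_middle_informative (h z = 0)) as [E|N].
    + rewrite E, (proj1 (H0 z E)). ring.
    + field. auto.
Qed.

(** Dividing by [(w - c)^n] and letting [n] grow in Cauchy's formula. *)
Lemma identity_square (f : C -> C) (c : C) (r e : R) : 0 < r -> 0 < e ->
  (forall w, square c r w -> cdiff f w) ->
  (forall w, Cmod (w - c) < e -> f w = 0) ->
  forall z, Cmod (z - c) < r -> f z = 0.
Proof.
  intros Hr He Hf H0 z Hz.
  destruct (classic (z = c)) as [->|nz].
  { apply H0. replace (c - c) with (RtoC 0) by ring. rewrite Cmod_0; auto. }
  assert (Hzi := Cmod_square_int _ _ _ Hz).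
  set (g := fun n w => f w * / (w - c) ^ n).
  (* At [w = c] the quotient involves [/ 0], but [f] vanishes identically near [c], so [g n] does
     too. *)
  assert (Hg : forall n w, square c r w -> cdiff (g n) w).
  { intros n w Hw. destruct (classic (w = c)) as [->|nw].
    - apply cdiff_ext_loc with (f := fun _ => 0) (r := e); auto; [|apply cdiff_const].
      intros v Hv. unfold g. rewrite (H0 v Hv). ring.
    - unfold g. apply Csub_neq_0 in nw. apply cdiff_mult; auto.
      apply cdiff_inv; auto with cd. apply Cpow_nz; auto. }
  destruct (cauchyI_bound c r z Hzi) as [K [HK HKb]].
  assert (N := swind_neq_0 _ _ _ Hzi).
  assert (Hfb : forall w, sbdry c r w -> ccont f w).
  { intros w [Hw _]. apply cdiff_ccont; auto. }
  destruct (bdry_bounded f (Re c - r) (Re c + r) (Im c - r) (Im c + r)) as [M [HM HMb]];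
    try lra; auto.
  set (t := (Cmod (z - c) / r)%R).
  assert (Pz : 0 < Cmod (z - c)) by (apply Cmod_gt_0, Csub_neq_0; auto).
  assert (Ht : 0 < t < 1).
  { unfold t. split; [apply Rdiv_lt_0_compat; auto|].
    apply Rmult_lt_reg_r with r; auto. unfold Rdiv. rewrite Rmult_assoc, Rinv_l; lra. }
  (* On the contour [Cmod (w - c) >= r], so [g n] is at most [M / r ^ n] there, while [z] is
     strictly closer to [c]: multiplying back by [(z - c) ^ n] leaves the geometric factor
     [t ^ n]. *)
  assert (B : forall n, Cmod (f z * swind c r z) <= K * M * t ^ n).
  { intros n. assert (E := cauchyI_formula (g n) c r z Hzi (Hg n)).
    assert (Nn : (z - c) ^ n <> 0) by (apply Cpow_nz, Csub_neq_0; auto).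
    replace (f z * swind c r z) with ((z - c) ^ n * cauchyI (g n) c r z).
    2:{ replace (cauchyI (g n) c r z) with (g n z * swind c r z) by (rewrite E; field; auto).
        unfold g. field. auto. }
    assert (Prn : 0 < r ^ n) by (apply pow_lt; auto).
    assert (Q : Cmod (cauchyI (g n) c r z) <= K * (M * / r ^ n)).
    { apply HKb.
      - apply Rmult_le_pos; [lra|]. left. apply Rinv_0_lt_compat; auto.
      - intros w [Hw _]. apply cdiff_ccont, Hg; auto.
      - intros w Hw. unfold g. assert (Pw := sbdry_Cmod c w r Hr Hw).
        assert (w - c <> 0) by (apply Cmod_gt_0; lra).
        rewrite Cmod_mult, Cmod_inv, Cmod_pow by (apply Cpow_nz; auto).
        apply Rmult_le_compat; [apply Cmod_ge_0| |apply HMb; auto|].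
        + left. apply Rinv_0_lt_compat, pow_lt; lra.
        + apply Rinv_le_contravar; auto. apply pow_incr; lra. }
    rewrite Cmod_mult, Cmod_pow. unfold t, Rdiv. rewrite Rpow_mult_distr, pow_inv.
    replace (K * M * (Cmod (z - c) ^ n * / r ^ n))%R
      with (Cmod (z - c) ^ n * (K * (M * / r ^ n)))%R by ring.
    apply Rmult_le_compat_l; auto. apply pow_le; lra. }
  assert (E : f z * swind c r z = 0).
  { apply Cmod_le_all_eps with (K * M)%R. intros e' He'.
    destruct (pow_lt_1_zero t) with (y := e') as [n Hn]; auto.
    { rewrite Rabs_right; lra. }
    specialize (Hn n (Nat.le_refl n)). rewrite Rabs_right in Hn by (left; apply pow_lt; lra).
    eapply Rle_trans; [apply (B n)|]. apply Rmult_le_compat_l; [|lra].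
    left. apply Rmult_lt_0_compat; auto. }
  replace (f z) with (f z * swind c r z / swind c r z) by (field; auto).
  rewrite E. field. auto.
Qed.

(** A single large square replaces a chain of discs: its centre lies deep in the region where [f]
    vanishes, it stays inside the half-plane of holomorphy, and its inscribed disc reaches [z]. *)
Lemma identity_half_plane (f : C -> C) (a b : R) :
  (forall w, a < Re w -> cdiff f w) -> (forall w, b < Re w -> f w = 0) ->
  forall z, a < Re z -> f z = 0.
Proof.
  intros Hf H0 z Hz.
  set (x := (Re z - a)%R). set (y := Im z). assert (Hx : 0 < x) by (unfold x; lra).
  (* the disc of centre [a + T] and radius [T] fills the half-plane as [T] grows *)
  set (T := (Rmax (Rabs (b - a) + 1) ((x ^ 2 + y ^ 2) / (2 * x) + 1))%R).
  assert (T1 : Rabs (b - a) + 1 <= T) by apply Rmax_l.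
  assert (T2 : (x ^ 2 + y ^ 2) / (2 * x) + 1 <= T) by apply Rmax_r.
  set (c := (a + T, 0)%R : C).
  assert (HTp : 0 < T) by (generalize (Rabs_pos (b - a)); lra).
  assert (HzT : Cmod (z - c) < T).
  { apply Rsqr_incrst_0; [|apply Cmod_ge_0|lra]. rewrite !Rsqr_pow2, Cmod2_alt, Re_minus, Im_minus.
    change (Re c) with (a + T)%R. change (Im c) with 0%R.
    replace (Re z - (a + T))%R with (x - T)%R by (unfold x; ring). fold y.
    assert (x ^ 2 + y ^ 2 < 2 * x * T)%R; [|lra].
    replace (x ^ 2 + y ^ 2)%R with ((2 * x) * ((x ^ 2 + y ^ 2) / (2 * x)))%R by (field; lra).
    apply Rmult_lt_compat_l; lra. }
  set (r := ((Cmod (z - c) + T) / 2)%R).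
  apply (identity_square f c r 1); unfold r; try lra.
  - generalize (Cmod_ge_0 (z - c)). lra.
  - intros w [Hw _]. change (Re c) with (a + T)%R in Hw. apply Hf. lra.
  - intros w Hw. apply H0. generalize (re_le_Cmod (w - c)). rewrite Re_minus.
    change (Re c) with (a + T)%R.
    generalize (Rle_abs (- (Re w - (a + T)))) (Rle_abs (b - a)). rewrite Rabs_Ropp. lra.
Qed.

(** The same argument with a square strictly above or below the real axis, on the side of [z]. It
    thereby avoids the real point [p], and the abscissa [b + 1] of its centre places a unit disc in
    the region where [f] vanishes. *)
Lemma identity_off_real (f : C -> C) (p : C) (b : R) : Im p = 0%R ->
  (forall w, w <> p -> cdiff f w) -> (forall w, b < Re w -> f w = 0) ->
  forall z, Im z <> 0%R -> f z = 0.
Proof.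
  intros Hp Hf H0 z Hz.
  set (x := (Re z - (b + 1))%R). set (y := Rabs (Im z)).
  assert (Hy : 0 < y) by (apply Rabs_pos_lt; auto).
  set (T := (Rmax 1 ((x ^ 2 + y ^ 2) / (2 * y) + 1))%R).
  assert (T1 : 1 <= T) by apply Rmax_l.
  assert (T2 : (x ^ 2 + y ^ 2) / (2 * y) + 1 <= T) by apply Rmax_r.
  assert (HS : exists s, ((s = 1 \/ s = -1) /\ Im z = s * y)%R).
  { unfold y. destruct (Rle_dec 0 (Im z)).
    - exists 1%R. rewrite Rabs_right by lra. split; [auto|lra].
    - exists (-1)%R. rewrite Rabs_left by lra. split; [auto|lra]. }
  destruct HS as [s [Hs Es]].
  set (c := (b + 1, s * T)%R : C).
  assert (HzT : Cmod (z - c) < T).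
  { apply Rsqr_incrst_0; [|apply Cmod_ge_0|lra]. rewrite !Rsqr_pow2, Cmod2_alt, Re_minus, Im_minus.
    change (Re c) with (b + 1)%R. change (Im c) with (s * T)%R. fold x. rewrite Es.
    replace ((s * y - s * T)^2)%R with ((y - T)^2)%R by (destruct Hs; subst s; ring).
    assert (x ^ 2 + y ^ 2 < 2 * y * T)%R; [|lra].
    replace (x ^ 2 + y ^ 2)%R with ((2 * y) * ((x ^ 2 + y ^ 2) / (2 * y)))%R by (field; lra).
    apply Rmult_lt_compat_l; lra. }
  set (r := ((Cmod (z - c) + T) / 2)%R).
  apply (identity_square f c r 1); unfold r; try lra.
  - generalize (Cmod_ge_0 (z - c)). lra.
  - intros w [_ Hw]. change (Im c) with (s * T)%R in Hw. apply Hf. intros ->.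
    rewrite Hp in Hw. destruct Hs; subst s; lra.
  - intros w Hw. apply H0. generalize (re_le_Cmod (w - c)). rewrite Re_minus.
    change (Re c) with (b + 1)%R.
    generalize (Rle_abs (- (Re w - (b + 1)))). rewrite Rabs_Ropp. lra.
Qed.

(** Real points other than [p] follow by continuity: a nonzero value would persist a little above
    the axis. *)
Lemma identity_punctured (f : C -> C) (p : C) (b : R) : Im p = 0%R ->
  (forall w, w <> p -> cdiff f w) -> (forall w, b < Re w -> f w = 0) ->
  forall z, z <> p -> f z = 0.
Proof.
  intros Hp Hf H0 z Hz.
  destruct (Req_dec (Im z) 0) as [E|N]; [|eapply identity_off_real; eauto].
  apply NNPP. intros Nf.
  destruct (ccont_nonzero f z (cdiff_ccont _ _ (Hf z Hz)) Nf) as [r [Hr Hr']].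
  apply (Hr' (z + Ci * RtoC (r / 2))).
  - replace (z + Ci * RtoC (r / 2) - z) with (Ci * RtoC (r / 2)) by ring.
    rewrite Cmod_mult, Cmod_Ci, Rmult_1_l, Cmod_R, Rabs_right; lra.
  - apply (identity_off_real f p b); auto.
    replace (Im (z + Ci * RtoC (r / 2))) with (Im z + r / 2)%R by (destruct z; simpl; ring). lra.
Qed.

(** * Complex powers and the binomial remainder *)

Lemma Cexp_plus (z w : C) : Cexp (z + w) = Cexp z * Cexp w.
Proof.
  destruct z as [x y], w as [u v]. unfold Cexp, Cmult, Cplus; simpl.
  rewrite exp_plus, cos_plus, sin_plus. f_equal; ring.
Qed.

Lemma Cexp_0 : Cexp 0 = 1.
Proof. unfold Cexp; simpl. rewrite exp_0, cos_0, sin_0. unfold RtoC. f_equal; ring. Qed.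

Lemma Cexp_opp (z : C) : Cexp (- z) * Cexp z = 1.
Proof. rewrite <- Cexp_plus. replace (- z + z) with (RtoC 0) by ring. apply Cexp_0. Qed.

Lemma Cexp_neq_0 (z : C) : Cexp z <> 0.
Proof.
  intros E. assert (H := Cexp_opp z). rewrite E in H. rewrite Cmult_0_r in H.
  apply C1_nz. symmetry. exact H.
Qed.

Lemma Cmod_Cexp (z : C) : Cmod (Cexp z) = exp (Re z).
Proof.
  unfold Cmod, Cexp; simpl. rewrite <- sqrt_Rsqr by (left; apply exp_pos). f_equal.
  unfold Rsqr. generalize (sin2_cos2 (Im z)). unfold Rsqr. intros E.
  transitivity (exp (Re z) * exp (Re z) * (sin (Im z) * sin (Im z) + cos (Im z) * cos (Im z)))%R.
  { ring. } rewrite E. ring.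
Qed.

Lemma Cexp_RtoC (x : R) : Cexp (RtoC x) = RtoC (exp x).
Proof. unfold Cexp, RtoC; simpl. rewrite cos_0, sin_0. f_equal; ring. Qed.

Lemma derivable_pt_lim_0 (f : R -> R) (l : R) : derivable_pt_lim f 0 l ->
  forall e, 0 < e -> exists d, 0 < d /\ forall h, Rabs h < d -> Rabs (f h - f 0 - l * h) <= e * Rabs h.
Proof.
  intros H e He. destruct (H e He) as [d Hd]. exists d. split; [apply cond_pos|].
  intros h Hh. destruct (Req_dec h 0) as [->|n].
  { replace (f 0 - f 0 - l * 0)%R with 0%R by ring. rewrite Rabs_R0. lra. }
  specialize (Hd h n Hh). rewrite Rplus_0_l in Hd.
  replace (f h - f 0 - l * h)%R with (((f h - f 0) / h - l) * h)%R by (field; auto).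
  rewrite Rabs_mult. apply Rmult_le_compat_r; [apply Rabs_pos|lra].
Qed.

Lemma cder_Cexp_0 : cder Cexp 0 1.
Proof.
  (* The real and the imaginary part each cost [3 * e * Cmod w], hence the 6; the cap by 1 serves to
     bound [1 + x] by 2 and [exp x - 1] by [2 * e]. *)
  apply cder_eps. intros e0 He0. set (e := (Rmin e0 1 / 6)%R).
  assert (Me : Rmin e0 1 <= e0) by apply Rmin_l. assert (Me' : Rmin e0 1 <= 1) by apply Rmin_r.
  assert (He : 0 < e) by (unfold e; assert (0 < Rmin e0 1) by (apply Rmin_glb_lt; lra); lra).
  assert (He1 : (6 * e <= e0 /\ e <= 1)%R) by (unfold e; lra).
  destruct (derivable_pt_lim_0 exp 1) with (e := e) as [d1 [Hd1 H1]]; auto.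
  { rewrite <- exp_0. apply derivable_pt_lim_exp. }
  destruct (derivable_pt_lim_0 cos 0) with (e := e) as [d2 [Hd2 H2]]; auto.
  { replace 0%R with (- sin 0)%R at 2 by (rewrite sin_0; ring). apply derivable_pt_lim_cos. }
  destruct (derivable_pt_lim_0 sin 1) with (e := e) as [d3 [Hd3 H3]]; auto.
  { rewrite <- cos_0. apply derivable_pt_lim_sin. }
  exists (Rmin (Rmin d1 d2) (Rmin d3 e)). split; [repeat apply Rmin_glb_lt; auto|].
  intros w Hw. replace (w - 0) with w in * by ring. rewrite Cexp_0.
  assert (W : (Cmod w < d1 /\ Cmod w < d2 /\ Cmod w < d3 /\ Cmod w < e)%R).
  { generalize (Rmin_l (Rmin d1 d2) (Rmin d3 e)) (Rmin_r (Rmin d1 d2) (Rmin d3 e))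
    (Rmin_l d1 d2) (Rmin_r d1 d2) (Rmin_l d3 e) (Rmin_r d3 e). lra. }
  destruct w as [x y]. set (m := Cmod (x, y)) in *.
  assert (Hx : Rabs x <= m) by (apply (re_le_Cmod (x, y))).
  assert (Hy : Rabs y <= m) by (apply (im_le_Cmod (x, y))).
  specialize (H1 x ltac:(lra)). specialize (H2 y ltac:(lra)). specialize (H3 y ltac:(lra)).
  rewrite exp_0 in H1. rewrite cos_0 in H2. rewrite sin_0 in H3.
  eapply Rle_trans; [apply Cmod_le_Re_Im|].
  assert (HR : Rabs (Re (Cexp (x, y) - 1 - 1 * (x, y))) <= e * m + 2 * e * m).
  { replace (Re (Cexp (x, y) - 1 - 1 * (x, y))) with
     ((exp x - 1 - 1 * x) * cos y + (1 + x) * (cos y - 1 - 0 * y))%R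
     by (unfold Cexp; simpl; ring).
    eapply Rle_trans; [apply Rabs_triang|]. rewrite !Rabs_mult.
    assert (Rabs (cos y) <= 1) by (apply Rabs_le; generalize (COS_bound y); lra).
    assert (Rabs (1 + x) <= 2) by (eapply Rle_trans; [apply Rabs_triang|]; rewrite Rabs_R1; lra).
    assert (e * Rabs x <= e * m) by (apply Rmult_le_compat_l; lra).
    assert (e * Rabs y <= e * m) by (apply Rmult_le_compat_l; lra).
    apply Rplus_le_compat.
    - rewrite <- (Rmult_1_r (e * m)). apply Rmult_le_compat; try apply Rabs_pos; lra.
    - rewrite Rmult_assoc. apply Rmult_le_compat; try apply Rabs_pos; lra. }
  assert (HI : Rabs (Im (Cexp (x, y) - 1 - 1 * (x, y))) <= 2 * e * m + e * m).
  { replace (Im (Cexp (x, y) - 1 - 1 * (x, y))) with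
     ((exp x - 1) * sin y + (sin y - 0 - 1 * y))%R
     by (unfold Cexp; simpl; ring).
    eapply Rle_trans; [apply Rabs_triang|]. rewrite !Rabs_mult.
    assert (e * Rabs x <= 1 * Rabs x) by (apply Rmult_le_compat_r; [apply Rabs_pos|lra]).
    assert (e * Rabs y <= e * m) by (apply Rmult_le_compat_l; lra).
    assert (Rabs (exp x - 1) <= 2 * e).
    { replace (exp x - 1)%R with ((exp x - 1 - 1 * x) + x)%R by ring.
      eapply Rle_trans; [apply Rabs_triang|]. lra. }
    assert (Rabs (sin y) <= m).
    { apply Rle_trans with (Rabs y); auto.
      destruct (Rle_dec 0 y).
      - rewrite (Rabs_right y) by lra. destruct (Req_dec y 0) as [->|].
        { rewrite sin_0, Rabs_R0. lra. }
        apply Rabs_le. split; [|left; apply sin_lt_x; lra].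
        assert (0 <= sin y) by (apply sin_ge_0; generalize PI2_1 (Rle_abs y); lra). lra.
      - rewrite (Rabs_left y) by lra. apply Rabs_le.
        assert (S1 : (sin (- y) < - y)%R) by (apply sin_lt_x; lra). rewrite sin_neg in S1.
        assert (S2 : 0 <= sin (- y)) by (apply sin_ge_0; generalize PI2_1;
          rewrite Rabs_left in Hy by lra; lra). rewrite sin_neg in S2. lra. }
    apply Rplus_le_compat; [|lra]. apply Rmult_le_compat; try apply Rabs_pos; lra. }
  assert (6 * e * m <= e0 * m) by (apply Rmult_le_compat_r; [apply Cmod_ge_0|lra]). lra.
Qed.

Lemma cder_Cexp (z : C) : cder Cexp z (Cexp z).
Proof.
  apply cder_ext with (fun w => Cexp z * Cexp (w - z)).
  { intros w. rewrite <- Cexp_plus. f_equal. ring. }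
  eapply cder_eq.
  - apply cder_scal. apply (cder_comp Cexp (fun w => w - z) z 1 (1 - 0)).
    + replace (z - z) with (RtoC 0) by ring. apply cder_Cexp_0.
    + apply cder_minus; [apply cder_id|apply cder_const].
  - ring.
Qed.

Lemma Rcpow_plus (a : R) (s t : C) : Rcpow a (s + t) = Rcpow a s * Rcpow a t.
Proof. unfold Rcpow. rewrite <- Cexp_plus. f_equal. ring. Qed.

Lemma Rcpow_mult (a b : R) (s : C) : 0 < a -> 0 < b -> Rcpow (a * b) s = Rcpow a s * Rcpow b s.
Proof.
  intros Ha Hb. unfold Rcpow. rewrite <- Cexp_plus. f_equal.
  rewrite ln_mult by auto. rewrite RtoC_plus. ring.
Qed.

Lemma Rcpow_neq_0 (a : R) (s : C) : Rcpow a s <> 0.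
Proof. apply Cexp_neq_0. Qed.

Lemma Rcpow_0 (a : R) : Rcpow a 0 = 1.
Proof. unfold Rcpow. rewrite Cmult_0_l. apply Cexp_0. Qed.

Lemma Rcpow_1 (a : R) : 0 < a -> Rcpow a 1 = RtoC a.
Proof.
  intros Ha. unfold Rcpow. rewrite Cmult_1_l, Cexp_RtoC, exp_ln; auto.
Qed.

Lemma Rcpow_opp (a : R) (s : C) : Rcpow a (- s) = / Rcpow a s.
Proof.
  assert (N := Rcpow_neq_0 a s).
  assert (E : Rcpow a (- s) * Rcpow a s = 1).
  { rewrite <- Rcpow_plus. replace (- s + s) with (RtoC 0) by ring. apply Rcpow_0. }
  replace (Rcpow a (- s)) with (Rcpow a (- s) * Rcpow a s / Rcpow a s) by (field; auto).
  rewrite E. field; auto.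
Qed.

Lemma Rcpow_base_1 (s : C) : Rcpow 1 s = 1.
Proof. unfold Rcpow. rewrite ln_1, Cmult_0_r. apply Cexp_0. Qed.

Lemma Cmod_Rcpow (a : R) (s : C) : Cmod (Rcpow a s) = exp (Re s * ln a).
Proof. unfold Rcpow. rewrite Cmod_Cexp. f_equal. destruct s; simpl; ring. Qed.

Lemma Rcpow_nat (a : R) (n : nat) : 0 < a -> Rcpow a (RtoC (INR n)) = RtoC a ^ n.
Proof.
  intros Ha. induction n as [|n IH].
  - apply Rcpow_0.
  - rewrite S_INR, RtoC_plus, Rcpow_plus, IH, Rcpow_1 by auto. simpl. ring.
Qed.

Lemma cder_Rcpow (a : R) (s : C) : cder (Rcpow a) s (RtoC (ln a) * Rcpow a s).
Proof.
  unfold Rcpow. eapply cder_eq.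
  - apply (cder_comp Cexp (fun w => w * RtoC (ln a))).
    + apply cder_Cexp.
    + apply cder_mult; [apply cder_id|apply cder_const].
  - cbv beta. ring.
Qed.

Lemma cdiff_Rcpow (a : R) (u : C -> C) (s : C) : cdiff u s -> cdiff (fun w => Rcpow a (u w)) s.
Proof.
  intros H. apply (cdiff_comp (Rcpow a)); auto. eexists; apply cder_Rcpow.
Qed.
#[export] Hint Resolve cdiff_Rcpow : cd.

(** * Complex-valued functions of a real variable *)

Definition rder (g : R -> C) (t : R) (l : C) : Prop :=
  is_derive (fun u => Re (g u)) t (Re l) /\ is_derive (fun u => Im (g u)) t (Im l).

Lemma rder_plus (f g : R -> C) (t : R) (a b : C) :
  rder f t a -> rder g t b -> rder (fun u => f u + g u) t (a + b).
Proof.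
  intros [F1 F2] [G1 G2]. split; simpl; apply (is_derive_plus (V := R_NormedModule)); auto.
Qed.

Lemma rder_scal (k : C) (f : R -> C) (t : R) (a : C) :
  rder f t a -> rder (fun u => k * f u) t (k * a).
Proof.
  intros [F1 F2]. destruct k as [k1 k2]. split; simpl.
  - apply (is_derive_minus (V := R_NormedModule));
    apply (is_derive_scal (fun u => _ (f u))); auto.
  - apply (is_derive_plus (V := R_NormedModule));
    apply (is_derive_scal (fun u => _ (f u))); auto.
Qed.

Lemma rder_RtoC (f : R -> R) (t a : R) : is_derive f t a -> rder (fun u => RtoC (f u)) t (RtoC a).
Proof. intros H. split; simpl; auto. apply (is_derive_const (V := R_NormedModule)). Qed.

(** The mean value theorem fails for complex values, so it is applied to the real function
    [Re (k * g t)] with [k] the conjugate of [g v - g 0]. Its increment is the square of the modulus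
    to be bounded, and one factor of that modulus cancels. *)
Lemma rder_mean_value (g g' : R -> C) (v M : R) :
  (forall t, Rmin 0 v <= t <= Rmax 0 v -> rder g t (g' t) /\ Cmod (g' t) <= M) ->
  Cmod (g v - g 0%R) <= M * Rabs v.
Proof.
  intros H. set (k := Cconj (g v - g 0%R)).
  set (h := fun t => Re (k * g t)).
  destruct (MVT_gen h 0 v (fun t => Re (k * g' t))) as [x [Hx E]].
  - intros t Ht. apply (rder_scal k g). apply H; lra.
  - intros t Ht. apply continuity_pt_filterlim.
    apply (ex_derive_continuous h). eexists. apply (rder_scal k g t). apply H; auto.
  - assert (Eh : (h v - h 0 = Cmod (g v - g 0%R) ^ 2)%R).
    { unfold h. rewrite <- Re_minus. replace (k * g v - k * g 0%R) with ((g v - g 0%R) * k) by ring.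
      unfold k. rewrite <- Cmod2_conj. reflexivity. }
    destruct (H x Hx) as [_ HM].
    assert (Hk : Cmod k = Cmod (g v - g 0%R)) by apply Cmod_conj.
    set (m := Cmod (g v - g 0%R)) in *.
    assert (Hm : 0 <= m) by apply Cmod_ge_0.
    assert (B : (m ^ 2 <= m * M * Rabs v)%R).
    { rewrite <- Eh, E, Rminus_0_r.
      eapply Rle_trans; [apply Rle_abs|]. rewrite Rabs_mult.
      apply Rmult_le_compat_r; [apply Rabs_pos|].
      eapply Rle_trans; [apply re_le_Cmod|]. rewrite Cmod_mult, Hk.
      apply Rmult_le_compat_l; auto. }
    destruct (Req_dec m 0) as [E0|N0].
    + rewrite E0. apply Rmult_le_pos; [|apply Rabs_pos].
      eapply Rle_trans; [apply Cmod_ge_0|apply HM].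
    + apply Rmult_le_reg_l with m; [lra|]. simpl in B. lra.
Qed.

(** * Finite sums and falling factorials *)

Fixpoint csum (f : nat -> C) (n : nat) : C :=
  match n with O => 0 | S m => csum f m + f m end.

Lemma csum_ext (f g : nat -> C) (n : nat) :
  (forall i, (i < n)%nat -> f i = g i) -> csum f n = csum g n.
Proof.
  intros H. induction n as [|n IH]; simpl; auto. rewrite IH, H; auto.
Qed.

Lemma csum_plus (f g : nat -> C) (n : nat) : csum (fun i => f i + g i) n = csum f n + csum g n.
Proof. induction n as [|n IH]; simpl; [ring|]. rewrite IH; ring. Qed.

Lemma csum_scal (k : C) (f : nat -> C) (n : nat) : csum (fun i => k * f i) n = k * csum f n.
Proof. induction n as [|n IH]; simpl; [ring|]. rewrite IH; ring. Qed.

Lemma csum_exchange (f : nat -> nat -> C) (n m : nat) :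
  csum (fun i => csum (fun j => f i j) m) n = csum (fun j => csum (fun i => f i j) n) m.
Proof.
  induction n as [|n IH]; simpl.
  - induction m as [|m IHm]; simpl; auto. rewrite <- IHm. ring.
  - rewrite IH, <- csum_plus. reflexivity.
Qed.

Lemma csum_shift (f : nat -> C) (n : nat) : csum f (S n) = f O + csum (fun i => f (S i)) n.
Proof. induction n as [|n IH]; [simpl; ring|]. change (csum f (S (S n))) with (csum f (S n) + f (S n)).
  rewrite IH. simpl. ring. Qed.

Lemma cdiff_csum (f : nat -> C -> C) (n : nat) (z : C) :
  (forall i, (i < n)%nat -> cdiff (f i) z) -> cdiff (fun w => csum (fun i => f i w) n) z.
Proof.
  intros H. induction n as [|n IH]; simpl; [apply cdiff_const|].
  apply cdiff_plus; auto.
Qed.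

Fixpoint falling (p : C) (n : nat) : C :=
  match n with O => 1 | S m => p * falling (p - 1) m end.

Lemma falling_S (p : C) (n : nat) : falling p (S n) = falling p n * (p - RtoC (INR n)).
Proof.
  revert p. induction n as [|n IH]; intros p.
  - simpl. ring.
  - change (falling p (S (S n))) with (p * falling (p - 1) (S n)). rewrite IH.
    change (falling p (S n)) with (p * falling (p - 1) n). rewrite S_INR, RtoC_plus. ring.
Qed.

Lemma falling_zero (n k : nat) : (n < k)%nat -> falling (RtoC (INR n)) k = 0.
Proof.
  intros H. induction k as [|k IH]; [lia|]. rewrite falling_S.
  destruct (Nat.eq_dec n k) as [->|].
  - ring.
  - rewrite IH by lia. ring.
Qed.

Lemma falling_fact (n : nat) : falling (RtoC (INR n)) n = RtoC (INR (fact n)).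
Proof.
  induction n as [|n IH]; [reflexivity|].
  change (falling (RtoC (INR (S n))) (S n)) with
    (RtoC (INR (S n)) * falling (RtoC (INR (S n)) - 1) n).
  replace (RtoC (INR (S n)) - 1) with (RtoC (INR n)) by (rewrite S_INR, RtoC_plus; ring).
  rewrite IH, <- RtoC_mult. change (fact (S n)) with (S n * fact n)%nat. rewrite mult_INR. auto.
Qed.

Lemma cdiff_falling (n : nat) (u : C -> C) (z : C) :
  cdiff u z -> cdiff (fun w => falling (u w) n) z.
Proof.
  revert u. induction n as [|n IH]; intros u Hu; simpl; [apply cdiff_const|].
  apply cdiff_mult; auto. apply (IH (fun w => u w - 1)). auto with cd.
Qed.
#[export] Hint Resolve cdiff_falling : cd.

Lemma Cmod_falling_bound (n : nat) (p : C) (r : R) : Cmod p <= r ->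
  Cmod (falling p n) <= (r + INR n) ^ n.
Proof.
  revert p r. induction n as [|n IH]; intros p r Hp.
  - simpl. rewrite Cmod_1. lra.
  - change (falling p (S n)) with (p * falling (p - 1) n). rewrite Cmod_mult.
    change ((r + INR (S n)) ^ S n)%R with ((r + INR (S n)) * (r + INR (S n)) ^ n)%R.
    assert (0 <= INR n) by apply pos_INR. assert (P := Cmod_ge_0 p). rewrite S_INR.
    apply Rmult_le_compat; try apply Cmod_ge_0; try lra.
    replace (r + (INR n + 1))%R with (r + 1 + INR n)%R by ring. apply IH.
    eapply Rle_trans; [apply Cmod_triangle|]. rewrite Cmod_opp, Cmod_1. lra.
Qed.

(** * Taylor remainder of the binomial series *)

Definition binomial_remainder (K : nat) (p : C) (v : R) : C :=
  Rcpow (1 + v) p - csum (fun j => falling p j / RtoC (INR (fact j)) * RtoC v ^ j) K.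

Lemma INR_fact_C (n : nat) : RtoC (INR (fact n)) <> 0.
Proof. intros E. apply RtoC_inj in E. apply (INR_fact_neq_0 n E). Qed.

Lemma rder_Rcpow (p : C) (v : R) : -1 < v ->
  rder (fun t => Rcpow (1 + t) p) v (p * Rcpow (1 + v) (p - 1)).
Proof.
  intros Hv. unfold Cminus. rewrite Rcpow_plus, Rcpow_opp, Rcpow_1 by lra.
  rewrite <- RtoC_inv by lra.
  destruct p as [a b]. unfold Rcpow, Cexp. split; simpl.
  - auto_derive; [lra|]. unfold Rminus. field. lra.
  - auto_derive; [lra|]. unfold Rminus. field. lra.
Qed.

Lemma rder_pow (n : nat) (v : R) :
  rder (fun t => RtoC t ^ S n) v (RtoC (INR (S n)) * RtoC v ^ n).
Proof.
  rewrite <- RtoC_pow, <- RtoC_mult.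
  assert (E : forall t, RtoC t ^ S n = RtoC (t ^ S n)) by (intros; symmetry; apply RtoC_pow).
  assert (H := rder_RtoC (fun t => (t ^ S n)%R) v (INR (S n) * v ^ n)%R).
  destruct H as [H1 H2].
  - auto_derive; auto. simpl pred. rewrite Rmult_1_l. reflexivity.
  - split; [refine (is_derive_ext _ _ _ _ _ H1)|refine (is_derive_ext _ _ _ _ _ H2)];
    intros t; rewrite E; reflexivity.
Qed.

Lemma rder_csum (f : nat -> R -> C) (f' : nat -> C) (t : R) (n : nat) :
  (forall i, rder (f i) t (f' i)) -> rder (fun u => csum (fun i => f i u) n) t (csum f' n).
Proof.
  intros H. induction n as [|n IH]; simpl.
  - apply (rder_RtoC (fun _ => 0%R) t 0%R). apply (is_derive_const (V := R_NormedModule)).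
  - apply rder_plus; auto.
Qed.

Lemma rder_ext (f g : R -> C) (t : R) (l : C) : (forall u, f u = g u) -> rder f t l -> rder g t l.
Proof.
  intros E [H1 H2]. split.
  - refine (is_derive_ext _ _ _ _ _ H1). intros u. rewrite E. reflexivity.
  - refine (is_derive_ext _ _ _ _ _ H2). intros u. rewrite E. reflexivity.
Qed.

Lemma RtoC_INR_S_neq_0 (n : nat) : RtoC (INR (S n)) <> 0.
Proof. intros E. apply RtoC_inj in E. apply (not_0_INR (S n)); auto. Qed.

Lemma rder_binomial_remainder (K : nat) (p : C) (v : R) : -1 < v ->
  rder (binomial_remainder (S K) p) v (p * binomial_remainder K (p - 1) v).
Proof.
  intros Hv.
  apply rder_ext with (fun t => Rcpow (1 + t) p + (- (1)) * (RtoC 1 +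
     csum (fun j => falling p (S j) / RtoC (INR (fact (S j))) * RtoC t ^ S j) K)).
  { intros t. unfold binomial_remainder. rewrite csum_shift. simpl falling. simpl fact. simpl Cpow.
    rewrite INR_1. field. }
  replace (p * binomial_remainder K (p - 1) v) with
    (p * Rcpow (1 + v) (p - 1) + (- (1)) * (RtoC 0 +
      csum (fun j => falling p (S j) / RtoC (INR (fact (S j))) * (RtoC (INR (S j)) * RtoC v ^ j)) K)).
  - apply rder_plus; [apply rder_Rcpow; auto|]. apply rder_scal, rder_plus.
    + apply (rder_RtoC (fun _ => 1%R) v 0%R). apply (is_derive_const (V := R_NormedModule)).
    + apply (rder_csum (fun j t => falling p (S j) / RtoC (INR (fact (S j))) * RtoC t ^ S j)).
      intros j. apply rder_scal, rder_pow.
  - assert (E : csum (fun j => falling p (S j) / RtoC (INR (fact (S j))) *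
                      (RtoC (INR (S j)) * RtoC v ^ j)) K =
      p * csum (fun j => falling (p - 1) j / RtoC (INR (fact j)) * RtoC v ^ j) K).
    { rewrite <- csum_scal. apply csum_ext. intros j _.
      change (falling p (S j)) with (p * falling (p - 1) j).
      change (fact (S j)) with (S j * fact j)%nat. rewrite mult_INR, RtoC_mult.
      field. split; [apply INR_fact_C|apply RtoC_INR_S_neq_0]. }
    rewrite E. unfold binomial_remainder. ring.
Qed.

Lemma binomial_remainder_0 (K : nat) (p : C) : binomial_remainder (S K) p 0 = 0.
Proof.
  unfold binomial_remainder. rewrite csum_shift, Rplus_0_r, Rcpow_base_1.
  replace (csum _ K) with (RtoC 0).
  - simpl. field.
  - induction K as [|K IH]; [reflexivity|]. cbn [csum]. rewrite <- IH. simpl Cpow. ring.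
Qed.

Lemma Rabs_ln_half (v : R) : Rabs v <= / 2 -> Rabs (ln (1 + v)) <= 1.
Proof.
  intros H. apply Rabs_le_between in H.
  assert (E1 : 2 < exp 1). { generalize (exp_ineq1 1). lra. }
  apply Rabs_le. split.
  - replace (- (1))%R with (ln (exp (- (1)))) by apply ln_exp.
    left. apply ln_increasing; [apply exp_pos|]. rewrite exp_Ropp.
    apply Rlt_le_trans with (/ 2)%R; [|lra]. apply Rinv_lt_contravar; lra.
  - apply Rle_trans with (ln (exp 1)); [left; apply ln_increasing; lra|rewrite ln_exp; lra].
Qed.

Lemma exp_le (x y : R) : x <= y -> exp x <= exp y.
Proof. intros [H|H]; [left; apply exp_increasing; auto|rewrite H; lra]. Qed.

(** Differentiation in [v] lowers both [K] and [p] by one, so the mean value inequality gives an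
    induction on [K]. The base case uses [Rabs (ln (1 + v)) <= 1], and each step replaces
    [Cmod (p - 1)] by [Cmod p + 1], whence [INR K] in the exponent. The factor [falling p K] is
    carried exactly: it makes the remainder vanish when [p] is a natural number below [K], which
    yields the values of zeta at even points. *)
Lemma binomial_remainder_bound (K : nat) (p : C) (v : R) : Rabs v <= / 2 ->
  Cmod (binomial_remainder K p v) <= exp (Cmod p + INR K) * Cmod (falling p K) * Rabs v ^ K.
Proof.
  revert p v. induction K as [|K IH]; intros p v Hv.
  - unfold binomial_remainder. simpl csum. simpl falling. simpl pow. simpl INR.
    replace (Rcpow (1 + v) p - 0) with (Rcpow (1 + v) p) by ring.
    rewrite Cmod_Rcpow, Cmod_1, Rplus_0_r, !Rmult_1_r. apply exp_le.
    eapply Rle_trans; [apply Rle_abs|]. rewrite Rabs_mult.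
    rewrite <- (Rmult_1_r (Cmod p)).
    apply Rmult_le_compat; try apply Rabs_pos; [apply re_le_Cmod|apply Rabs_ln_half; auto].
  - replace (binomial_remainder (S K) p v) with (binomial_remainder (S K) p v - binomial_remainder (S K) p 0%R)
      by (rewrite binomial_remainder_0; ring).
    eapply Rle_trans.
    + apply (rder_mean_value _ (fun t => p * binomial_remainder K (p - 1) t) v
        (exp (Cmod p + INR (S K)) * Cmod (falling p (S K)) * Rabs v ^ K)).
      intros t Ht.
      assert (Htv : Rabs t <= Rabs v).
      { destruct (Rle_dec 0 v) as [P|P].
        - rewrite Rmin_left, Rmax_right in Ht by lra. rewrite !Rabs_right; lra.
        - rewrite Rmin_right, Rmax_left in Ht by lra. rewrite (Rabs_left v) by lra.
          apply Rabs_le. lra. }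
      split.
      * apply rder_binomial_remainder. apply Rle_trans with (2 := Hv) in Htv.
        apply Rabs_le_between in Htv. lra.
      * rewrite Cmod_mult. change (falling p (S K)) with (p * falling (p - 1) K).
        rewrite Cmod_mult, S_INR.
        eapply Rle_trans; [apply Rmult_le_compat_l; [apply Cmod_ge_0|apply IH; lra]|].
        assert (Ee : exp (Cmod (p - 1) + INR K) <= exp (Cmod p + (INR K + 1))).
        { apply exp_le. generalize (Cmod_triangle p (- (1))). rewrite Cmod_opp, Cmod_1.
          unfold Cminus. lra. }
        assert (Ev : Rabs t ^ K <= Rabs v ^ K).
        { apply pow_incr. split; [apply Rabs_pos|auto]. }
        assert (P1 := Cmod_ge_0 p). assert (P2 := Cmod_ge_0 (falling (p - 1) K)).
        assert (P3 : 0 <= Rabs t ^ K) by (apply pow_le, Rabs_pos).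
        assert (P4 := exp_pos (Cmod (p - 1) + INR K)).
        apply Rle_trans with (exp (Cmod (p - 1) + INR K) * (Cmod p * Cmod (falling (p - 1) K)) * Rabs t ^ K)%R.
        { right; ring. }
        apply Rmult_le_compat; auto.
        { apply Rmult_le_pos; [lra|]. apply Rmult_le_pos; auto. }
        apply Rmult_le_compat_r; auto. apply Rmult_le_pos; auto.
    + right. simpl pow. ring.
Qed.

(** * Limits of complex sequences *)

Definition clim (u : nat -> C) (l : C) : Prop :=
  forall e, 0 < e -> exists N, forall n, (N <= n)%nat -> Cmod (u n - l) < e.

Lemma clim_unique (u : nat -> C) (l l' : C) : clim u l -> clim u l' -> l = l'.
Proof.
  intros H H'. apply NNPP. intros n. apply Csub_neq_0, Cmod_gt_0 in n.
  destruct (H (Cmod (l - l') / 2)%R) as [N HN]; [lra|].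
  destruct (H' (Cmod (l - l') / 2)%R) as [N' HN']; [lra|].
  specialize (HN (Nat.max N N') (Nat.le_max_l _ _)).
  specialize (HN' (Nat.max N N') (Nat.le_max_r _ _)).
  set (w := u (Nat.max N N')) in *.
  generalize (Cmod_triangle (l - w) (w - l')).
  replace (l - w + (w - l')) with (l - l') by ring. rewrite (Cmod_sub_sym l w). lra.
Qed.

Lemma clim_const (k : C) : clim (fun _ => k) k.
Proof.
  intros e He. exists O. intros n _. replace (k - k) with (RtoC 0) by ring. rewrite Cmod_0. auto.
Qed.

Lemma clim_plus (u v : nat -> C) (a b : C) :
  clim u a -> clim v b -> clim (fun n => u n + v n) (a + b).
Proof.
  intros H H' e He. destruct (H (e / 2)%R) as [N HN]; [lra|].
  destruct (H' (e / 2)%R) as [N' HN']; [lra|].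
  exists (Nat.max N N'). intros n Hn. specialize (HN n ltac:(lia)). specialize (HN' n ltac:(lia)).
  replace (u n + v n - (a + b)) with ((u n - a) + (v n - b)) by ring.
  eapply Rle_lt_trans; [apply Cmod_triangle|]. lra.
Qed.

Lemma clim_comp (f : C -> C) (u : nat -> C) (a : C) :
  ccont f a -> clim u a -> clim (fun n => f (u n)) (f a).
Proof.
  intros Hf H e He. destruct (Hf e He) as [d [Hd H']]. destruct (H d Hd) as [N HN].
  exists N. intros n Hn. auto.
Qed.

Lemma clim_scal (k : C) (u : nat -> C) (a : C) : clim u a -> clim (fun n => k * u n) (k * a).
Proof.
  intros H. apply (clim_comp (fun z => k * z)); auto. apply cdiff_ccont; auto with cd.
Qed.

Lemma clim_opp (u : nat -> C) (a : C) : clim u a -> clim (fun n => - u n) (- a).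
Proof. intros H. apply (clim_comp Copp); auto. apply ccont_opp, ccont_id. Qed.

Lemma clim_mult (u v : nat -> C) (a b : C) :
  clim u a -> clim v b -> clim (fun n => u n * v n) (a * b).
Proof.
  intros Hu Hv.
  assert (Sq : forall w c, clim w c -> clim (fun n => w n * w n) (c * c)).
  { intros w c H. apply (clim_comp (fun z => z * z)); auto. apply cdiff_ccont; auto with cd. }
  (* polarisation *)
  assert (H := clim_plus _ _ _ _ (Sq _ _ (clim_plus _ _ _ _ Hu Hv))
     (clim_opp _ _ (Sq _ _ (clim_plus _ _ _ _ Hu (clim_opp _ _ Hv))))).
  apply (clim_scal (/ 4)) in H.
  replace (a * b) with (/ 4 * ((a + b) * (a + b) + - ((a + - b) * (a + - b)))) by field.
  intros e He. destruct (H e He) as [N HN]. exists N. intros n Hn. specialize (HN n Hn).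
  replace (u n * v n) with (/ 4 * ((u n + v n) * (u n + v n) + - ((u n + - v n) * (u n + - v n)))) by field.
  exact HN.
Qed.

Lemma clim_ext (u v : nat -> C) (a : C) (N0 : nat) :
  (forall n, (N0 <= n)%nat -> u n = v n) -> clim u a -> clim v a.
Proof.
  intros E H e He. destruct (H e He) as [N HN]. exists (Nat.max N N0). intros n Hn.
  rewrite <- E by lia. apply HN; lia.
Qed.

Lemma clim_subseq (u : nat -> C) (a : C) (phi : nat -> nat) :
  (forall n, (n <= phi n)%nat) -> clim u a -> clim (fun n => u (phi n)) a.
Proof.
  intros Hp H e He. destruct (H e He) as [N HN]. exists N. intros n Hn.
  apply HN. specialize (Hp n). lia.
Qed.

Lemma clim_csum (f : nat -> nat -> C) (l : nat -> C) (n : nat) :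
  (forall i, (i < n)%nat -> clim (f i) (l i)) -> clim (fun N => csum (fun i => f i N) n) (csum l n).
Proof.
  intros H. induction n as [|n IH]; simpl.
  - apply clim_const.
  - apply clim_plus; auto.
Qed.

Lemma INR_S_pos (n : nat) : 0 < INR (S n).
Proof. apply lt_0_INR. lia. Qed.

Lemma archimed_inv (B e : R) : 0 <= B -> 0 < e -> exists N, forall n, (N <= n)%nat -> B / INR (S n) < e.
Proof.
  intros HB He. destruct (INR_archimed e B He) as [N HN]. exists N. intros n Hn.
  assert (P := INR_S_pos n). apply Rmult_lt_reg_r with (INR (S n)); auto.
  unfold Rdiv. rewrite Rmult_assoc, Rinv_l, Rmult_1_r by lra.
  apply le_INR in Hn. rewrite S_INR in *.
  assert (INR N * e <= INR n * e) by (apply Rmult_le_compat_r; lra). lra.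
Qed.

(** The explicit rate survives in the limit. With [B] independent of a parameter it becomes the
    uniform convergence that [weierstrass] asks for. *)
Lemma clim_of_cauchy (u : nat -> C) (B : R) (N0 : nat) : 0 <= B ->
  (forall n m, (N0 <= n)%nat -> (n <= m)%nat -> Cmod (u m - u n) <= B / INR (S n)) ->
  exists l, clim u l /\ forall n, (N0 <= n)%nat -> Cmod (l - u n) <= B / INR (S n).
Proof.
  intros HB H.
  assert (HC : forall g : C -> R, (forall z w, Rabs (g z - g w) <= Cmod (z - w)) ->
     Cauchy_crit (fun n => g (u n))).
  { intros g Hg e He. destruct (archimed_inv B e HB He) as [N HN].
    exists (Nat.max N N0). intros n m Hn Hm. unfold Rdist.
    eapply Rle_lt_trans; [apply Hg|].
    destruct (Nat.le_ge_cases n m).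
    - rewrite Cmod_sub_sym. eapply Rle_lt_trans; [apply H; lia|apply HN; lia].
    - eapply Rle_lt_trans; [apply H; lia|apply HN; lia]. }
  destruct (Rcomplete.R_complete _ (HC Re (fun z w => re_le_Cmod (z - w)))) as [x Hx].
  destruct (Rcomplete.R_complete _ (HC Im (fun z w => im_le_Cmod (z - w)))) as [y Hy].
  assert (L : clim u (x, y)).
  { intros e He. destruct (Hx (e / 2)%R) as [N1 H1]; [lra|].
    destruct (Hy (e / 2)%R) as [N2 H2]; [lra|].
    exists (Nat.max N1 N2). intros n Hn. eapply Rle_lt_trans; [apply Cmod_le_Re_Im|].
    rewrite Re_minus, Im_minus. specialize (H1 n ltac:(lia)). specialize (H2 n ltac:(lia)).
    unfold Rdist in *. simpl. lra. }
  exists (x, y). split; auto. intros n Hn. apply Rnot_lt_le. intros Hlt.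
  destruct (L (Cmod ((x, y) - u n) - B / INR (S n))%R) as [N HN]; [lra|].
  specialize (HN (Nat.max N n) ltac:(lia)).
  specialize (H n (Nat.max N n) Hn ltac:(lia)).
  set (w := u (Nat.max N n)) in *. rewrite Cmod_sub_sym in HN.
  generalize (Cmod_triangle ((x, y) - w) (w - u n)).
  replace ((x, y) - w + (w - u n)) with ((x, y) - u n) by ring. lra.
Qed.

(** For [x >= 1] one has [1 / x^2 <= 2 * (1 / x - 1 / (x + 1))]. The increments are assumed small
    only below [m], so that the lemma can be used inside the strong induction of [rgamma_approx]. *)
Lemma telescoping_bound (u : nat -> C) (B : R) (N0 n m : nat) : 0 <= B ->
  (forall k, (N0 <= k)%nat -> (k < m)%nat -> Cmod (u (S k) - u k) <= B / INR (S k) ^ 2) ->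
  (N0 <= n)%nat -> (n <= m)%nat ->
  Cmod (u m - u n) <= 2 * B * (/ INR (S n) - / INR (S m)).
Proof.
  intros HB H Hn Hm. induction Hm as [|m Hm IH].
  - replace (u n - u n) with (RtoC 0) by ring. rewrite Cmod_0. lra.
  - replace (u (S m) - u n) with ((u (S m) - u m) + (u m - u n)) by ring.
    eapply Rle_trans; [apply Cmod_triangle|].
    specialize (H m ltac:(lia) ltac:(lia)) as Hs.
    assert (IH' : Cmod (u m - u n) <= 2 * B * (/ INR (S n) - / INR (S m))).
    { apply IH. intros k Hk Hk'. apply H; lia. }
    assert (P := INR_S_pos m). assert (P' : INR (S (S m)) = (INR (S m) + 1)%R) by apply S_INR.
    assert (Q : B / INR (S m) ^ 2 <= 2 * B * (/ INR (S m) - / INR (S (S m)))).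
    { rewrite P'. set (x := INR (S m)) in *.
      assert (X1 : 1 <= x). { unfold x. rewrite S_INR. generalize (pos_INR m). lra. }
      replace (2 * B * (/ x - / (x + 1)))%R with (B * (2 / (x * (x + 1))))%R by (field; lra).
      unfold Rdiv at 1. apply Rmult_le_compat_l; auto.
      apply Rmult_le_reg_r with (x ^ 2 * (x + 1))%R.
      { apply Rmult_lt_0_compat; [apply pow_lt|]; lra. }
      replace (/ x ^ 2 * (x ^ 2 * (x + 1)))%R with (x + 1)%R by (field; lra).
      replace (2 / (x * (x + 1)) * (x ^ 2 * (x + 1)))%R with (2 * x)%R by (field; lra). lra. }
    lra.
Qed.

Lemma cauchy_of_quadratic (u : nat -> C) (B : R) (N0 n m : nat) : 0 <= B ->
  (forall k, (N0 <= k)%nat -> Cmod (u (S k) - u k) <= B / INR (S k) ^ 2) ->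
  (N0 <= n)%nat -> (n <= m)%nat -> Cmod (u m - u n) <= 2 * B / INR (S n).
Proof.
  intros HB H Hn Hm.
  eapply Rle_trans; [apply (telescoping_bound u B N0); auto|].
  assert (0 < / INR (S m)) by apply Rinv_0_lt_compat, INR_S_pos.
  unfold Rdiv. apply Rmult_le_compat_l; lra.
Qed.

(** * Continuation of zeta *)

Definition dirichlet_sum (s : C) (N : nat) : C := csum (fun m => Rcpow (INR (S m)) (- s)) N.

(** What is left of [(n + 1/2)^(1-s) - (n - 1/2)^(1-s)], with [n = m + 1], after expanding
    [(1 + v)^(1-s)] and [(1 - v)^(1-s)] at [v = 1 / (2 n)]. The order [2 * k + 3] keeps the odd
    powers up to [2 k + 1], that is the shifts [s, s + 2, ..., s + 2 k], and leaves a remainder of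
    size [n^(- Re s - 2 k - 2)], summable when [Re s >= - 2 k]. *)
Definition step_remainder (k m : nat) (s : C) : C :=
  Rcpow (INR (S m)) (1 - s) *
  (binomial_remainder (2 * k + 3) (1 - s) (/ (2 * INR (S m))) - binomial_remainder (2 * k + 3) (1 - s) (- / (2 * INR (S m)))).

Definition odd_coef (i : nat) (s : C) : C :=
  2 * (falling (1 - s) (2 * i + 1) / RtoC (INR (fact (2 * i + 1)))) / 2 ^ (2 * i + 1).

(** [odd_coef] divided by [s + 2 i - 1]. The divisor is handed over to the Dirichlet series at
    [s + 2 i], turning it into a value of the entire function [(s - 1) zeta(s)]; in this way the
    recursion involves entire functions only. *)
Definition odd_coef_quot (i : nat) (s : C) : C :=
  - (2 * (falling (1 - s) (2 * i) / RtoC (INR (fact (2 * i + 1)))) / 2 ^ (2 * i + 1)).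

Lemma C2_pow_neq_0 (n : nat) : (2 : C) ^ n <> 0.
Proof. apply Cpow_nz. intros E. apply RtoC_inj in E. lra. Qed.

Lemma odd_coef_factor (i : nat) (s : C) : odd_coef i s = odd_coef_quot i s * (s + RtoC (INR (2 * i)) - 1).
Proof.
  unfold odd_coef, odd_coef_quot. replace (2 * i + 1)%nat with (S (2 * i)) by lia. rewrite falling_S.
  field. split; [apply INR_fact_C|apply C2_pow_neq_0].
Qed.

Lemma csum_odd_part (c : nat -> C) (v : C) (K : nat) :
  csum (fun j => c j * v ^ j) (2 * K + 1) - csum (fun j => c j * (- v) ^ j) (2 * K + 1) =
  csum (fun i => 2 * c (2 * i + 1)%nat * v ^ (2 * i + 1)) K.
Proof.
  induction K as [|K IH]; [simpl; ring|].
  replace (2 * S K + 1)%nat with (S (S (2 * K + 1))) by lia.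
  assert (CS : forall (f : nat -> C) n, csum f (S n) = csum f n + f n) by reflexivity.
  rewrite !CS, <- IH.
  assert (E : (- v) ^ (2 * K + 1) = - v ^ (2 * K + 1)).
  { rewrite !Cpow_add_r, !Cpow_mult_r. replace ((- v) ^ 2) with (v ^ 2) by (simpl; ring).
    simpl. ring. }
  assert (E' : (- v) ^ S (2 * K + 1) = v ^ S (2 * K + 1)).
  { change ((- v) * (- v) ^ (2 * K + 1) = v * v ^ (2 * K + 1)). rewrite E. ring. }
  rewrite E, E'. ring.
Qed.

(** With [n +- 1/2 = n (1 +- v)] the even powers of [v] cancel, and [n^(1-s) v^(2i+1)] equals
    [n^(-(s+2i)) / 2^(2i+1)], a term of the Dirichlet series at [s + 2 i]. *)
Lemma half_integer_step (k m : nat) (s : C) :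
  Rcpow (INR (S m) + / 2) (1 - s) - Rcpow (INR (S m) - / 2) (1 - s) =
  csum (fun i => odd_coef i s * Rcpow (INR (S m)) (- (s + RtoC (INR (2 * i))))) (S k) + step_remainder k m s.
Proof.
  set (n := INR (S m)). assert (Hn : 1 <= n).
  { unfold n. rewrite S_INR. generalize (pos_INR m). lra. }
  set (p := 1 - s). set (v := (/ (2 * n))%R).
  assert (Hv : 0 < v <= / 2).
  { unfold v. split; [apply Rinv_0_lt_compat; lra|apply Rinv_le_contravar; lra]. }
  assert (Env : (n * v = / 2)%R) by (unfold v; field; lra).
  replace (n + / 2)%R with (n * (1 + v))%R by (rewrite <- Env; ring).
  replace (n - / 2)%R with (n * (1 + - v))%R by (rewrite <- Env; ring).
  rewrite !Rcpow_mult by lra.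
  unfold step_remainder. fold n p v.
  set (c := fun j => falling p j / RtoC (INR (fact j))).
  assert (E1 : forall t, Rcpow (1 + t) p = csum (fun j => c j * RtoC t ^ j) (2 * k + 3) + binomial_remainder (2 * k + 3) p t).
  { intros t. unfold binomial_remainder, c. ring. }
  rewrite (E1 v), (E1 (- v)%R).
  assert (E2 := csum_odd_part c (RtoC v) (S k)).
  replace (2 * S k + 1)%nat with (2 * k + 3)%nat in E2 by lia.
  rewrite RtoC_opp.
  assert (E3 : csum (fun i => odd_coef i s * Rcpow n (- (s + RtoC (INR (2 * i))))) (S k) =
    Rcpow n p * csum (fun i => 2 * c (2 * i + 1)%nat * RtoC v ^ (2 * i + 1)) (S k)).
  { rewrite <- csum_scal. apply csum_ext. intros i _. unfold odd_coef. fold p. fold (c (2 * i + 1)%nat).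
    replace (Rcpow n p) with (Rcpow n (- (s + RtoC (INR (2 * i)))) * RtoC n ^ (2 * i + 1)).
    - assert (Nn : RtoC n <> 0) by (intros E; apply RtoC_inj in E; lra).
      assert (Np : RtoC n ^ (2 * i + 1) <> 0) by (apply Cpow_nz; auto).
      assert (N2 := C2_pow_neq_0 (2 * i + 1)).
      unfold v. rewrite RtoC_inv, RtoC_mult by lra.
      rewrite Cpow_inv by (apply Cmult_neq_0; [intros E; apply RtoC_inj in E; lra|auto]).
      rewrite Cpow_mult_l. field. auto.
    - rewrite <- Rcpow_nat, <- Rcpow_plus by lra. f_equal. unfold p.
      rewrite plus_INR, RtoC_plus. simpl (INR 1). ring. }
  rewrite E3, <- E2. ring.
Qed.

Lemma Cmod_step_remainder_bound (k m : nat) (s : C) (R : R) : Cmod s <= R -> (- INR (2 * k) <= Re s)%R ->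
  Cmod (step_remainder k m s) <= 2 * (exp (1 + R + INR (2 * k + 3)) * (1 + R + INR (2 * k + 3)) ^ (2 * k + 3)) / INR (S m) ^ 2.
Proof.
  intros HR Hs. set (n := INR (S m)). assert (Hn : 1 <= n).
  { unfold n. rewrite S_INR. generalize (pos_INR m). lra. }
  set (p := 1 - s). set (v := (/ (2 * n))%R). set (K := (2 * k + 3)%nat).
  assert (Hv : 0 < v <= / 2).
  { unfold v. split; [apply Rinv_0_lt_compat; lra|apply Rinv_le_contravar; lra]. }
  assert (Hp : Cmod p <= 1 + R).
  { eapply Rle_trans; [apply Cmod_triangle|]. rewrite Cmod_opp, Cmod_1. lra. }
  set (A := (exp (1 + R + INR K) * (1 + R + INR K) ^ K)%R).
  assert (HK : 0 <= INR K) by apply pos_INR.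
  assert (HR0 : 0 <= R) by (eapply Rle_trans; [apply Cmod_ge_0|apply HR]).
  assert (Hb : forall t, Rabs t = v -> Cmod (binomial_remainder K p t) <= A * v ^ K).
  { intros t Ht. rewrite <- Ht. eapply Rle_trans; [apply binomial_remainder_bound; lra|].
    apply Rmult_le_compat_r; [apply pow_le, Rabs_pos|]. unfold A.
    apply Rmult_le_compat; [left; apply exp_pos|apply Cmod_ge_0|apply exp_le; lra|].
    apply Cmod_falling_bound; auto. }
  assert (HA : 0 < A).
  { unfold A. apply Rmult_lt_0_compat; [apply exp_pos|apply pow_lt; lra]. }
  unfold step_remainder. fold n p v K. rewrite Cmod_mult, Cmod_Rcpow.
  assert (D : Cmod (binomial_remainder K p v - binomial_remainder K p (- v)) <= 2 * A * v ^ K).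
  { eapply Rle_trans; [apply Cmod_triangle|]. rewrite Cmod_opp.
    assert (H1 := Hb v ltac:(apply Rabs_right; lra)).
    assert (H2 := Hb (- v)%R ltac:(rewrite Rabs_Ropp; apply Rabs_right; lra)). lra. }
  assert (Hvn : v ^ K <= exp (- (INR K * ln n))).
  { rewrite exp_Ropp. replace (exp (INR K * ln n)) with (n ^ K)%R.
    - unfold v. rewrite pow_inv. apply Rinv_le_contravar; [apply pow_lt; lra|].
      apply pow_incr; lra.
    - rewrite <- Rpower_pow by lra. reflexivity. }
  assert (Hln : 0 <= ln n). { rewrite <- ln_1. destruct Hn as [Hn|<-]; [left; apply ln_increasing; lra|lra]. }
  assert (Hfin : exp (Re p * ln n) * exp (- (INR K * ln n)) <= / n ^ 2).
  { rewrite <- exp_plus. replace (/ n ^ 2)%R with (exp (- (2 * ln n))).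
    - apply exp_le. replace (Re p * ln n + - (INR K * ln n))%R with ((Re p - INR K) * ln n)%R by ring.
      rewrite <- Ropp_mult_distr_l_reverse. apply Rmult_le_compat_r; auto.
      replace (Re p) with (1 - Re s)%R by reflexivity. unfold K. rewrite plus_INR.
      simpl (INR 3). lra.
    - rewrite exp_Ropp. f_equal. rewrite <- Rpower_pow by lra. unfold Rpower. f_equal. }
  unfold Rdiv. apply Rle_trans with (exp (Re p * ln n) * (2 * A * exp (- (INR K * ln n))))%R.
  - apply Rmult_le_compat_l; [left; apply exp_pos|]. eapply Rle_trans; [apply D|].
    apply Rmult_le_compat_l; lra.
  - replace (exp (Re p * ln n) * (2 * A * exp (- (INR K * ln n))))%R with
      (2 * A * (exp (Re p * ln n) * exp (- (INR K * ln n))))%R by ring.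
    apply Rmult_le_compat_l; lra.
Qed.

Definition step_remainder_sum (k : nat) (s : C) : C :=
  epsilon (inhabits (0 : C)) (clim (csum (fun m => step_remainder k m s))).

(** Here [step_remainder_sum], chosen by [epsilon], is shown to be a genuine limit. [B] depends on
    [s] only through the radius [R], so that convergence is uniform on bounded sets. *)
Lemma step_remainder_sum_spec (k : nat) (R : R) : 0 <= R -> exists B, 0 <= B /\
  forall s, Cmod s <= R -> (- INR (2 * k) <= Re s)%R ->
    clim (csum (fun m => step_remainder k m s)) (step_remainder_sum k s) /\
    forall n, Cmod (step_remainder_sum k s - csum (fun m => step_remainder k m s) n) <= B / INR (S n).
Proof.
  intros HR0.
  set (B0 := (2 * (exp (1 + R + INR (2 * k + 3)) * (1 + R + INR (2 * k + 3)) ^ (2 * k + 3)))%R).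
  assert (HK := pos_INR (2 * k + 3)).
  assert (HB0 : 0 <= B0).
  { unfold B0. apply Rmult_le_pos; [lra|]. apply Rmult_le_pos; [left; apply exp_pos|].
    apply pow_le; lra. }
  exists (2 * B0)%R. split; [lra|]. intros s Hs Hre.
  destruct (clim_of_cauchy (csum (fun m => step_remainder k m s)) (2 * B0) 0) as [l [Hl Hl']]; [lra| |].
  { intros n m _ Hnm. apply (cauchy_of_quadratic _ B0 0); auto; try lia.
    intros j _. cbn [csum].
    replace (csum (fun m0 => step_remainder k m0 s) j + step_remainder k j s - csum (fun m0 => step_remainder k m0 s) j)
      with (step_remainder k j s) by ring. apply Cmod_step_remainder_bound; auto. }
  assert (L : clim (csum (fun m => step_remainder k m s)) (step_remainder_sum k s)).
  { unfold step_remainder_sum. apply epsilon_spec. exists l. auto. }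
  split; auto. intros n. rewrite (clim_unique _ _ _ L Hl). apply Hl'. lia.
Qed.

Lemma cdiff_binomial_remainder (K : nat) (v : R) (s : C) : cdiff (fun s => binomial_remainder K (1 - s) v) s.
Proof.
  unfold binomial_remainder. apply cdiff_minus.
  - auto with cd.
  - apply (cdiff_csum (fun j s => falling (1 - s) j / RtoC (INR (fact j)) * RtoC v ^ j)).
    intros i _. apply cdiff_mult; [|apply cdiff_const].
    apply cdiff_div; [apply INR_fact_C| |]; auto with cd.
Qed.

Lemma cdiff_step_remainder (k m : nat) (s : C) : cdiff (step_remainder k m) s.
Proof.
  unfold step_remainder. apply cdiff_mult; [auto with cd|]. apply cdiff_minus; apply cdiff_binomial_remainder.
Qed.

Lemma cdiff_step_remainder_sum (k : nat) (s : C) : (- INR (2 * k) < Re s)%R -> cdiff (step_remainder_sum k) s.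
Proof.
  intros Hs. set (r := (Re s + INR (2 * k))%R). assert (Hr : 0 < r) by (unfold r; lra).
  assert (HR : 0 <= Cmod s + r) by (generalize (Cmod_ge_0 s); lra).
  destruct (step_remainder_sum_spec k (Cmod s + r) HR) as [B [HB H]].
  apply weierstrass with r; auto. intros e He.
  destruct (archimed_inv B e HB He) as [N HN].
  exists (fun z => csum (fun m => step_remainder k m z) N). intros w Hw. split.
  - apply (cdiff_csum (fun m z => step_remainder k m z)). intros i _. apply cdiff_step_remainder.
  - rewrite Cmod_sub_sym. left. eapply Rle_lt_trans; [apply H|apply (HN N); auto].
    + replace w with (s + (w - s)) by ring. eapply Rle_trans; [apply Cmod_triangle|]. lra.
    + generalize (re_le_Cmod (w - s)) (Rle_abs (- (Re (w - s)))). rewrite Rabs_Ropp, Re_minus.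
      unfold r in Hw. lra.
Qed.

Lemma clim_half_power (s : C) : 1 < Re s ->
  clim (fun N => Rcpow (INR N + / 2) (1 - s)) 0.
Proof.
  intros Hs e He. set (T := (Rabs (ln e) / (Re s - 1) + 1)%R).
  destruct (INR_archimed 1 (exp T) Rlt_0_1) as [N HN]. rewrite Rmult_1_r in HN.
  exists N. intros n Hn. apply le_INR in Hn.
  replace (Rcpow (INR n + / 2) (1 - s) - 0) with (Rcpow (INR n + / 2) (1 - s)) by ring.
  rewrite Cmod_Rcpow. change (Re (1 - s)) with (1 - Re s)%R.
  assert (HT : T < ln (INR n + / 2)).
  { rewrite <- (ln_exp T). apply ln_increasing; [apply exp_pos|lra]. }
  assert (HT2 : ((Re s - 1) * T < (Re s - 1) * ln (INR n + / 2))%R).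
  { apply Rmult_lt_compat_l; lra. }
  assert (ET : ((Re s - 1) * T = Rabs (ln e) + (Re s - 1))%R) by (unfold T; field; lra).
  rewrite <- (exp_ln e) by auto. apply exp_increasing.
  generalize (Rle_abs (- ln e)). rewrite Rabs_Ropp. lra.
Qed.

(** The limit of [dirichlet_identity] for [N] to infinity. The term of index 0, which is
    [(1 - s) zeta(s)], has moved to the other side, so [E] is called only at
    [s + 2, ..., s + 2 k]. *)
Definition zeta_rec (k : nat) (E : C -> C) (s : C) : C :=
  Rcpow (/ 2) (1 - s) +
  csum (fun i => odd_coef_quot (S i) s * E (s + RtoC (INR (2 * S i)))) k + step_remainder_sum k s.

(** Exact for every [N] and [s]: the half-integer differences for [n = 1, ..., N] telescope, and the
    double sum on the other side is exchanged. Convergence enters only afterwards. *)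
Lemma dirichlet_identity (k N : nat) (s : C) :
  (s - 1) * dirichlet_sum s N =
  Rcpow (/ 2) (1 - s) - Rcpow (INR N + / 2) (1 - s) +
  csum (fun i => odd_coef (S i) s * dirichlet_sum (s + RtoC (INR (2 * S i))) N) k +
  csum (fun m => step_remainder k m s) N.
Proof.
  assert (T : Rcpow (INR N + / 2) (1 - s) - Rcpow (/ 2) (1 - s) =
     csum (fun i => odd_coef i s * dirichlet_sum (s + RtoC (INR (2 * i))) N) (S k) +
     csum (fun m => step_remainder k m s) N).
  { unfold dirichlet_sum.
    rewrite (csum_ext _ (fun i => csum (fun m => odd_coef i s * Rcpow (INR (S m)) (- (s + RtoC (INR (2 * i))))) N) (S k))
      by (intros; rewrite csum_scal; auto).
    rewrite csum_exchange, <- csum_plus.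
    rewrite (csum_ext _ (fun m => Rcpow (INR (S m) + / 2) (1 - s) - Rcpow (INR (S m) - / 2) (1 - s)) N)
      by (intros; rewrite (half_integer_step k); auto).
    induction N as [|N IH].
    - simpl csum. simpl INR. rewrite Rplus_0_l. ring.
    - cbn [csum]. rewrite <- IH.
      replace (INR (S N) - / 2)%R with (INR N + / 2)%R by (rewrite S_INR; field). ring. }
  rewrite csum_shift in T.
  assert (E0 : odd_coef 0 s * dirichlet_sum (s + RtoC (INR (2 * 0))) N = (1 - s) * dirichlet_sum s N).
  { f_equal.
    - unfold odd_coef. simpl. field.
    - simpl. rewrite Cplus_0_r. auto. }
  rewrite E0 in T.
  replace (Rcpow (INR N + / 2) (1 - s)) with
    ((Rcpow (INR N + / 2) (1 - s) - Rcpow (/ 2) (1 - s)) + Rcpow (/ 2) (1 - s)) by ring.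
  rewrite T. ring.
Qed.

Definition dirichlet_lim (E : C -> C) (s : C) : Prop :=
  clim (fun N => (s - 1) * dirichlet_sum s N) (E s).

Lemma zeta_rec_lim (k : nat) (E : C -> C) (s : C) : 1 < Re s ->
  (forall i, (i < k)%nat -> dirichlet_lim E (s + RtoC (INR (2 * S i)))) ->
  dirichlet_lim (zeta_rec k E) s.
Proof.
  intros Hs HE. unfold dirichlet_lim.
  apply clim_ext with (u := fun N => (Rcpow (/ 2) (1 - s) + - Rcpow (INR N + / 2) (1 - s)) +
    csum (fun i => odd_coef_quot (S i) s * ((s + RtoC (INR (2 * S i)) - 1) * dirichlet_sum (s + RtoC (INR (2 * S i))) N)) k +
    csum (fun m => step_remainder k m s) N) (N0 := O).
  { intros N _. rewrite (dirichlet_identity k). unfold Cminus at 2. f_equal. f_equal.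
    apply csum_ext. intros i _. rewrite odd_coef_factor. ring. }
  unfold zeta_rec. apply clim_plus; [apply clim_plus|].
  - assert (A := clim_plus _ _ _ _ (clim_const (Rcpow (/ 2) (1 - s)))
      (clim_opp _ _ (clim_half_power s Hs))).
    replace (Rcpow (/ 2) (1 - s) + - 0) with (Rcpow (/ 2) (1 - s)) in A by ring. exact A.
  - apply (clim_csum (fun i N => odd_coef_quot (S i) s * ((s + RtoC (INR (2 * S i)) - 1) * dirichlet_sum (s + RtoC (INR (2 * S i))) N))
      (fun i => odd_coef_quot (S i) s * E (s + RtoC (INR (2 * S i))))).
    intros i Hi. apply clim_scal. apply HE; auto.
  - destruct (step_remainder_sum_spec k (Cmod s) (Cmod_ge_0 s)) as [B [_ H]]. apply H; [lra|].
    generalize (pos_INR (2 * k)). lra.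
Qed.

Lemma cdiff_odd_coef_quot (i : nat) (s : C) : cdiff (odd_coef_quot i) s.
Proof.
  unfold odd_coef_quot. apply cdiff_opp, cdiff_div; [apply C2_pow_neq_0| |apply cdiff_const].
  apply cdiff_mult; [apply cdiff_const|]. apply cdiff_div; [apply INR_fact_C| |]; auto with cd.
Qed.

Lemma cdiff_zeta_rec (k : nat) (E : C -> C) (s : C) : (- INR (2 * k) < Re s)%R ->
  (forall i, (i < k)%nat -> cdiff E (s + RtoC (INR (2 * S i)))) -> cdiff (zeta_rec k E) s.
Proof.
  intros Hs HE. unfold zeta_rec. apply cdiff_plus; [apply cdiff_plus|].
  - auto with cd.
  - apply (cdiff_csum (fun i s => odd_coef_quot (S i) s * E (s + RtoC (INR (2 * S i))))).
    intros i Hi. apply cdiff_mult; [apply cdiff_odd_coef_quot|].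
    apply (cdiff_comp E (fun s => s + RtoC (INR (2 * S i)))); auto with cd.
  - apply cdiff_step_remainder_sum; auto.
Qed.

Lemma Re_plus_R (s : C) (x : R) : Re (s + RtoC x) = (Re s + x)%R.
Proof. reflexivity. Qed.

Lemma zeta_strip (k : nat) : exists E,
  (forall s, (- INR (2 * k) < Re s)%R -> cdiff E s) /\
  (forall s, 1 < Re s -> dirichlet_lim E s).
Proof.
  induction k as [|k [E [HE1 HE2]]].
  - exists (zeta_rec 0 (fun _ => 0)). split.
    + intros s Hs. apply cdiff_zeta_rec; auto. intros; lia.
    + intros s Hs. apply zeta_rec_lim; auto. intros; lia.
  - exists (zeta_rec (S k) E). split.
    + intros s Hs. apply cdiff_zeta_rec; auto. intros i _. apply HE1. rewrite Re_plus_R.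
      replace (2 * S k)%nat with (2 * k + 2)%nat in Hs by lia.
      replace (2 * S i)%nat with (2 * i + 2)%nat by lia. rewrite plus_INR in Hs |- *.
      generalize (pos_INR (2 * i)). lra.
    + intros s Hs. apply zeta_rec_lim; auto. intros i _. apply HE2. rewrite Re_plus_R.
      generalize (pos_INR (2 * S i)). lra.
Qed.

Lemma dirichlet_lim_unique (E F : C -> C) (s : C) :
  dirichlet_lim E s -> dirichlet_lim F s -> E s = F s.
Proof. apply clim_unique. Qed.

(** All strip continuations have the same Dirichlet limit for [Re s > 1], so they agree wherever two
    of them are holomorphic. The strip index [kf s] may then be frozen in a neighbourhood of [s],
    and differentiability carries over. *)
Lemma zeta_entire : exists E,
  (forall s, cdiff E s) /\ (forall s, 1 < Re s -> dirichlet_lim E s).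
Proof.
  destruct (choice (fun k E => (forall s, (- INR (2 * k) < Re s)%R -> cdiff E s) /\
     (forall s, 1 < Re s -> dirichlet_lim E s)) zeta_strip) as [F HF].
  assert (HN : forall s : C, exists k, (- INR (2 * k) < Re s)%R).
  { intros s. destruct (INR_archimed 1 (Rabs (Re s) + 1) Rlt_0_1) as [k Hk]. exists k.
    rewrite mult_INR. simpl (INR 2). generalize (pos_INR k) (Rle_abs (- Re s)).
    rewrite Rabs_Ropp. lra. }
  destruct (choice _ HN) as [kf Hkf].
  assert (Agree : forall k l s, (- INR (2 * k) < Re s)%R -> (- INR (2 * l) < Re s)%R -> F k s = F l s).
  { intros k l s Hk Hl.
    enough (E : F k s - F l s = 0).
    { replace (F k s) with (F k s - F l s + F l s) by ring. rewrite E. ring. }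
    apply (identity_half_plane (fun s => F k s - F l s) (Rmax (- INR (2 * k)) (- INR (2 * l))) 1).
    - intros w Hw. apply cdiff_minus.
      + apply HF. eapply Rle_lt_trans; [apply Rmax_l|apply Hw].
      + apply HF. eapply Rle_lt_trans; [apply Rmax_r|apply Hw].
    - intros w Hw. rewrite (dirichlet_lim_unique (F k) (F l) w); [ring| |]; apply HF; auto.
    - apply Rmax_lub_lt; auto. }
  exists (fun s => F (kf s) s). split.
  - intros s. set (r := (Re s + INR (2 * kf s))%R).
    assert (Hr : 0 < r) by (unfold r; generalize (Hkf s); lra).
    apply cdiff_ext_loc with (f := F (kf s)) (r := r); auto.
    + intros w Hw. apply Agree; auto.
      generalize (re_le_Cmod (w - s)) (Rle_abs (- (Re (w - s)))). rewrite Rabs_Ropp, Re_minus.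
      unfold r in Hw. lra.
    + apply HF, Hkf.
  - intros s Hs. apply (proj2 (HF (kf s)) s Hs).
Qed.

(** The recursion extends to the left by the identity theorem, so that [E] can be evaluated at
    negative even points. *)
Lemma zeta_entire_rec (E : C -> C) : (forall s, cdiff E s) ->
  (forall s, 1 < Re s -> dirichlet_lim E s) ->
  forall k s, (- INR (2 * k) < Re s)%R -> E s = zeta_rec k E s.
Proof.
  intros HE1 HE2 k s Hs.
  enough (H : E s - zeta_rec k E s = 0).
  { replace (E s) with (E s - zeta_rec k E s + zeta_rec k E s) by ring. rewrite H. ring. }
  apply (identity_half_plane (fun s => E s - zeta_rec k E s) (- INR (2 * k)) 1); auto.
  - intros w Hw. apply cdiff_minus; auto. apply cdiff_zeta_rec; auto.
  - intros w Hw. rewrite (dirichlet_lim_unique E (zeta_rec k E) w); [ring|auto|].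
    apply zeta_rec_lim; auto. intros i _. apply HE2. rewrite Re_plus_R.
    generalize (pos_INR (2 * S i)). lra.
Qed.

Lemma csum_zero (f : nat -> C) (n : nat) : (forall i, (i < n)%nat -> f i = 0) -> csum f n = 0.
Proof.
  intros H. induction n as [|n IH]; [reflexivity|]. cbn [csum].
  rewrite IH, H by auto. ring.
Qed.

(** At [s = - 2 m] the exponent [1 - s] is the natural number [2 m + 1], so the binomial expansion
    stops before order [2 k + 3] and every remainder is zero. *)
Lemma step_remainder_sum_even (k m : nat) : (m < k)%nat -> step_remainder_sum k (- RtoC (INR (2 * m))) = 0.
Proof.
  intros Hm. set (s := - RtoC (INR (2 * m))).
  assert (Hre : (- INR (2 * k) <= Re s)%R).
  { change (Re s) with (- INR (2 * m))%R. apply Ropp_le_contravar, le_INR. lia. }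
  destruct (step_remainder_sum_spec k (Cmod s) (Cmod_ge_0 s)) as [B [_ H]].
  destruct (H s (Rle_refl _) Hre) as [L _].
  apply (clim_unique _ _ _ L).
  apply clim_ext with (u := fun _ => 0) (N0 := O); [|apply clim_const].
  intros n _. symmetry. apply csum_zero. intros i _. unfold step_remainder.
  assert (Hp : 1 - s = RtoC (INR (2 * m + 1))).
  { unfold s. rewrite plus_INR, RtoC_plus. simpl (INR 1). ring. }
  assert (Hb : forall t, Rabs t <= / 2 -> binomial_remainder (2 * k + 3) (1 - s) t = 0).
  { intros t Ht. apply Cmod_eq_0. apply Rle_antisym; [|apply Cmod_ge_0].
    eapply Rle_trans; [apply binomial_remainder_bound; auto|].
    rewrite Hp, falling_zero by lia. rewrite Cmod_0. lra. }
  assert (Hv : 0 < / (2 * INR (S i)) <= / 2).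
  { rewrite S_INR. generalize (pos_INR i). intros.
    split; [apply Rinv_0_lt_compat; lra|apply Rinv_le_contravar; lra]. }
  rewrite !Hb; [ring| |].
  - rewrite Rabs_Ropp, Rabs_right; lra.
  - rewrite Rabs_right; lra.
Qed.

Lemma Rcpow_half_odd (m : nat) : Rcpow (/ 2) (1 - - RtoC (INR (2 * m))) = / 2 ^ (2 * m + 1).
Proof.
  replace (1 - - RtoC (INR (2 * m))) with (RtoC (INR (2 * m + 1)))
    by (rewrite plus_INR, RtoC_plus; simpl (INR 1); ring).
  rewrite Rcpow_nat by lra. rewrite RtoC_inv by lra. apply Cpow_inv.
  intros E; apply RtoC_inj in E; lra.
Qed.

(** This is [zeta(0) = - 1/2]. In the recursion with [k = 1] the coefficient of [E 2] contains
    [falling 1 2 = 0], which leaves only [(1/2)^1]. *)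
Lemma zeta_entire_at_0 (E : C -> C) : (forall s, cdiff E s) ->
  (forall s, 1 < Re s -> dirichlet_lim E s) -> E 0 = / 2.
Proof.
  intros HE1 HE2. assert (H := zeta_entire_rec E HE1 HE2 1 (- RtoC (INR (2 * 0)))).
  replace (RtoC 0) with (- RtoC (INR (2 * 0))) by (simpl; ring).
  rewrite H by (simpl; lra). unfold zeta_rec. rewrite step_remainder_sum_even by lia. rewrite Rcpow_half_odd.
  cbn [csum]. unfold odd_coef_quot.
  replace (1 - - RtoC (INR (2 * 0))) with (RtoC (INR 1)) by (simpl; ring).
  rewrite (falling_zero 1 (2 * 1)) by lia. simpl. field. intros E1. apply RtoC_inj in E1. lra.
Qed.

(** The symmetric differences [(n + 1/2)^(1-s) - (n - 1/2)^(1-s)] involve only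
    the shifts [s + 2 i], so the even points form a closed recursion. *)
Lemma zeta_trivial_zeros (E : C -> C) : (forall s, cdiff E s) ->
  (forall s, 1 < Re s -> dirichlet_lim E s) ->
  forall m, (0 < m)%nat -> E (- RtoC (INR (2 * m))) = 0.
Proof.
  intros HE1 HE2 m. induction m as [m IH] using (well_founded_induction lt_wf). intros Hm.
  set (s := - RtoC (INR (2 * m))).
  rewrite (zeta_entire_rec E HE1 HE2 (S m) s).
  2:{ change (Re s) with (- INR (2 * m))%R. apply Ropp_lt_contravar, lt_INR. lia. }
  assert (R1 : step_remainder_sum (S m) s = 0) by (apply step_remainder_sum_even; lia).
  assert (R2 : Rcpow (/ 2) (1 - s) = / 2 ^ (2 * m + 1)) by apply Rcpow_half_odd.
  unfold zeta_rec. rewrite R1, R2.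
  destruct m as [|m]; [lia|].
  assert (Hp : 1 - s = RtoC (INR (2 * S m + 1))).
  { unfold s. rewrite plus_INR, RtoC_plus. simpl (INR 1). ring. }
  (* The terms [i < m] vanish by induction, and the last one, [i = S m], by [falling_zero]. The term
     [i = m] reaches the point 0 with coefficient [- 2 / 2^(2m+3)]; multiplied by [E 0 = 1/2] it
     cancels the power of one half. *)
  cbn [csum]. rewrite csum_zero.
  2:{ intros i Hi. replace (s + RtoC (INR (2 * S i))) with (- RtoC (INR (2 * (m - i)))).
      - rewrite IH by lia. ring.
      - unfold s. replace (2 * S m)%nat with (2 * S i + 2 * (m - i))%nat by lia.
        rewrite plus_INR, RtoC_plus. ring. }
  replace (s + RtoC (INR (2 * S m))) with (RtoC 0) by (unfold s; ring).
  rewrite (zeta_entire_at_0 E HE1 HE2). unfold odd_coef_quot. rewrite Hp.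
  rewrite (falling_zero (2 * S m + 1) (2 * S (S m))) by lia.
  assert (Hf : falling (RtoC (INR (2 * S m + 1))) (2 * S m) = RtoC (INR (fact (2 * S m + 1)))).
  { rewrite <- falling_fact. replace (2 * S m + 1)%nat with (S (2 * S m)) at 3 by lia.
    rewrite falling_S. rewrite plus_INR, RtoC_plus. simpl (INR 1). ring. }
  rewrite Hf.
  assert (N1 := INR_fact_C (2 * S m + 1)). assert (N2 := C2_pow_neq_0 (2 * S m + 1)).
  assert (N3 := INR_fact_C (2 * S (S m) + 1)). assert (N4 := C2_pow_neq_0 (2 * S (S m) + 1)).
  field. auto.
Qed.

(** * The reciprocal Gamma function *)

(** Reciprocal of the [n]-th term of Gauss's limit. *)
Definition gauss_inv (n : nat) (s : C) : C := rising s (S n) / (RtoC (INR (fact n)) * Rcpow (INR n) s).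

Definition rgamma (s : C) : C := epsilon (inhabits (0 : C)) (clim (fun n => gauss_inv n s)).

Lemma cdiff_rising (n : nat) (u : C -> C) (z : C) : cdiff u z -> cdiff (fun w => rising (u w) n) z.
Proof. intros H. induction n as [|n IH]; simpl; [apply cdiff_const|]. auto with cd. Qed.
#[export] Hint Resolve cdiff_rising : cd.

Lemma gauss_inv_den_neq_0 (n : nat) (s : C) : RtoC (INR (fact n)) * Rcpow (INR n) s <> 0.
Proof. apply Cmult_neq_0; [apply INR_fact_C|apply Rcpow_neq_0]. Qed.

Lemma cdiff_gauss_inv (n : nat) (z : C) : cdiff (gauss_inv n) z.
Proof.
  unfold gauss_inv. apply cdiff_div; [apply gauss_inv_den_neq_0|auto with cd|].
  apply cdiff_mult; [apply cdiff_const|auto with cd].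
Qed.

(** Bounds the coefficient of [x^2] in [(1 + s x) (1 - x)^s - 1] for [|s| <= B] and [0 < x <= 1/2]:
    the first summand comes from [(s x)^2], the second from the binomial remainder of order 2. *)
Definition gauss_inv_const (B : R) : R := (B * B + (1 + B) * (exp (B + 2) * (B + 2) ^ 2))%R.

Lemma gauss_inv_const_pos (R : R) : 0 <= R -> 0 <= gauss_inv_const R.
Proof.
  intros H. unfold gauss_inv_const. apply Rplus_le_le_0_compat; [apply Rmult_le_pos; auto|].
  apply Rmult_le_pos; [lra|]. apply Rmult_le_pos; [left; apply exp_pos|apply pow_le; lra].
Qed.

(** Consecutive terms have quotient [(1 + s x) (1 - x)^s] with [x = 1 / (n + 1)]. Its linear terms
    cancel, so the product converges like the sum of [1 / n^2]. *)
Lemma gauss_inv_step (n : nat) (s : C) (R : R) : (1 <= n)%nat -> Cmod s <= R ->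
  Cmod (gauss_inv (S n) s - gauss_inv n s) <= Cmod (gauss_inv n s) * gauss_inv_const R / INR (S n) ^ 2.
Proof.
  intros Hn HR. assert (P := Cmod_ge_0 s).
  set (x := (/ INR (S n))%R). assert (P1 := INR_S_pos n).
  assert (Hn2 : 2 <= INR (S n)). { apply le_INR in Hn. rewrite S_INR. simpl in Hn. lra. }
  assert (Pn : 0 < INR n) by (rewrite S_INR in Hn2; lra).
  assert (Hx : 0 < x <= / 2).
  { unfold x. split; [apply Rinv_0_lt_compat; auto|apply Rinv_le_contravar; lra]. }
  set (b := binomial_remainder 2 s (- x)).
  assert (Eb : Rcpow (1 + - x) s = 1 - s * RtoC x + b).
  { unfold b, binomial_remainder. simpl. rewrite RtoC_opp. field. }
  assert (Erat : gauss_inv (S n) s = gauss_inv n s * ((1 + s * RtoC x) * Rcpow (1 + - x) s)).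
  { assert (E : INR n = (INR (S n) * (1 + - x))%R) by (unfold x; rewrite S_INR in *; field; lra).
    assert (E2 : Rcpow (INR n) s = Rcpow (INR (S n)) s * Rcpow (1 + - x) s).
    { rewrite <- Rcpow_mult by lra. rewrite <- E. auto. }
    unfold gauss_inv. rewrite E2. change (rising s (S (S n))) with (rising s (S n) * (s + RtoC (INR (S n)))).
    change (fact (S n)) with (S n * fact n)%nat. rewrite mult_INR, RtoC_mult.
    unfold x. rewrite RtoC_inv by lra.
    assert (N1 := INR_fact_C n). assert (N2 := RtoC_INR_S_neq_0 n).
    assert (N3 := Rcpow_neq_0 (INR (S n)) s). assert (N4 := Rcpow_neq_0 (1 + - / INR (S n)) s).
    field. auto. }
  assert (Bb : Cmod b <= exp (R + 2) * (R + 2) ^ 2 * x ^ 2).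
  { unfold b. eapply Rle_trans; [apply binomial_remainder_bound|].
    - rewrite Rabs_Ropp, Rabs_right; lra.
    - rewrite Rabs_Ropp, (Rabs_right x) by lra. apply Rmult_le_compat_r; [apply pow_le; lra|].
      replace (INR 2) with 2%R by (simpl; ring).
      apply Rmult_le_compat; [left; apply exp_pos|apply Cmod_ge_0|apply exp_le; lra|].
      apply (Cmod_falling_bound 2 s R HR). }
  rewrite Erat, Eb.
  replace (gauss_inv n s * ((1 + s * RtoC x) * (1 - s * RtoC x + b)) - gauss_inv n s) with
    (gauss_inv n s * (- (s * s * (RtoC x * RtoC x)) + (1 + s * RtoC x) * b)) by ring.
  rewrite Cmod_mult. unfold Rdiv. rewrite Rmult_assoc. apply Rmult_le_compat_l; [apply Cmod_ge_0|].
  rewrite <- pow_inv. fold x.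
  eapply Rle_trans; [apply Cmod_triangle|]. rewrite Cmod_opp, !Cmod_mult, Cmod_R, (Rabs_right x) by lra.
  unfold gauss_inv_const. rewrite Rmult_plus_distr_r. apply Rplus_le_compat.
  - replace (x ^ 2)%R with (x * x)%R by ring. apply Rmult_le_compat_r; [apply Rmult_le_pos; lra|].
    apply Rmult_le_compat; auto.
  - rewrite Rmult_assoc. apply Rmult_le_compat; try apply Cmod_ge_0; auto.
    eapply Rle_trans; [apply Cmod_triangle|]. rewrite Cmod_1, Cmod_mult, Cmod_R, (Rabs_right x) by lra.
    apply Rplus_le_compat_l. rewrite <- (Rmult_1_r R). apply Rmult_le_compat; lra.
Qed.

(** The errors are relative to [U], the modulus of the [N]-th term. While the terms stay within
    [U / 2] of it they are at most [3 / 2 * U], so all later increments add up to at most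
    [3 * C0 * U / (N + 1)]; the choice [N + 1 >= 6 * C0] makes this at most [U / 2] and closes the
    induction. The rate gives uniform convergence, the factor one half gives nonvanishing. *)
Lemma rgamma_approx (R : R) : 0 <= R -> exists N, (1 <= N)%nat /\ forall s, Cmod s <= R ->
  clim (fun n => gauss_inv n s) (rgamma s) /\
  Cmod (rgamma s - gauss_inv N s) <= Cmod (gauss_inv N s) / 2 /\
  forall n, (N <= n)%nat -> Cmod (rgamma s - gauss_inv n s) <= 3 * gauss_inv_const R * Cmod (gauss_inv N s) / INR (S n).
Proof.
  intros HR. assert (HC := gauss_inv_const_pos R HR). set (C0 := gauss_inv_const R) in *.
  destruct (INR_archimed 1 (6 * C0) Rlt_0_1) as [N0 HN0].
  set (N := S N0). assert (HN : 6 * C0 <= INR (S N)).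
  { unfold N. rewrite !S_INR. lra. }
  assert (PN := INR_S_pos N).
  exists N. split; [unfold N; lia|]. intros s Hs.
  set (U := Cmod (gauss_inv N s)). assert (HU : 0 <= U) by apply Cmod_ge_0.
  assert (Hb : forall m, (N <= m)%nat -> Cmod (gauss_inv m s - gauss_inv N s) <= U / 2).
  { intros m. induction m as [m IH] using (well_founded_induction lt_wf). intros Hm.
    eapply Rle_trans; [apply (telescoping_bound (fun n => gauss_inv n s) (3 / 2 * U * C0) N N m)|]; auto.
    - apply Rmult_le_pos; [|auto]. lra.
    - intros k Hk Hkm. eapply Rle_trans; [apply (gauss_inv_step k s R); auto; unfold N in Hk; lia|].
      fold C0. unfold Rdiv. apply Rmult_le_compat_r; [left; apply Rinv_0_lt_compat, pow_lt, INR_S_pos|].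
      apply Rmult_le_compat_r; auto.
      specialize (IH k Hkm Hk). generalize (Cmod_ge_minus (gauss_inv k s) (gauss_inv N s)). fold U. lra.
    - assert (0 < / INR (S m)) by apply Rinv_0_lt_compat, INR_S_pos.
      assert (A : C0 * / INR (S N) <= / 6).
      { apply Rmult_le_reg_r with (INR (S N)); auto. rewrite Rmult_assoc, Rinv_l by lra. lra. }
      assert (PI : 0 < / INR (S N)) by (apply Rinv_0_lt_compat; auto).
      assert (U * C0 * / INR (S N) <= U * / 6).
      { rewrite Rmult_assoc. apply Rmult_le_compat_l; auto. }
      assert (0 <= U * C0 * / INR (S m)) by (apply Rmult_le_pos; [apply Rmult_le_pos; auto|lra]).
      lra. }
  destruct (clim_of_cauchy (fun n => gauss_inv n s) (3 * C0 * U) N) as [l [Hl Hl']].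
  { apply Rmult_le_pos; lra. }
  { intros n m Hn Hnm.
    replace (3 * C0 * U)%R with (2 * (3 / 2 * U * C0))%R by field.
    apply (cauchy_of_quadratic (fun n => gauss_inv n s) (3 / 2 * U * C0) N); auto.
    - apply Rmult_le_pos; [|auto]. lra.
    - intros k Hk. eapply Rle_trans; [apply (gauss_inv_step k s R); auto; unfold N in Hk; lia|].
      fold C0. unfold Rdiv. apply Rmult_le_compat_r; [left; apply Rinv_0_lt_compat, pow_lt, INR_S_pos|].
      apply Rmult_le_compat_r; auto.
      specialize (Hb k Hk). generalize (Cmod_ge_minus (gauss_inv k s) (gauss_inv N s)). fold U. lra. }
  assert (L : clim (fun n => gauss_inv n s) (rgamma s)).
  { unfold rgamma. apply epsilon_spec. exists l. auto. }
  assert (El : rgamma s = l) by (eapply clim_unique; eauto).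
  rewrite El. split; [exact Hl|split; [|exact Hl']].
  eapply Rle_trans; [apply Hl'; auto|].
  apply Rmult_le_reg_r with (INR (S N)); auto.
  unfold Rdiv. rewrite (Rmult_assoc _ (/ INR (S N))), Rinv_l, Rmult_1_r by lra.
  assert (U * (6 * C0) <= U * INR (S N)) by (apply Rmult_le_compat_l; auto). lra.
Qed.

Lemma rgamma_lim (s : C) : clim (fun n => gauss_inv n s) (rgamma s).
Proof.
  destruct (rgamma_approx (Cmod s) (Cmod_ge_0 s)) as [N [_ H]]. apply H. lra.
Qed.

Lemma cdiff_rgamma (s : C) : cdiff rgamma s.
Proof.
  assert (HR : 0 <= Cmod s + 1) by (generalize (Cmod_ge_0 s); lra).
  destruct (rgamma_approx (Cmod s + 1) HR) as [N [_ H]].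
  destruct (ccont_locally_bounded (gauss_inv N) s) as [d [Hd Hdb]].
  { apply cdiff_ccont, cdiff_gauss_inv. }
  set (M := (Cmod (gauss_inv N s) + 1)%R) in *.
  assert (HM : 0 < M) by (unfold M; generalize (Cmod_ge_0 (gauss_inv N s)); lra).
  assert (HC := gauss_inv_const_pos _ HR). set (C0 := gauss_inv_const (Cmod s + 1)) in *.
  apply weierstrass with (Rmin 1 d); [apply Rmin_glb_lt; lra|]. intros e He.
  destruct (archimed_inv (3 * C0 * M) e) as [n0 Hn0]; auto.
  { apply Rmult_le_pos; lra. }
  set (n := Nat.max N n0).
  exists (gauss_inv n). intros w Hw. split; [apply cdiff_gauss_inv|].
  assert (W1 : Cmod (w - s) < 1) by (eapply Rlt_le_trans; [apply Hw|apply Rmin_l]).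
  assert (W2 : Cmod (w - s) < d) by (eapply Rlt_le_trans; [apply Hw|apply Rmin_r]).
  assert (W3 : Cmod w <= Cmod s + 1).
  { replace w with ((w - s) + s) by ring. eapply Rle_trans; [apply Cmod_triangle|]. lra. }
  destruct (H w W3) as [_ [_ H3]]. rewrite Cmod_sub_sym.
  eapply Rle_trans; [apply (H3 n); unfold n; lia|]. fold C0.
  eapply Rle_trans; [|left; apply (Hn0 n); unfold n; lia].
  unfold Rdiv. apply Rmult_le_compat_r; [left; apply Rinv_0_lt_compat, INR_S_pos|].
  apply Rmult_le_compat_l; [lra|]. left. auto.
Qed.

Lemma rising_neq_0 (s : C) (n : nat) : (forall j, (j < n)%nat -> s <> - RtoC (INR j)) -> rising s n <> 0.
Proof.
  intros H. induction n as [|n IH]; simpl.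
  - apply C1_nz.
  - apply Cmult_neq_0; auto. intros E. apply (H n); auto.
    replace s with (s + RtoC (INR n) - RtoC (INR n)) by ring. rewrite E. ring.
Qed.

(** A zero of the limit would give [Cmod (gauss_inv N s) <= Cmod (gauss_inv N s) / 2], forcing a
    factor of [rising] to vanish. *)
Lemma rgamma_neq_0 (s : C) : (forall n, s <> - RtoC (INR n)) -> rgamma s <> 0.
Proof.
  intros Hs E. destruct (rgamma_approx (Cmod s) (Cmod_ge_0 s)) as [N [_ H]].
  destruct (H s ltac:(lra)) as [_ [H2 _]]. rewrite E in H2.
  replace (0 - gauss_inv N s) with (- gauss_inv N s) in H2 by ring. rewrite Cmod_opp in H2.
  assert (Z : gauss_inv N s = 0). { apply Cmod_eq_0. generalize (Cmod_ge_0 (gauss_inv N s)). lra. }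
  assert (Nr : rising s (S N) <> 0) by (apply rising_neq_0; auto).
  apply Nr. replace (rising s (S N)) with (gauss_inv N s * (RtoC (INR (fact N)) * Rcpow (INR N) s)).
  - rewrite Z. ring.
  - unfold gauss_inv. field. split; [apply Rcpow_neq_0|apply INR_fact_C].
Qed.

Lemma clim_div_n (k : C) : clim (fun n => k / RtoC (INR n)) 0.
Proof.
  intros e He. destruct (archimed_inv (Cmod k) e (Cmod_ge_0 k) He) as [N HN].
  exists (S N). intros n Hn. destruct n as [|n]; [lia|].
  replace (k / RtoC (INR (S n)) - 0) with (k / RtoC (INR (S n))) by ring.
  assert (P := INR_S_pos n).
  rewrite Cmod_div by apply RtoC_INR_S_neq_0. rewrite Cmod_R, Rabs_right by lra.
  apply HN. lia.
Qed.

Lemma rising_shift (z : C) (n : nat) : rising z (S n) = z * rising (z + 1) n.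
Proof.
  induction n as [|n IH].
  - simpl. ring.
  - change (rising z (S (S n))) with (rising z (S n) * (z + RtoC (INR (S n)))). rewrite IH.
    change (rising (z + 1) (S n)) with (rising (z + 1) n * (z + 1 + RtoC (INR n))).
    rewrite S_INR, RtoC_plus. ring.
Qed.

Lemma rgamma_rec (z : C) : rgamma z = z * rgamma (z + 1).
Proof.
  apply (clim_unique (fun n => gauss_inv n z * (1 + (z + 1) / RtoC (INR n)))).
  - replace (rgamma z) with (rgamma z * (1 + 0)) by ring.
    apply clim_mult; [apply rgamma_lim|]. apply clim_plus; [apply clim_const|apply clim_div_n].
  - apply clim_ext with (u := fun n => z * gauss_inv n (z + 1)) (N0 := 1%nat).
    2:{ apply clim_scal, rgamma_lim. }
    intros n Hn. destruct n as [|n]; [lia|]. set (m := S n).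
    assert (N0 : RtoC (INR m) <> 0) by apply RtoC_INR_S_neq_0.
    unfold gauss_inv. rewrite Rcpow_plus, Rcpow_1 by apply INR_S_pos.
    assert (E : z * rising (z + 1) (S m) = rising z (S m) * (z + RtoC (INR m) + 1)).
    { rewrite <- rising_shift.
      change (rising z (S (S m))) with (rising z (S m) * (z + RtoC (INR (S m)))).
      rewrite (S_INR m), RtoC_plus. ring. }
    assert (N1 := INR_fact_C m). assert (N2 := Rcpow_neq_0 (INR m) z).
    transitivity ((z * rising (z + 1) (S m)) / (RtoC (INR (fact m)) * (Rcpow (INR m) z * RtoC (INR m)))).
    { field. auto. }
    rewrite E. field. auto.
Qed.

Lemma rgamma_rising (z : C) (n : nat) : rgamma z = rising z n * rgamma (z + RtoC (INR n)).
Proof.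
  induction n as [|n IH].
  - simpl. rewrite Cplus_0_r. ring.
  - rewrite IH. rewrite (rgamma_rec (z + RtoC (INR n))).
    change (rising z (S n)) with (rising z n * (z + RtoC (INR n))).
    rewrite S_INR, RtoC_plus. replace (z + (RtoC (INR n) + 1)) with (z + RtoC (INR n) + 1) by ring. ring.
Qed.

Lemma cder_factor (f h : C -> C) (a : C) :
  (forall z, f z = (z - a) * h z) -> cdiff h a -> cder f a (h a).
Proof.
  intros E Hh. exists h. split; [apply cdiff_ccont; auto|]. split; auto.
  intros w. rewrite (E w), (E a). ring.
Qed.

Lemma RtoC_nonneg_neq (x : R) : 0 < x -> forall n, RtoC x <> - RtoC (INR n).
Proof.
  intros Hx n E. rewrite <- RtoC_opp in E. apply RtoC_inj in E. generalize (pos_INR n). lra.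
Qed.

(** Applying the functional equation [n + 1] times splits off [z + n]; at [- n] the cofactor [h] is
    a nonzero rising product times [rgamma 1]. *)
Lemma rgamma_simple_zero (n : nat) :
  rgamma (- RtoC (INR n)) = 0 /\ C_derive rgamma (- RtoC (INR n)) <> 0.
Proof.
  set (a := - RtoC (INR n)).
  set (h := fun z => rising z n * rgamma (z + RtoC (INR (S n)))).
  assert (E : forall z, rgamma z = (z - a) * h z).
  { intros z. unfold h, a. rewrite (rgamma_rising z (S n)).
    change (rising z (S n)) with (rising z n * (z + RtoC (INR n))). ring. }
  split.
  - rewrite E. ring.
  - rewrite (cder_C_derive _ _ _ (cder_factor rgamma h a E ltac:(unfold h;
      apply cdiff_mult; [auto with cd|apply (cdiff_comp rgamma (fun z => z + RtoC (INR (S n))));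
        [apply cdiff_rgamma|auto with cd]]))).
    unfold h. apply Cmult_neq_0.
    + apply rising_neq_0. intros j Hj E'. unfold a in E'. apply lt_INR in Hj.
      rewrite <- !RtoC_opp in E'. apply RtoC_inj in E'. lra.
    + replace (a + RtoC (INR (S n))) with (RtoC 1) by (unfold a; rewrite S_INR, RtoC_plus; ring).
      apply rgamma_neq_0, RtoC_nonneg_neq. lra.
Qed.

Lemma rising_duplication (z : C) (n : nat) :
  rising z n * rising (z + / 2) n * 4 ^ n = rising (2 * z) (2 * n).
Proof.
  induction n as [|n IH]; [simpl; ring|].
  replace (2 * S n)%nat with (S (S (2 * n))) by lia. cbn [rising]. rewrite <- IH.
  rewrite S_INR, RtoC_plus, mult_INR, RtoC_mult. replace (INR 2) with 2%R by (simpl; ring).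
  simpl Cpow. field.
Qed.

(** For Gauss's products the formula holds up to a factor [an n] independent of [z] and a factor
    tending to 1. Both the convergence of [an] and the nonvanishing of its limit are read off at
    [z = 1/2], where the limits of both sides are nonzero. *)
Lemma rgamma_duplication : exists a : C, a <> 0 /\
  forall z, rgamma z * rgamma (z + / 2) = a * Rcpow 2 (2 * z) * rgamma (2 * z).
Proof.
  set (an := fun n => RtoC (2 * INR n * INR (fact (2 * n)) / (INR (fact n) * INR (fact n))) /
     (4 ^ S n * Rcpow (INR n) (/ 2))).
  assert (H : forall z n, (1 <= n)%nat -> gauss_inv n z * gauss_inv n (z + / 2) =
    an n * (Rcpow 2 (2 * z) * (gauss_inv (2 * n) (2 * z) * (1 + ((2 * z + 1) / 2) / RtoC (INR n))))).
  { intros z n Hn. destruct n as [|n]; [lia|]. set (m := S n).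
    assert (Pm := INR_S_pos n : (0 < INR m)%R).
    assert (N0 : RtoC (INR m) <> 0) by apply RtoC_INR_S_neq_0.
    assert (E := rising_duplication z (S m)).
    replace (2 * S m)%nat with (S (S (2 * m))) in E by lia.
    change (rising (2 * z) (S (S (2 * m)))) with
      (rising (2 * z) (S (2 * m)) * (2 * z + RtoC (INR (S (2 * m))))) in E.
    rewrite S_INR, RtoC_plus, mult_INR, RtoC_mult in E. replace (INR 2) with 2%R in E by (simpl; ring).
    assert (N4 : (4 : C) ^ S m <> 0).
    { apply Cpow_nz. intros E4. apply RtoC_inj in E4. lra. }
    assert (E1 : rising z (S m) * rising (z + / 2) (S m) =
       rising (2 * z) (S (2 * m)) * (2 * z + (2 * RtoC (INR m) + 1)) / 4 ^ S m).
    { rewrite <- E. field. auto. }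
    unfold an, gauss_inv.
    assert (E2 : Rcpow (INR (2 * m)) (2 * z) = Rcpow 2 (2 * z) * (Rcpow (INR m) z * Rcpow (INR m) z)).
    { rewrite mult_INR. replace (INR 2) with 2%R by (simpl; ring).
      rewrite Rcpow_mult by lra. rewrite <- Rcpow_plus. f_equal. f_equal. ring. }
    rewrite E2, Rcpow_plus.
    rewrite RtoC_div, !RtoC_mult by (apply Rmult_integral_contrapositive_currified; apply INR_fact_neq_0).
    assert (N1 := INR_fact_C m). assert (N2 := INR_fact_C (2 * m)).
    assert (N3 := Rcpow_neq_0 (INR m) z). assert (N5 := Rcpow_neq_0 (INR m) (/ 2)).
    assert (N6 := Rcpow_neq_0 2 (2 * z)).
    transitivity ((rising z (S m) * rising (z + / 2) (S m)) / (RtoC (INR (fact m)) * RtoC (INR (fact m)) *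
       (Rcpow (INR m) z * Rcpow (INR m) z * Rcpow (INR m) (/ 2)))).
    { field. auto. }
    rewrite E1. field. repeat split; auto. }
  assert (N12 : rgamma 1 <> 0) by (apply rgamma_neq_0, RtoC_nonneg_neq; lra).
  assert (Nh : rgamma (/ 2) <> 0).
  { replace (/ 2) with (RtoC (/ 2)) by (rewrite RtoC_inv; auto; lra).
    apply rgamma_neq_0, RtoC_nonneg_neq. lra. }
  assert (L2 : forall z, clim (fun n => Rcpow 2 (2 * z) * (gauss_inv (2 * n) (2 * z) * (1 + ((2 * z + 1) / 2) / RtoC (INR n))))
     (Rcpow 2 (2 * z) * (rgamma (2 * z) * (1 + 0)))).
  { intros z. apply clim_scal, clim_mult.
    - apply (clim_subseq (fun n => gauss_inv n (2 * z)) _ (fun n => 2 * n)%nat); [lia|apply rgamma_lim].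
    - apply clim_plus; [apply clim_const|apply clim_div_n]. }
  assert (L1 : forall z, clim (fun n => gauss_inv n z * gauss_inv n (z + / 2)) (rgamma z * rgamma (z + / 2))).
  { intros z. apply clim_mult; apply rgamma_lim. }
  set (D := Rcpow 2 (2 * / 2) * (rgamma (2 * / 2) * (1 + 0))).
  assert (E22 : 2 * / 2 = RtoC 1) by (field; intros E; apply RtoC_inj in E; lra).
  assert (ND : D <> 0).
  { unfold D. rewrite E22. apply Cmult_neq_0; [apply Rcpow_neq_0|]. rewrite Cplus_0_r, Cmult_1_r. auto. }
  set (a := rgamma (/ 2) * rgamma (/ 2 + / 2) * / D).
  assert (La : clim an a).
  { assert (Li := clim_mult _ _ _ _ (L1 (/ 2)) (clim_comp Cinv _ D (ccont_inv_id D ND) (L2 (/ 2)))).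
    (* Beyond [N1] the terms are closer to [D] than 0 is, so dividing by them is legitimate. *)
    destruct (L2 (/ 2) (Cmod D)) as [N1 HN1]. { apply Cmod_gt_0; auto. }
    eapply clim_ext; [|exact Li]. instantiate (1 := Nat.max 1 N1). intros n Hn. cbv beta.
    rewrite (H (/ 2) n) by lia.
    specialize (HN1 n ltac:(lia)). fold D in HN1. cbv beta in HN1.
    set (t := Rcpow 2 (2 * / 2) * (gauss_inv (2 * n) (2 * / 2) * (1 + (2 * / 2 + 1) / 2 / RtoC (INR n)))) in *.
    assert (t <> 0).
    { intros E. rewrite E in HN1. replace (0 - D) with (- D) in HN1 by ring.
      rewrite Cmod_opp in HN1. lra. }
    field. auto. }
  exists a. split.
  - unfold a. apply Cmult_neq_0; [apply Cmult_neq_0; auto|].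
    + replace (/ 2 + / 2) with (RtoC 1) by (rewrite <- E22; ring). auto.
    + intros E. apply C1_nz. rewrite <- (Cinv_l D ND), E. ring.
  - intros z. apply (clim_unique (fun n => gauss_inv n z * gauss_inv n (z + / 2))); auto.
    replace (a * Rcpow 2 (2 * z) * rgamma (2 * z)) with (a * (Rcpow 2 (2 * z) * (rgamma (2 * z) * (1 + 0)))) by ring.
    eapply clim_ext; [|apply (clim_mult _ _ _ _ La (L2 z))]. instantiate (1 := 1%nat).
    intros n Hn. symmetry. apply H; auto.
Qed.

Lemma CLim_seq_clim (u : nat -> C) (l : C) : clim u l -> CLim_seq u = l.
Proof.
  intros H. destruct l as [x y]. unfold CLim_seq.
  assert (Hx : is_lim_seq (fun n => Re (u n)) x).
  { apply is_lim_seq_Reals. intros e He. destruct (H e He) as [N HN]. exists N. intros n Hn.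
    unfold Rdist. eapply Rle_lt_trans; [apply (re_le_Cmod (u n - (x, y)))|auto]. }
  assert (Hy : is_lim_seq (fun n => Im (u n)) y).
  { apply is_lim_seq_Reals. intros e He. destruct (H e He) as [N HN]. exists N. intros n Hn.
    unfold Rdist. eapply Rle_lt_trans; [apply (im_le_Cmod (u n - (x, y)))|auto]. }
  rewrite (is_lim_seq_unique _ _ Hx), (is_lim_seq_unique _ _ Hy). reflexivity.
Qed.

Lemma Gamma_rgamma (s : C) : (forall n, s <> - RtoC (INR n)) -> Gamma s = / rgamma s.
Proof.
  intros Hs. unfold Gamma. apply CLim_seq_clim.
  apply clim_ext with (u := fun n => / gauss_inv n s) (N0 := O).
  - intros n _. unfold gauss_inv.
    assert (rising s (S n) <> 0) by (apply rising_neq_0; auto).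
    assert (N1 := INR_fact_C n). assert (N2 := Rcpow_neq_0 (INR n) s). field. auto.
  - apply (clim_comp Cinv); [|apply rgamma_lim].
    apply ccont_inv_id, rgamma_neq_0. auto.
Qed.

(** * Zeros of the sine and the entire numerators *)

Definition csinpi (z : C) : C := Csin (RtoC PI * z).

Lemma two_Ci_neq_0 : 2 * Ci <> 0.
Proof. intros E. apply (f_equal Im) in E. simpl in E. lra. Qed.

Lemma csinpi_Cexp (z : C) : csinpi z = (Cexp (Ci * RtoC PI * z) - Cexp (- (Ci * RtoC PI) * z)) / (2 * Ci).
Proof. unfold csinpi, Csin. f_equal. f_equal; [|f_equal]; f_equal; ring. Qed.

Lemma cder_csinpi (z : C) : cder csinpi z
  ((Ci * RtoC PI * Cexp (Ci * RtoC PI * z) + Ci * RtoC PI * Cexp (- (Ci * RtoC PI) * z)) / (2 * Ci)).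
Proof.
  assert (L : forall k, cder (fun w => Cexp (k * w)) z (Cexp (k * z) * (k * 1))).
  { intros k. apply (cder_comp Cexp (fun w => k * w)); [apply cder_Cexp|].
    apply cder_scal, cder_id. }
  apply cder_ext with (fun w => / (2 * Ci) * (Cexp (Ci * RtoC PI * w) - Cexp (- (Ci * RtoC PI) * w))).
  { intros w. rewrite csinpi_Cexp. field. exact (fun E => two_Ci_neq_0 ltac:(rewrite E; ring)). }
  eapply cder_eq; [apply cder_scal, cder_minus; apply L|].
  field. exact (fun E => two_Ci_neq_0 ltac:(rewrite E; ring)).
Qed.

Lemma csinpi_zero_Cexp (z : C) : csinpi z = 0 -> Cexp (Ci * RtoC PI * z) = Cexp (- (Ci * RtoC PI) * z).
Proof.
  intros H. rewrite csinpi_Cexp in H.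
  set (u := Cexp (Ci * RtoC PI * z)) in *. set (v := Cexp (- (Ci * RtoC PI) * z)) in *.
  assert (E : u - v = 0).
  { replace (u - v) with ((u - v) / (2 * Ci) * (2 * Ci)).
    - rewrite H. ring.
    - field. exact (fun E => two_Ci_neq_0 ltac:(rewrite E; ring)). }
  replace u with (u - v + v) by ring. rewrite E. ring.
Qed.

(** At a zero the two exponentials coincide, so the derivative is [PI] times an exponential. *)
Lemma csinpi_simple_zero (z : C) : csinpi z = 0 -> C_derive csinpi z <> 0.
Proof.
  intros H. apply csinpi_zero_Cexp in H. rewrite (cder_C_derive _ _ _ (cder_csinpi z)), <- H.
  intros E. apply (Cmult_neq_0 (RtoC PI) (Cexp (Ci * RtoC PI * z))).
  - intros EP. apply RtoC_inj in EP. apply PI_neq0. auto.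
  - apply Cexp_neq_0.
  - rewrite <- E. field. exact (fun E => two_Ci_neq_0 ltac:(rewrite E; ring)).
Qed.

(** A zero means [exp(2 i pi z) = 1]: the modulus forces [z] to be real, and then [cos(2 pi x) = 1]
    forces [sin(pi x) = 0]. *)
Lemma csinpi_zero_integer (z : C) : csinpi z = 0 -> is_integer z.
Proof.
  intros H. apply csinpi_zero_Cexp in H.
  assert (E : Cexp (2 * Ci * RtoC PI * z) = 1).
  { replace (2 * Ci * RtoC PI * z) with (Ci * RtoC PI * z + Ci * RtoC PI * z) by ring.
    rewrite Cexp_plus. rewrite H at 1.
    replace (- (Ci * RtoC PI) * z) with (- (Ci * RtoC PI * z)) by ring. apply Cexp_opp. }
  assert (HP := PI_RGT_0).
  destruct z as [x y].
  assert (Em := f_equal Cmod E). rewrite Cmod_Cexp, Cmod_1 in Em.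
  replace (Re (2 * Ci * RtoC PI * (x, y))) with (- (2 * PI * y))%R in Em by (simpl; ring).
  rewrite <- exp_0 in Em. apply exp_inv in Em.
  assert (Hy : y = 0%R).
  { apply Rmult_eq_reg_l with (2 * PI)%R; [lra|apply Rgt_not_eq; lra]. }
  subst y. apply (f_equal Re) in E. unfold Cexp in E. cbn [Re fst] in E.
  replace (Re (2 * Ci * RtoC PI * (x, 0%R))) with 0%R in E by (simpl; ring).
  replace (Im (2 * Ci * RtoC PI * (x, 0%R))) with (2 * (PI * x))%R in E by (simpl; ring).
  rewrite exp_0, Rmult_1_l, cos_2a_sin in E. change (Re (RtoC 1)) with 1%R in E.
  assert (Hs : sin (PI * x) = 0%R).
  { apply Rsqr_0_uniq. unfold Rsqr. lra. }
  apply sin_eq_0_0 in Hs. destruct Hs as [k Hk]. exists k. unfold RtoC. f_equal.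
  apply Rmult_eq_reg_l with PI; [lra|apply Rgt_not_eq; lra].
Qed.

Lemma csinpi_integer (k : Z) : csinpi (RtoC (IZR k)) = 0.
Proof.
  rewrite csinpi_Cexp.
  assert (Hs : sin (PI * IZR k) = 0%R). { apply sin_eq_0_1. exists k. ring. }
  replace (Cexp (Ci * RtoC PI * RtoC (IZR k))) with (Cexp (- (Ci * RtoC PI) * RtoC (IZR k))).
  { field. exact (fun E => two_Ci_neq_0 ltac:(rewrite E; ring)). }
  unfold Cexp.
  replace (Re (- (Ci * RtoC PI) * RtoC (IZR k))) with 0%R by (simpl; ring).
  replace (Re (Ci * RtoC PI * RtoC (IZR k))) with 0%R by (simpl; ring).
  replace (Im (- (Ci * RtoC PI) * RtoC (IZR k))) with (- (PI * IZR k))%R by (simpl; ring).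
  replace (Im (Ci * RtoC PI * RtoC (IZR k))) with (PI * IZR k)%R by (simpl; ring).
  rewrite cos_neg, sin_neg, Hs. f_equal. f_equal. ring.
Qed.

(** The integers are the zero set of the continuous function [csinpi]. *)
Lemma not_integer_open (s : C) : ~ is_integer s ->
  exists r, 0 < r /\ forall w, Cmod (w - s) < r -> ~ is_integer w.
Proof.
  intros H. destruct (ccont_nonzero csinpi s) as [r [Hr Hn]].
  - apply cdiff_ccont. eexists. apply cder_csinpi.
  - intros E. apply H, csinpi_zero_integer, E.
  - exists r. split; auto. intros w Hw [k ->]. apply (Hn _ Hw), csinpi_integer.
Qed.

Lemma rgamma_zero (z : C) : rgamma z = 0 -> exists n, z = - RtoC (INR n).
Proof.
  intros H. apply NNPP. intros Hn. apply (rgamma_neq_0 z); auto. intros n E. apply Hn. exists n. auto.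
Qed.

Lemma cder_rgamma_compl (z : C) : cder (fun w => rgamma (1 - w)) z (- C_derive rgamma (1 - z)).
Proof.
  eapply cder_eq.
  - apply (cder_comp rgamma (fun w => 1 - w)); [apply cdiff_derive, cdiff_rgamma|].
    apply cder_minus; [apply cder_const|apply cder_id].
  - ring.
Qed.

(** [sin (pi z)] and [rgamma z * rgamma (1 - z)] have the same simple zeros; that
    their ratio is constant (the reflection formula) is not needed. *)
Lemma weak_reflection : exists Q, (forall z, cdiff Q z) /\ (forall z, Q z <> 0) /\
  forall z, csinpi z = Q z * (rgamma z * rgamma (1 - z)).
Proof.
  set (P := fun z => rgamma z * rgamma (1 - z)).
  assert (HPd : forall z, cder P z (C_derive rgamma z * rgamma (1 - z) + rgamma z * - C_derive rgamma (1 - z))).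
  { intros z. apply (cder_mult rgamma (fun w => rgamma (1 - w)));
    [apply cdiff_derive, cdiff_rgamma|apply cder_rgamma_compl]. }
  assert (HS : forall z, cdiff csinpi z) by (intros; eexists; apply cder_csinpi).
  assert (HP : forall z, cdiff P z) by (intros; eexists; apply HPd).
  assert (HP0 : forall a, P a = 0 -> csinpi a = 0 /\ C_derive P a <> 0).
  { intros a Ha. rewrite (cder_C_derive _ _ _ (HPd a)).
    destruct (classic (rgamma a = 0)) as [E|E].
    - destruct (rgamma_zero _ E) as [n ->]. destruct (rgamma_simple_zero n) as [E0 E1]. split.
      + rewrite INR_IZR_INZ, <- RtoC_opp, <- opp_IZR. apply csinpi_integer.
      + rewrite E. replace (C_derive rgamma (- RtoC (INR n)) * rgamma (1 - - RtoC (INR n)) + 0 * - C_derive rgamma (1 - - RtoC (INR n)))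
          with (C_derive rgamma (- RtoC (INR n)) * rgamma (1 - - RtoC (INR n))) by ring.
        apply Cmult_neq_0; auto.
        replace (1 - - RtoC (INR n)) with (RtoC (INR (S n))) by (rewrite S_INR, RtoC_plus; ring).
        apply rgamma_neq_0, RtoC_nonneg_neq, INR_S_pos.
    - assert (E' : rgamma (1 - a) = 0).
      { apply NNPP. intros N. apply (Cmult_neq_0 _ _ E N Ha). }
      destruct (rgamma_zero _ E') as [n En]. destruct (rgamma_simple_zero n) as [E0 E1]. split.
      + replace a with (RtoC (IZR (Z.of_nat (S n)))); [apply csinpi_integer|].
        rewrite <- INR_IZR_INZ, S_INR, RtoC_plus. replace a with (1 - (1 - a)) by ring. rewrite En. ring.
      + rewrite E', En. intros E2. apply (Cmult_neq_0 _ _ E E1).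
        replace (rgamma a * C_derive rgamma (- RtoC (INR n))) with
          (- (C_derive rgamma a * 0 + rgamma a * - C_derive rgamma (- RtoC (INR n)))) by ring.
        rewrite E2. ring. }
  destruct (entire_quotient csinpi P HS HP HP0) as [Q [HQ EQ]].
  exists Q. split; [auto|split]; [|exact EQ].
  (* A zero of [Q] would be a zero of [csinpi], hence an integer, hence also a zero of [P]. The
     product [Q * P] would then have zero derivative there, contradicting the simplicity of the
     zeros of [csinpi]. *)
  intros z Hz.
  assert (Sz : csinpi z = 0) by (rewrite EQ, Hz; ring).
  assert (Pz : P z = 0).
  { destruct (csinpi_zero_integer _ Sz) as [k ->]. unfold P.
    destruct (Z_le_gt_dec k 0) as [Hk|Hk].
    - replace (RtoC (IZR k)) with (- RtoC (INR (Z.to_nat (- k)))).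
      + rewrite (proj1 (rgamma_simple_zero _)). ring.
      + rewrite INR_IZR_INZ, Z2Nat.id by lia. rewrite opp_IZR, RtoC_opp. ring.
    - replace (1 - RtoC (IZR k)) with (- RtoC (INR (Z.to_nat (k - 1)))).
      + rewrite (proj1 (rgamma_simple_zero _)). ring.
      + rewrite INR_IZR_INZ, Z2Nat.id by lia. rewrite minus_IZR, RtoC_minus. ring. }
  apply (csinpi_simple_zero z Sz).
  rewrite (cder_C_derive _ _ (C_derive Q z * P z + Q z * C_derive P z)).
  - rewrite Hz, Pz. ring.
  - apply cder_ext with (fun w => Q w * P w). { intros w. symmetry. apply EQ. }
    apply cder_mult; apply cdiff_derive; auto.
Qed.

(** * Zeta, chi and omega expressed through entire functions *)

Lemma is_series_clim (a : nat -> C) (l : C) :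
  is_series (K := C_AbsRing) (V := C_NormedModule) a l <-> clim (csum a) l.
Proof.
  assert (E : forall n, sum_n (G := C_AbelianMonoid) a n = csum a (S n)).
  { intros n. induction n as [|n IH].
    - rewrite sum_O. simpl. ring.
    - rewrite sum_Sn, IH. reflexivity. }
  split.
  - intros H e He.
    destruct (H (fun w => Cmod (w - l) < e)) as [N HN].
    { assert (L : locally (T := C_UniformSpace) l (fun w => Cmod (w - l) < e)).
      { apply locally_C_eps. exists e. auto. } exact L. }
    exists (S N). intros n Hn. destruct n as [|n]; [lia|].
    rewrite <- E. apply HN. lia.
  - intros H P HP.
    assert (HP' : locally (T := C_UniformSpace) l P) by exact HP.
    apply locally_C_eps in HP'. destruct HP' as [d [Hd HP']].
    destruct (H d Hd) as [N HN]. exists N. intros n Hn. apply HP'.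
    change (Cmod (sum_n (G := C_AbelianMonoid) a n - l) < d). rewrite E. apply HN. lia.
Qed.

Lemma holomorphic_at_cdiff (f : C -> C) (z : C) : holomorphic_at f z -> cdiff f z.
Proof.
  intros H. apply locally_C_eps in H. destruct H as [d [Hd H]]. apply cdiff_ex_derive, H.
  replace (z - z) with (RtoC 0) by ring. rewrite Cmod_0. auto.
Qed.

Lemma Re_gt_1_neq (s : C) : 1 < Re s -> s - 1 <> 0.
Proof. intros H E. apply (f_equal Re) in E. simpl in E. unfold Re in H. lra. Qed.

Lemma dirichlet_lim_sum (E : C -> C) (s : C) : 1 < Re s ->
  dirichlet_lim E s <-> clim (dirichlet_sum s) (E s / (s - 1)).
Proof.
  intros Hs. assert (N := Re_gt_1_neq s Hs). split; intros H.
  - apply (clim_scal (/ (s - 1))) in H.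
    replace (E s / (s - 1)) with (/ (s - 1) * E s) by (field; auto).
    refine (clim_ext _ _ _ O _ H). intros n _. field. auto.
  - apply (clim_scal (s - 1)) in H. unfold dirichlet_lim.
    replace (E s) with ((s - 1) * (E s / (s - 1))) by (field; auto). exact H.
Qed.

(** [E s / (s - 1)] witnesses that a continuation exists, so the [epsilon] in [zeta] does pick one;
    the identity theorem on the plane without 1 then shows that it is this one. *)
Lemma zeta_eq (E : C -> C) : (forall s, cdiff E s) ->
  (forall s, 1 < Re s -> dirichlet_lim E s) ->
  forall s : C, s <> 1 -> zeta s = E s / (s - 1).
Proof.
  intros HE1 HE2.
  assert (Hd : forall s : C, s <> 1 -> cdiff (fun s => E s / (s - 1)) s).
  { intros s Hs. apply cdiff_div; auto with cd. apply Csub_neq_0; auto. }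
  assert (Hex : zeta_continuation (fun s => E s / (s - 1))).
  { split.
    - intros s Hs. apply is_series_clim. apply (dirichlet_lim_sum E s Hs). auto.
    - intros s Hs. apply locally_C_eps.
      assert (N := Csub_neq_0 _ _ Hs). exists (Cmod (s - 1)). split; [apply Cmod_gt_0; auto|].
      intros w Hw. apply cdiff_ex_derive, Hd. intros ->. rewrite Cmod_sub_sym in Hw. lra. }
  assert (Hz : zeta_continuation zeta).
  { unfold zeta. apply epsilon_spec. eexists. exact Hex. }
  destruct Hz as [Hz1 Hz2]. destruct Hex as [Hx1 _]. intros s Hs.
  assert (H0 : zeta s - E s / (s - 1) = 0).
  { apply (identity_punctured (fun s => zeta s - E s / (s - 1)) 1 1); auto.
    - intros w Hw. apply cdiff_minus; [apply holomorphic_at_cdiff|]; auto.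
    - intros w Hw. specialize (Hz1 w Hw). specialize (Hx1 w Hw).
      apply is_series_clim in Hz1. apply is_series_clim in Hx1.
      rewrite (clim_unique _ _ _ Hz1 Hx1). ring. }
  replace (zeta s) with (zeta s - E s / (s - 1) + E s / (s - 1)) by ring. rewrite H0. ring.
Qed.

Definition Afun (s : C) : C := rgamma (s / 2).
Definition Bfun (s : C) : C := rgamma ((1 - s) / 2).

Lemma C2_neq_0 : RtoC 2 <> 0.
Proof. intros E. apply RtoC_inj in E. lra. Qed.

Lemma cdiff_Afun (s : C) : cdiff Afun s.
Proof.
  apply (cdiff_comp rgamma (fun s => s / 2)); [apply cdiff_rgamma|].
  apply cdiff_div; auto with cd. apply C2_neq_0.
Qed.

Lemma cdiff_Bfun (s : C) : cdiff Bfun s.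
Proof.
  apply (cdiff_comp rgamma (fun s => (1 - s) / 2)); [apply cdiff_rgamma|].
  apply cdiff_div; auto with cd. apply C2_neq_0.
Qed.

Lemma not_integer_half (s : C) : ~ is_integer s -> forall n, s / 2 <> - RtoC (INR n).
Proof.
  intros H n E. apply H. exists (- (2 * Z.of_nat n))%Z.
  replace s with (2 * (s / 2)) by (field; apply C2_neq_0). rewrite E.
  rewrite opp_IZR, mult_IZR, <- INR_IZR_INZ, RtoC_opp, RtoC_mult. ring.
Qed.

Lemma not_integer_compl (s : C) : ~ is_integer s -> ~ is_integer (1 - s).
Proof.
  intros H [n E]. apply H. exists (1 - n)%Z. rewrite minus_IZR, RtoC_minus, <- E. ring.
Qed.

Lemma not_integer_neg (s : C) : ~ is_integer s -> forall n, s <> - RtoC (INR n).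
Proof.
  intros H n E. apply H. exists (- Z.of_nat n)%Z. rewrite E, opp_IZR, <- INR_IZR_INZ, RtoC_opp. auto.
Qed.

Lemma Afun_neq_0 (s : C) : ~ is_integer s -> Afun s <> 0.
Proof. intros H. apply rgamma_neq_0, not_integer_half, H. Qed.

Lemma Bfun_neq_0 (s : C) : ~ is_integer s -> Bfun s <> 0.
Proof. intros H. apply rgamma_neq_0, not_integer_half, not_integer_compl, H. Qed.

(** The sine at [pi s / 2] is [Q(s/2) * A * rgamma (1 - s / 2)]. Duplication at [(1 - s) / 2] gives
    [B * rgamma (1 - s / 2) = a * 2^(1-s) * rgamma (1 - s)], whose last two factors absorb both
    [2^s] and [Gamma (1 - s)]. *)
Lemma chi_factorization : exists Y, (forall s, cdiff Y s) /\ (forall s, Y s <> 0) /\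
  forall s, ~ is_integer s -> chi s = Y s * Afun s / Bfun s.
Proof.
  destruct weak_reflection as [Q [HQ [NQ EQ]]].
  destruct rgamma_duplication as [a [Na Ea]].
  exists (fun s => 2 * a * Rcpow PI (s - 1) * Q (s / 2)).
  split; [|split].
  - intros s. apply cdiff_mult; [apply cdiff_mult; auto with cd|].
    apply (cdiff_comp Q (fun s => s / 2)); auto.
    apply cdiff_div; auto with cd. apply C2_neq_0.
  - intros s. repeat apply Cmult_neq_0; auto; [apply C2_neq_0|apply Rcpow_neq_0].
  - intros s Hs. unfold chi.
    replace (RtoC PI * s / 2) with (RtoC PI * (s / 2)) by (field; apply C2_neq_0).
    fold (csinpi (s / 2)). rewrite EQ.
    assert (N1 := not_integer_neg _ (not_integer_compl s Hs)).
    rewrite Gamma_rgamma by auto. assert (NG := rgamma_neq_0 _ N1).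
    assert (D := Ea ((1 - s) / 2)).
    replace (2 * ((1 - s) / 2)) with (1 - s) in D by (field; apply C2_neq_0).
    replace ((1 - s) / 2 + / 2) with (1 - s / 2) in D by (field; apply C2_neq_0).
    fold (Bfun s) in D.
    assert (R2 : Rcpow 2 (1 - s) = 2 * / Rcpow 2 s).
    { unfold Cminus. rewrite Rcpow_plus, Rcpow_opp, Rcpow_1 by lra. auto. }
    rewrite R2 in D.
    fold (Afun s). assert (NA := Afun_neq_0 s Hs). assert (NB := Bfun_neq_0 s Hs).
    assert (N2 := Rcpow_neq_0 2 s).
    replace (rgamma (1 - s / 2)) with (a * (2 * / Rcpow 2 s) * rgamma (1 - s) / Bfun s).
    + field. auto.
    + rewrite <- D. field. auto.
Qed.

Definition Xfun (s : C) : C := Afun s * Bfun s.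

Lemma cdiff_Xfun (s : C) : cdiff Xfun s.
Proof. apply cdiff_mult; [apply cdiff_Afun|apply cdiff_Bfun]. Qed.

Lemma Xfun_neq_0 (s : C) : ~ is_integer s -> Xfun s <> 0.
Proof. intros H. apply Cmult_neq_0; [apply Afun_neq_0|apply Bfun_neq_0]; auto. Qed.

Lemma omega_entire : exists W, (forall s, cdiff W s) /\
  forall s, ~ is_integer s -> omega s = W s / Xfun s.
Proof.
  destruct chi_factorization as [Y [HY [NY EY]]].
  assert (HYd : forall s, cdiff (C_derive Y) s).
  { intros s. apply cdiff_C_derive with 1%R; [lra|auto]. }
  assert (HAd : forall s, cdiff (C_derive Afun) s).
  { intros s. apply cdiff_C_derive with 1%R; [lra|]. intros; apply cdiff_Afun. }
  assert (HBd : forall s, cdiff (C_derive Bfun) s).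
  { intros s. apply cdiff_C_derive with 1%R; [lra|]. intros; apply cdiff_Bfun. }
  (* The logarithmic derivative [Y'/Y + A'/A - B'/B] of [Y A / B], multiplied by [A B]. *)
  exists (fun s => Afun s * Bfun s * (C_derive Y s / Y s) + C_derive Afun s * Bfun s - Afun s * C_derive Bfun s).
  split.
  - intros s. assert (H1 := cdiff_Afun s). assert (H2 := cdiff_Bfun s).
    specialize (HYd s). specialize (HAd s). specialize (HBd s). specialize (HY s). specialize (NY s).
    apply cdiff_minus; [apply cdiff_plus|].
    + apply cdiff_mult; [apply cdiff_mult|apply cdiff_div]; assumption.
    + apply cdiff_mult; assumption.
    + apply cdiff_mult; assumption.
  - intros s Hs. assert (NA := Afun_neq_0 s Hs). assert (NB := Bfun_neq_0 s Hs).
    destruct (not_integer_open s Hs) as [r [Hr Hri]].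
    unfold omega. rewrite (EY s Hs).
    rewrite (cder_C_derive chi s (((C_derive Y s * Afun s + Y s * C_derive Afun s) * Bfun s -
       Y s * Afun s * C_derive Bfun s) / (Bfun s * Bfun s))).
    + unfold Xfun. specialize (NY s). field. auto.
    + apply cder_ext_loc with (f := fun s => Y s * Afun s / Bfun s) (r := r); auto.
      { intros w Hw. symmetry. apply EY, Hri, Hw. }
      apply (cder_div (fun s => Y s * Afun s)); auto.
      * apply cder_mult; apply cdiff_derive; auto. apply cdiff_Afun.
      * apply cdiff_derive, cdiff_Bfun.
Qed.

(** * Numerators of the functions [Zfun k] and the conclusion *)

Lemma cder_pow (f : C -> C) (z l : C) (k : nat) : f z <> 0 -> cder f z l ->
  cder (fun w => f w ^ k) z (RtoC (INR k) * l * f z ^ k / f z).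
Proof.
  intros N H. induction k as [|k IH].
  - simpl. eapply cder_eq; [apply cder_const|]. field. auto.
  - eapply cder_eq; [apply (cder_mult f (fun w => f w ^ k)); eauto|].
    rewrite S_INR, RtoC_plus. simpl. field. auto.
Qed.

(** The entire function [Xfun s / (s - 1)]: [B] vanishes at 1, and [rgamma_rec] extracts that zero.
    It absorbs the term that comes from differentiating the pole factor [1 / (s - 1)]. *)
Definition X1fun (s : C) : C := - (Afun s * / 2 * rgamma ((1 - s) / 2 + 1)).

Lemma Xfun_X1fun (s : C) : Xfun s = (s - 1) * X1fun s.
Proof.
  unfold Xfun, X1fun, Bfun. rewrite (rgamma_rec ((1 - s) / 2)). field.
Qed.

Lemma cdiff_X1fun (s : C) : cdiff X1fun s.
Proof.
  unfold X1fun. apply cdiff_opp, cdiff_mult.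
  - apply cdiff_mult; [apply cdiff_Afun|apply cdiff_const].
  - apply (cdiff_comp rgamma (fun s => (1 - s) / 2 + 1)); [apply cdiff_rgamma|].
    apply cdiff_plus; [|auto with cd]. apply cdiff_div; auto with cd. apply C2_neq_0.
Qed.

Lemma Xfun_even (m : nat) : Xfun (- RtoC (INR (2 * m))) = 0.
Proof.
  unfold Xfun, Afun. replace (- RtoC (INR (2 * m)) / 2) with (- RtoC (INR m)).
  - rewrite (proj1 (rgamma_simple_zero m)). ring.
  - rewrite mult_INR, RtoC_mult. replace (INR 2) with 2%R by (simpl; ring). field.
Qed.

Lemma not_integer_neq_1 (s : C) : ~ is_integer s -> s <> 1.
Proof. intros H E. apply H. exists 1%Z. auto. Qed.

(** Multiplying [Z_k] by [(s - 1) X^k] clears all poles, where [X = 1 / (Gamma(s/2) Gamma((1-s)/2))],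
    and the result keeps the trivial zeros of zeta. *)
Lemma Zfun_numerator (k : nat) : exists V, (forall s, cdiff V s) /\
  (forall m, (0 < m)%nat -> V (- RtoC (INR (2 * m))) = 0) /\
  forall s, ~ is_integer s -> Zfun k s = V s / ((s - 1) * Xfun s ^ k).
Proof.
  destruct omega_entire as [W [HW EW]].
  destruct zeta_entire as [E [HE1 HE2]].
  induction k as [|k [V [HV1 [HV2 HV3]]]].
  - exists E. split; [auto|split].
    + apply zeta_trivial_zeros; auto.
    + intros s Hs. assert (N := not_integer_neq_1 s Hs). simpl.
      rewrite (zeta_eq E HE1 HE2 s N). apply Csub_neq_0 in N. field. auto.
  - assert (HVd : forall s, cdiff (C_derive V) s).
    { intros s. apply cdiff_C_derive with 1%R; [lra|auto]. }
    assert (HXd : forall s, cdiff (C_derive Xfun) s).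
    { intros s. apply cdiff_C_derive with 1%R; [lra|]. intros; apply cdiff_Xfun. }
    exists (fun s => Xfun s * C_derive V s -
       V s * (X1fun s + RtoC (INR k) * C_derive Xfun s + / 2 * W s)).
    split; [|split].
    + intros s. specialize (HVd s). specialize (HXd s). specialize (HV1 s). specialize (HW s).
      assert (H1 := cdiff_Xfun s). assert (H2 := cdiff_X1fun s).
      apply cdiff_minus; apply cdiff_mult; try assumption.
      apply cdiff_plus; [apply cdiff_plus|]; try assumption;
      apply cdiff_mult; try assumption; apply cdiff_const.
    + intros m Hm. rewrite Xfun_even, HV2 by auto. ring.
    + intros s Hs. destruct (not_integer_open s Hs) as [r [Hr Hri]].
      assert (NX := Xfun_neq_0 s Hs). assert (N1 := Csub_neq_0 _ _ (not_integer_neq_1 s Hs)).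
      assert (NXk : Xfun s ^ k <> 0) by (apply Cpow_nz; auto).
      cbn [Zfun]. rewrite (EW s Hs), (HV3 s Hs).
      assert (D : cder (fun s => V s / ((s - 1) * Xfun s ^ k)) s
        ((C_derive V s * ((s - 1) * Xfun s ^ k) -
          V s * ((1 - 0) * Xfun s ^ k + (s - 1) * (RtoC (INR k) * C_derive Xfun s * Xfun s ^ k / Xfun s))) /
         ((s - 1) * Xfun s ^ k * ((s - 1) * Xfun s ^ k)))).
      { apply (cder_div V (fun s => (s - 1) * Xfun s ^ k)).
        - apply Cmult_neq_0; auto.
        - apply cdiff_derive; auto.
        - apply (cder_mult (fun s => s - 1) (fun s => Xfun s ^ k)).
          + apply cder_minus; [apply cder_id|apply cder_const].
          + apply cder_pow; auto. apply cdiff_derive, cdiff_Xfun. }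
      assert (D' := cder_ext_loc _ (Zfun k) _ _ r Hr (fun w Hw => eq_sym (HV3 w (Hri w Hw))) D).
      rewrite (cder_C_derive _ _ _ D').
      replace (X1fun s) with (Xfun s / (s - 1)) by (rewrite Xfun_X1fun; field; auto).
      simpl Cpow. field. repeat split; auto.
Qed.

Lemma CpowZ_inv_of_nat (z : C) (k : nat) : CpowZ (/ z) (Z.of_nat k) = (/ z) ^ k.
Proof.
  destruct k as [|k]; [reflexivity|]. unfold CpowZ. cbn [Z.of_nat].
  rewrite SuccNat2Pos.id_succ. reflexivity.
Qed.

(** One formula also covers [k = 0], where the exponent is [-1]. *)
Lemma CpowZ_inv_pred (z : C) (k : nat) : z <> 0 -> CpowZ (/ z) (Z.of_nat k - 1) = z * (/ z) ^ k.
Proof.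
  intros N. destruct k as [|k].
  - simpl. field. auto.
  - replace (Z.of_nat (S k) - 1)%Z with (Z.of_nat k) by lia.
    rewrite CpowZ_inv_of_nat. simpl. field. auto.
Qed.

Theorem mainTheorem1 : forall k : nat, removably_entire (xi k).
Proof.
  intros k. destruct (Zfun_numerator k) as [V [HV1 [HV2 HV3]]].
  (* Since [A s = s / 2 * H s], this is [2 A / s]: the zero of [A] at 0 is gone and those at
     [-2, -4, ...] remain. With [V = q * H] the quotient [s * V / A] becomes [2 * q], the witness
     below. *)
  set (H := fun s => rgamma (s / 2 + 1)).
  assert (Hd : forall s, cder H s (C_derive rgamma (s / 2 + 1) * / 2)).
  { intros s. eapply cder_eq.
    - apply (cder_comp rgamma (fun s => s / 2 + 1)).
      + apply cdiff_derive, cdiff_rgamma.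
      + apply cder_plus; [|apply cder_const].
        apply (cder_div (fun s => s) (fun _ => RtoC 2)); [apply C2_neq_0|apply cder_id|apply cder_const].
    - field. }
  destruct (entire_quotient V H HV1) as [q [Hq Eq]].
  { intros s. eexists. apply Hd. }
  { intros a Ha. destruct (rgamma_zero _ Ha) as [n En]. split.
    - replace a with (- RtoC (INR (2 * S n))); [apply HV2; lia|].
      replace a with (2 * ((a / 2 + 1) - 1)) by (field; apply C2_neq_0). rewrite En.
      rewrite mult_INR, (S_INR n), RtoC_mult, RtoC_plus. replace (INR 2) with 2%R by (simpl; ring). ring.
    - rewrite (cder_C_derive _ _ _ (Hd a)), En. apply Cmult_neq_0.
      + apply rgamma_simple_zero.
      + intros E. apply C1_nz. transitivity (2 * / 2); [field|rewrite E; ring]. }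
  exists (fun s => Rcpow PI (- s / 2) * (2 * q s)). split.
  - intros z. apply locally_C_eps. exists 1%R. split; [lra|]. intros w _.
    apply cdiff_ex_derive. apply cdiff_mult.
    + apply cdiff_Rcpow, cdiff_div; auto with cd. apply C2_neq_0.
    + apply cdiff_mult; auto with cd.
  - intros s Hs. unfold xi.
    rewrite (Gamma_rgamma (s / 2)) by (apply not_integer_half; auto).
    rewrite (Gamma_rgamma ((1 - s) / 2)) by (apply not_integer_half, not_integer_compl; auto).
    fold (Afun s) (Bfun s). rewrite CpowZ_inv_of_nat, CpowZ_inv_pred by (apply Afun_neq_0; auto).
    assert (NA := Afun_neq_0 s Hs). assert (NB := Bfun_neq_0 s Hs).
    rewrite !Cpow_inv by auto. rewrite (HV3 s Hs). unfold Xfun. rewrite Cpow_mult_l.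
    assert (N1 := Csub_neq_0 _ _ (not_integer_neq_1 s Hs)).
    assert (NAk : Afun s ^ k <> 0) by (apply Cpow_nz; auto).
    assert (NBk : Bfun s ^ k <> 0) by (apply Cpow_nz; auto).
    assert (EA : Afun s = s / 2 * H s) by apply rgamma_rec.
    assert (NH : H s <> 0).
    { intros E. apply NA. rewrite EA, E. ring. }
    assert (N0 : s <> 0).
    { intros E. apply Hs. exists 0%Z. auto. }
    rewrite (Eq s).
    transitivity (Rcpow PI (- s / 2) * s * (q s * H s) / Afun s).
    { field. auto. }
    rewrite EA. field. auto.
Qed.
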